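(* Let $\mu$ be a positive (Laplace-transformable) Radon measure on $\mathbb R_+$ such that $f=\mathcal L\mu$ is a potential with $f(0+)=\infty$. Let $-A$ generate a bounded $C_0$-semigroup $(T(s))_{s\ge0}$ on a Banach space $X$, and let $x,y\in X$ satisfy \[\lim_{\alpha\searrow0}\int_0^\infty e^{-\alpha s}T(s)x\,\mu(\mathrm ds)=y\quad\text{weakly}.\] Then: (a) $x=(1/f)(A)y$ and $\|\mathcal C_t(A)x\|=O\big(1/f(1/t)\big)$ as $t\to\infty$; (b) if moreover $t/f(1/t)\to\infty$ as $t\to\infty$, then $\|\mathcal C_t(A)x\|=o\big(1/f(1/t)\big)$ as $t\to\infty$.
   Context: $\mathcal L\mu(z)=\int_{\mathbb R_+}e^{-sz}\mu(\mathrm ds)$. A Bernstein function is $g(z)=a+bz+\int_{(0,\infty)}(1-e^{-sz})\nu(\mathrm ds)$ with $a,b\ge0$, $\nu$ positive Radon on $(0,\infty)$, $\int\frac{s}{1+s}\nu(\mathrm ds)<\infty$. A potential is a completely monotone function $f$ (i.e. $C^\infty$ on $(0,\infty)$ with $(-1)^nf^{(n)}\ge0$ for all $n\ge0$) of the form $f=1/g$ with $g\ne0$ a Bernstein function; $(1/f)(A)=g(A)$ is defined via the extended Hille–Phillips calculus (for $\hat\nu\in\mathcal W^+$, i.e. Laplace transforms of bounded complex measures, $\hat\nu(A)x=\int T(s)x\,\nu(\mathrm ds)$; for holomorphic $h$ on $\{\operatorname{Re}z>0\}$, $h(A):=e(A)^{-1}(eh)(A)$ on $\{x:(eh)(A)x\in\operatorname{ran}e(A)\}$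 where $e,eh\in\mathcal W^+$ and $e(A)$ injective). Cesàro means: $\mathcal C_t(A)x=\frac1t\int_0^tT(s)x\,\mathrm ds$. *)

(* Defs.v *)
From HB Require Import structures.
From mathcomp Require Import all_boot all_order all_algebra.
From mathcomp Require Import all_classical all_reals all_analysis.
From mathcomp.real_closed Require Import complex.
Import Order.TTheory GRing.Theory Num.Theory.
Import numFieldNormedType.Exports.

Set Implicit Arguments.
Unset Strict Implicit.
Unset Printing Implicit Defensive.

Local Open Scope ring_scope.
Local Open Scope classical_set_scope.

(* The complex numbers over a real type, seen as a numClosedFieldType
   (this makes the topology/normed structure of mathcomp-analysis available). *)
Definition CC (R : realType) : numClosedFieldType := R[i].

Section Defs.
Variable R : realType.

Definition cplx (a b : R) : CC R := Complex a b.
Definition Rc (r : R) : CC R := cplx r 0.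
Definition cRe (z : CC R) : R := complex.Re z.
Definition cIm (z : CC R) : R := complex.Im z.

Definition cexpn (s : R) (z : CC R) : CC R :=
  cplx (expR (- (s * cRe z)) * cos (s * cIm z))
       (- (expR (- (s * cRe z)) * sin (s * cIm z))).

Definition cintegrable (m : {measure set (measurableTypeR R) -> \bar R}) (D : set R)
  (k : R -> CC R) : Prop :=
  m.-integrable D (fun s => (cRe (k s))%:E) /\
  m.-integrable D (fun s => (cIm (k s))%:E).

Definition cint (m : {measure set (measurableTypeR R) -> \bar R}) (D : set R) (k : R -> CC R)
  : CC R :=
  cplx (Rintegral m D (fun s => cRe (k s))) (Rintegral m D (fun s => cIm (k s))).

(* ---------- bounded complex measures on R_+, via a Jordan-type decomposition
   rho = (m1 - m2) + i (m3 - m4) restricted to [0, +oo[ with m_k finite there.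
   Every bounded complex measure on R_+ is of this form. *)
Record cmeasure := CMeasure {
  cm1 : {measure set (measurableTypeR R) -> \bar R};
  cm2 : {measure set (measurableTypeR R) -> \bar R};
  cm3 : {measure set (measurableTypeR R) -> \bar R};
  cm4 : {measure set (measurableTypeR R) -> \bar R} }.

Definition bounded_cmeasure (rho : cmeasure) : Prop :=
  [/\ (cm1 rho `[0%R, +oo[ < +oo)%E, (cm2 rho `[0%R, +oo[ < +oo)%E,
      (cm3 rho `[0%R, +oo[ < +oo)%E & (cm4 rho `[0%R, +oo[ < +oo)%E].

Definition cmintegrable (rho : cmeasure) (k : R -> CC R) : Prop :=
  [/\ cintegrable (cm1 rho) `[0%R, +oo[ k, cintegrable (cm2 rho) `[0%R, +oo[ k,
      cintegrable (cm3 rho) `[0%R, +oo[ k & cintegrable (cm4 rho) `[0%R, +oo[ k].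

Definition cmint (rho : cmeasure) (k : R -> CC R) : CC R :=
  cint (cm1 rho) `[0%R, +oo[ k - cint (cm2 rho) `[0%R, +oo[ k
  + cplx 0 1 * (cint (cm3 rho) `[0%R, +oo[ k - cint (cm4 rho) `[0%R, +oo[ k).

Definition cLaplace (rho : cmeasure) (z : CC R) : CC R :=
  cmint rho (fun s => cexpn s z).

Variable X : completeNormedModType (CC R).

Definition dual_fun (phi : X -> CC R) : Prop :=
  (forall (a : CC R) (u v : X), phi (a *: u + v) = a * phi u + phi v) /\
  continuous phi.

(* z is the (weak / Pettis) integral of h over D with respect to m.
   For the integrals occurring below the Bochner integral exists and
   coincides with this one (Hahn-Banach gives uniqueness). *)
Definition is_vint (m : {measure set (measurableTypeR R) -> \bar R}) (D : set R) (h : R -> X)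
  (z : X) : Prop :=
  forall phi, dual_fun phi ->
    cintegrable m D (phi \o h) /\ phi z = cint m D (phi \o h).

Definition vint (m : {measure set (measurableTypeR R) -> \bar R}) (D : set R) (h : R -> X) : X :=
  xget 0 [set z | is_vint m D h z].

Definition is_cmvint (rho : cmeasure) (h : R -> X) (z : X) : Prop :=
  forall phi, dual_fun phi ->
    cmintegrable rho (phi \o h) /\ phi z = cmint rho (phi \o h).

Definition bounded_C0_semigroup (T : R -> X -> X) : Prop :=
  [/\ (forall s, 0 <= s -> forall (a : CC R) (u v : X),
          T s (a *: u + v) = a *: T s u + T s v),
      (forall u, T 0 u = u),
      (forall s t, 0 <= s -> 0 <= t -> forall u, T (s + t) u = T s (T t u)),
      (forall u, {within `[0%R, +oo[, continuous (fun s => T s u)}) &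
      (exists M : R, forall s u, 0 <= s -> `|T s u| <= Rc M * `|u|)].

(* Hille--Phillips calculus: for rho a bounded complex measure on R_+,
   (L rho)(A) u = \int T(s) u rho(ds), where -A generates T. *)
Definition HP (T : R -> X -> X) (rho : cmeasure) (u : X) : X :=
  xget 0 [set z | is_cmvint rho (fun s => T s u) z].

(* (rho, sigma) regularizes h : e := L rho in W^+, e h = L sigma in W^+
   (on Re z > 0), and e(A) injective. *)
Definition regularizer (T : R -> X -> X) (h : CC R -> CC R)
  (rho sigma : cmeasure) : Prop :=
  [/\ bounded_cmeasure rho, bounded_cmeasure sigma,
      (forall z : CC R, 0 < cRe z -> cLaplace sigma z = cLaplace rho z * h z) &
      injective (HP T rho)].

(* x = h(A) y in the extended Hille--Phillips calculus:
   h(A) = e(A)^{-1} (e h)(A), i.e. (e h)(A) y = e(A) x; since this does not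
   depend on the regularizer we require it for some and for every regularizer. *)
Definition hp_calc_eq (T : R -> X -> X) (h : CC R -> CC R) (y x : X) : Prop :=
  (exists rho sigma, regularizer T h rho sigma /\ HP T rho x = HP T sigma y) /\
  (forall rho sigma, regularizer T h rho sigma -> HP T rho x = HP T sigma y).

Definition cesaro_mean (T : R -> X -> X) (t : R) (u : X) : X :=
  Rc t^-1 *: vint lebesgue_measure `[0%R, t] (fun s => T s u).

End Defs.

Section Scalar.
Variable R : realType.

Definition radon_Rplus (mu : {measure set (measurableTypeR R) -> \bar R}) : Prop :=
  forall r : R, (mu `[0%R, r] < +oo)%E.

Definition laplace_transformable (mu : {measure set (measurableTypeR R) -> \bar R}) : Prop :=
  forall z : R, 0 < z -> mu.-integrable `[0%R, +oo[ (fun s => (expR (- (s * z)))%:E).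

Definition Laplace (mu : {measure set (measurableTypeR R) -> \bar R}) (z : R) : R :=
  Rintegral mu `[0%R, +oo[ (fun s => expR (- (s * z))).

Definition completely_monotone (f : R -> R) : Prop :=
  forall (n : nat) (z : R), 0 < z ->
    derivable (derive1n n f) z 1 /\ 0 <= (-1) ^+ n * derive1n n f z.

Definition bernstein_data (a b : R) (nu : {measure set (measurableTypeR R) -> \bar R}) : Prop :=
  [/\ 0 <= a, 0 <= b,
      (forall r1 r2 : R, 0 < r1 -> (nu `[r1, r2] < +oo)%E) &
      nu.-integrable `]0%R, +oo[ (fun s => (s / (1 + s))%:E)].

Definition bernstein (a b : R) (nu : {measure set (measurableTypeR R) -> \bar R}) (z : R) : R :=
  a + b * z + Rintegral nu `]0%R, +oo[ (fun s => 1 - expR (- (s * z))).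

Definition bernsteinC (a b : R) (nu : {measure set (measurableTypeR R) -> \bar R}) (z : CC R)
  : CC R :=
  Rc a + Rc b * z + cint nu `]0%R, +oo[ (fun s => Rc 1 - cexpn s z).

End Scalar.

(* Main.v *)
Require Import Defs.
From HB Require Import structures.
From mathcomp Require Import all_boot all_order all_algebra.
From mathcomp Require Import all_classical all_reals all_analysis.
From mathcomp.real_closed Require Import complex.
From mathcomp Require Import measurable_realfun.
From mathcomp Require Import ring lra.
Import Order.TTheory GRing.Theory Num.Theory.
Import numFieldNormedType.Exports.
Local Open Scope ring_scope.
Local Open Scope classical_set_scope.

(** Since f(0+) = oo forces a = 0, write g = 1/f = b z + \int (1 - e^{-sz}) nu(ds). Every vector
    is tested against functionals psi, so that T enters only through the bounded continuous
    functions h = psi (T _ u) on [0, +oo[ and the calculus only through convolution operators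
    acting on such h. A convolution operator is determined by its Laplace symbol on ]0, +oo[
    (Bernstein polynomials in e^{-s}), so operator identities reduce to scalar ones.

    Inversion: let f_al z = f (al + z) and g_al z = g (al + z). If S and E have symbols with
    lamS = g lamE, then lamS f_al + lamE (g_al - g) f_al = lamE. Applied to x this reads
    S y_al + o(1) = E x, where y_al is the Abel mean: g_al - g is the symbol of an operator of
    norm g al -> 0, and y_al is bounded by the uniform boundedness principle. In the weak limit
    S y = E x. Taking for E the regularizer gives x = g(A) y; (1 + z)^-1 is a regularizer because
    g (z) / (1 + z) is the Laplace transform of an explicit signed measure.

    Cesaro means: E = C_t gives C_t x = g(A) C_t y, and
    C_t y - T(s) C_t y = (s/t) (C_s y - T(t) C_s y) bounds its norm by a multiple of
    \int min(1, s/t) nu(ds), hence of g (1/t). For (b) one uses in addition that C_t y -> 0: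
    a functional dominated by u |-> limsup |C_t u| kills all y_al, hence y. *)

(** * Real numbers inside the complex field *)

Section ComplexScalars.
Variable R : realType.
Implicit Types r s : R.

(** The measure nu may have infinite mass near 0. An operator integrated against nu must therefore
    come with norms of order min(1, s), which dictates the Lipschitz bounds below and the way (1 -
    e^{-sz}) / (1 + z) is cut into a positive and a negative part: each has mass 1 - e^{-s}.

    A regularizer must satisfy its identity on the complex half-plane, whereas convolution operators
    only know real symbols. The inversion uses the identity at real z alone, but the pair built for
    (1 + z)^-1 needs a separate evaluation on e^{-sz} with z complex.

    The condition in (b) deals with the terms of order 1/t. The drift contributes (b/t) (y - T(t)
    y), and the times s below a fixed threshold, where C_s y is not yet small, contribute a multiple
    of (1/t) \int min(1, s) nu(ds). Both are negligible against g (1/t) once t g (1/t) -> oo. For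
    (a) it is enough that b/t <= g (1/t).

    The Abel means tend to y only weakly and u |-> limsup |C_t u| need not be weakly continuous, so
    C_t y -> 0 cannot be obtained by passing to the limit; a dominated linear functional can. That
    C_t x -> 0 is (a) combined with g (0+) = 0. *)

Lemma RcD r s : Rc (r + s) = Rc r + Rc s.
Proof. by apply/eqP; rewrite eq_complex /= addr0 !eqxx. Qed.

Lemma RcM r s : Rc (r * s) = Rc r * Rc s.
Proof. by apply/eqP; rewrite eq_complex /= !(mulr0, mul0r, subr0, addr0) !eqxx. Qed.

Lemma Rc0 : Rc (0 : R) = 0. Proof. by []. Qed.

Lemma Rc1 : Rc (1 : R) = 1. Proof. by []. Qed.

Lemma RcN r : Rc (- r) = - Rc r.
Proof. by apply/eqP; rewrite eq_complex /= oppr0 !eqxx. Qed.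

Lemma cReD (u v : CC R) : cRe (u + v) = cRe u + cRe v.
Proof. by case: u => ? ?; case: v => ? ?. Qed.

Lemma cImD (u v : CC R) : cIm (u + v) = cIm u + cIm v.
Proof. by case: u => ? ?; case: v => ? ?. Qed.

Lemma cReN (u : CC R) : cRe (- u) = - cRe u.
Proof. by case: u. Qed.

Lemma cImN (u : CC R) : cIm (- u) = - cIm u.
Proof. by case: u. Qed.

Lemma cReM (u v : CC R) : cRe (u * v) = cRe u * cRe v - cIm u * cIm v.
Proof. by case: u => ? ?; case: v => ? ?. Qed.

Lemma cImM (u v : CC R) : cIm (u * v) = cRe u * cIm v + cIm u * cRe v.
Proof. by case: u => ? ?; case: v => ? ?. Qed.

Lemma CC_eqP (u v : CC R) : cRe u = cRe v -> cIm u = cIm v -> u = v.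
Proof. by case: u => ? ?; case: v => ? ? /= -> ->. Qed.

Lemma ler_Rc r s : (Rc r <= Rc s) = (r <= s).
Proof. by rewrite lecE /= eqxx. Qed.

Lemma ltr_Rc r s : (Rc r < Rc s) = (r < s).
Proof. by rewrite ltcE /= eqxx. Qed.

Lemma Rc_cRe (u : CC R) : 0 <= u -> Rc (cRe u) = u.
Proof. by case: u => p q; rewrite lecE /= => /andP[/eqP -> _]. Qed.

Lemma norm_Rc r : `|Rc r| = Rc `|r|.
Proof. by apply: CC_eqP => //=; rewrite expr0n /= addr0 sqrtr_sqr. Qed.

End ComplexScalars.

(** * The Hahn-Banach theorem for sublinear functionals *)

Section Sublinear.
Variables (R : realType) (V : lmodType (CC R)).
Implicit Types (p q : V -> R) (u v : V).

(** Only real scalars [Rc r] enter, so a complex space serves as a real one without a change of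
    structure. *)
Definition sublinear p :=
  (forall u v, p (u + v) <= p u + p v) /\
  (forall r u, 0 <= r -> p (Rc r *: u) = r * p u).

Lemma sublinear0 {p} : sublinear p -> p 0 = 0.
Proof. by case=> _ /(_ 0 0 (lexx 0)); rewrite mul0r scaler0. Qed.

Lemma sublinear_opp p : sublinear p -> forall u, - p (- u) <= p u.
Proof.
by move=> sp u; rewrite lerNl -subr_ge0 opprK addrC -[leLHS](sublinear0 sp) -(addNr u) addrC;
  case: sp => + _; exact.
Qed.

(** For [q] sublinear, this is the largest sublinear functional below [q] whose value at [- v] is at
    most [- q v]. *)
Definition shave q v u := inf [set q (u + Rc t *: v) - t * q v | t in `[0%R, +oo[%classic].

Section Shave.
Variables (q : V -> R) (v : V).
Hypothesis sq : sublinear q.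

Let E u := [set q (u + Rc t *: v) - t * q v | t in `[0%R, +oo[%classic].

Let E_ge u : lbound (E u) (- q (- u)).
Proof.
move=> x [t]; rewrite /= in_itv/= andbT => t0 <-.
have [sub hom] := sq; have := sub (u + Rc t *: v) (- u).
by rewrite addrAC subrr add0r (hom _ _ t0) => ?; lra.
Qed.

Let hasinfE u : has_inf (E u).
Proof.
split; last by exists (- q (- u)); exact: E_ge.
by exists (q (u + Rc 0 *: v) - 0 * q v), 0 => //=; rewrite in_itv/= lexx.
Qed.

Lemma shave_le u t : 0 <= t -> shave q v u <= q (u + Rc t *: v) - t * q v.
Proof.
move=> t0; apply: ge_inf; first by exists (- q (- u)); exact: E_ge.
by exists t => //=; rewrite in_itv/= andbT.
Qed.

Lemma shave_leq u : shave q v u <= q u.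
Proof. by have := shave_le u 0 (lexx _); rewrite scale0r addr0 mul0r subr0. Qed.

Lemma shave_ge u m : (forall t, 0 <= t -> m <= q (u + Rc t *: v) - t * q v) ->
  m <= shave q v u.
Proof.
move=> h; apply: lb_le_inf; first by case: (hasinfE u).
by move=> x [t]; rewrite /= in_itv/= andbT => t0 <-; exact: h.
Qed.

Lemma sublinear_shave : sublinear (shave q v).
Proof.
have [sub hom] := sq.
have sh0 : shave q v 0 = 0.
  apply/le_anti/andP; split; first by have := shave_leq 0; rewrite (sublinear0 sq).
  by apply: shave_ge => t t0; rewrite add0r hom// subrr.
split=> [u w|r u]; last first.
  rewrite le_eqVlt => /predU1P[<-|r0]; first by rewrite scale0r mul0r sh0.
  (* Replacing t by s t in the infimum gives one inequality; the other is the same one for the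
     inverse factor. *)
  have key s w : 0 < s -> shave q v (Rc s *: w) <= s * shave q v w.
    move=> s0; rewrite -ler_pdivrMl//; apply: shave_ge => t t0.
    rewrite ler_pdivrMl//.
    apply: le_trans (shave_le _ (s * t) (mulr_ge0 (ltW s0) t0)) _.
    by rewrite RcM -scalerA -scalerDr (hom _ _ (ltW s0)) mulrBr mulrA lexx.
  apply/le_anti/andP; split; first exact: key.
  rewrite mulrC -ler_pdivlMr//.
  have ri : 0 < r^-1 by rewrite invr_gt0.
  by have := key _ (Rc r *: u) ri; rewrite scalerA -RcM mulVf ?gt_eqF// Rc1 scale1r mulrC.
rewrite -lerBlDr; apply: shave_ge => t t0.
rewrite lerBlDr -lerBlDl; apply: shave_ge => s s0; rewrite lerBlDl.
apply: le_trans (shave_le _ (t + s) (addr_ge0 t0 s0)) _.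
have := sub (u + Rc t *: v) (w + Rc s *: v).
have -> : u + Rc t *: v + (w + Rc s *: v) = u + w + Rc (t + s) *: v.
  by rewrite RcD scalerDl addrACA.
by move=> ?; lra.
Qed.

End Shave.

Definition real_linear p :=
  (forall u v, p (u + v) = p u + p v) /\ (forall r u, p (Rc r *: u) = r * p u).

(** Minimality forces [shave q v = q] for every [v], and the competitor t = 1 in the infimum then
    says q u + q v <= q (u + v). *)
Lemma minimal_sublinear_linear q : sublinear q ->
  (forall q', sublinear q' -> (forall u, q' u <= q u) -> q' = q) -> real_linear q.
Proof.
move=> sq qmin; have [sub hom] := sq.
have add u v : q (u + v) = q u + q v.
  apply/le_anti/andP; split=> //.
  have := shave_le q v sq u 1 ler01.
  rewrite (qmin _ (sublinear_shave _ _ sq) (shave_leq _ _ sq)) Rc1 scale1r mul1r.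
  by move=> ?; lra.
have opp u : q (- u) = - q u.
  by apply/eqP; rewrite -addr_eq0 -add addNr (sublinear0 sq).
split=> // r u; have [r0|r0] := leP 0 r; first exact: hom.
by rewrite -[r]opprK RcN scaleNr opp hom ?mulNr// oppr_ge0 ltW.
Qed.

Theorem Hahn_Banach_sublinear p : sublinear p ->
  exists2 l, real_linear l & forall u, l u <= p u.
Proof.
move=> sp.
pose T := {q : V -> R | sublinear q /\ forall u, q u <= p u}.
(* The order is reversed: maximal for [R'] means minimal as a functional, and a chain is bounded by
   its pointwise infimum, finite because all members lie above [- p (- u)]. *)
pose R' (q1 q2 : T) := `[< forall u, sval q2 u <= sval q1 u >].
have Teq (s t : T) : sval s = sval t -> s = t.
  case: s t => [s s_] [t t_] /= st; subst t; congr exist; exact: Prop_irrelevance.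
have [||||[q [sq qp]] qmax] := @Zorn T R'.
- by move=> t; apply/asboolP.
- move=> r s t /asboolP rs /asboolP st; apply/asboolP => u.
  exact: le_trans (st u) (rs u).
- move=> s t /asboolP st /asboolP ts; apply: Teq; apply/funext => u.
  by apply/le_anti/andP.
- move=> A totA.
  have [[t0 At0]|A0] := pselect (A !=set0); last first.
    have pT : sublinear p /\ forall u, p u <= p u by [].
    exists (exist _ p pT) => s As; exfalso; apply: A0; by exists s.
  pose E u := [set sval t u | t in A].
  have Elb u : lbound (E u) (- p (- u)).
    move=> x [t At <-]; case: t At => /= q [sq qp] _.
    by apply: le_trans (sublinear_opp q sq u); rewrite lerN2.
  have Ei u : has_inf (E u).
    by split; [exists (sval t0 u), t0 | exists (- p (- u))].
  pose m u := inf (E u).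
  have mle t u : A t -> m u <= sval t u.
    by move=> At; apply: ge_inf; [exists (- p (- u)); exact: Elb|exists t].
  have mge z u : (forall t, A t -> z <= sval t u) -> z <= m u.
    move=> h; apply: lb_le_inf; first by case: (Ei u).
    by move=> x [t At <-]; exact: h.
  have sm : sublinear m.
    split=> [u w|r u r0]; last first.
      have [->|rn0] := eqVneq r 0.
        rewrite scale0r mul0r; apply/le_anti/andP; split.
          by apply: le_trans (mle _ _ At0) _; rewrite (sublinear0 (svalP t0).1).
        by apply: mge => t At; rewrite (sublinear0 (svalP t).1).
      have rp : 0 < r by rewrite lt_neqAle eq_sym rn0.
      apply/le_anti/andP; split.
        rewrite -ler_pdivrMl//; apply: mge => t At; rewrite ler_pdivrMl//.
        by apply: le_trans (mle _ _ At) _; rewrite (svalP t).1.2.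
      apply: mge => t At; rewrite (svalP t).1.2// ler_pM2l//; exact: mle.
    rewrite -lerBlDr; apply: (mge) => t At.
    rewrite lerBlDr -lerBlDl; apply: mge => s As; rewrite lerBlDl.
    (* Subadditivity holds for one member at a time; the chain supplies the smaller of [s] and [t]
       for both arguments. *)
    have [/asboolP ts|/asboolP st] := totA t s At As.
      apply: le_trans (mle _ _ As) _.
      by apply: le_trans ((svalP s).1.1 _ _) _; rewrite lerD2r.
    apply: le_trans (mle _ _ At) _.
    by apply: le_trans ((svalP t).1.1 _ _) _; rewrite lerD2l.
  have mp u : m u <= p u by apply: le_trans (mle _ _ At0) _; exact: (svalP t0).2.
  by exists (exist _ m (conj sm mp)) => s As; apply/asboolP => u; exact: mle.
exists q => //; apply: minimal_sublinear_linear => // q' sq' q'q.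
have q'p u : q' u <= p u by exact: le_trans (q'q u) (qp u).
have := qmax (exist _ q' (conj sq' q'p)).
by move=> h; have /(congr1 sval) := h (asboolT q'q).
Qed.

(** Domination by [shave p v] instead of [p] yields l (- v) <= - p v, which is the missing
    inequality at [v]. *)
Theorem Hahn_Banach_supporting p v : sublinear p ->
  exists2 l, real_linear l & (forall u, l u <= p u) /\ l v = p v.
Proof.
move=> sp; have [l ll lp] := Hahn_Banach_sublinear _ (sublinear_shave p v sp).
have lep u : l u <= p u by apply: le_trans (lp u) (shave_leq p v sp u).
exists l => //; split=> //; apply/le_anti/andP; split=> //.
have := le_trans (lp (- v)) (shave_le p v sp (- v) 1 ler01).
rewrite Rc1 scale1r addNr (sublinear0 sp) mul1r sub0r.
suff -> : l (- v) = - l v by rewrite lerN2.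
by rewrite -[- v]scaleN1r -[-1]/(- Rc 1) -RcN ll.2 mulN1r.
Qed.

End Sublinear.

(** * Bounded real-linear functionals on a complex Banach space *)

Section RealDual.
Variables (R : realType) (X : completeNormedModType (CC R)).
Implicit Types (u v : X) (psi : X -> R).

(** The norm of a module over [CC R] is itself a complex number, determined by its real part since
    it is nonnegative. *)
Definition nrm u : R := cRe `|u|.

Lemma normE u : `|u| = Rc (nrm u).
Proof. by rewrite /nrm Rc_cRe. Qed.

Lemma nrm_ge0 u : 0 <= nrm u.
Proof. by rewrite -ler_Rc -normE normr_ge0. Qed.

Lemma nrmD u v : nrm (u + v) <= nrm u + nrm v.
Proof. by rewrite -ler_Rc RcD -!normE ler_normD. Qed.

Lemma nrmZ r u : nrm (Rc r *: u) = `|r| * nrm u.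
Proof. by rewrite /nrm normrZ norm_Rc normE cReM /= mul0r subr0. Qed.

Lemma nrmN u : nrm (- u) = nrm u. Proof. by rewrite /nrm normrN. Qed.

Lemma nrm0 : nrm 0 = 0. Proof. by rewrite /nrm normr0. Qed.

Lemma nrm0_eq0 u : nrm u = 0 -> u = 0.
Proof. by move=> u0; apply/eqP; rewrite -normr_eq0 normE u0. Qed.

(** Hahn-Banach delivers real-linear functionals. The bound is kept as a parameter because norm
    estimates run over functionals with bound 1 and composition with the semigroup changes it. *)
Definition rdual (K : R) psi :=
  [/\ 0 <= K, real_linear R X psi & forall u, `|psi u| <= K * nrm u].

Lemma sublinear_nrm : sublinear R X nrm.
Proof. by split=> [|r u r0]; [exact: nrmD|rewrite nrmZ ger0_norm]. Qed.

Section Linear.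
Variables (psi : X -> R) (lpsi : real_linear R X psi).

Lemma rlin0 : psi 0 = 0. Proof. by rewrite -[0](scale0r 0) -Rc0 lpsi.2 mul0r. Qed.

Lemma rlinN u : psi (- u) = - psi u.
Proof. by apply/eqP; rewrite -addr_eq0 -lpsi.1 addNr rlin0. Qed.

Lemma rlinB u v : psi (u - v) = psi u - psi v. Proof. by rewrite lpsi.1 rlinN. Qed.

Lemma rlin_sum (I : Type) (s : seq I) (P : pred I) (F : I -> X) :
  psi (\sum_(i <- s | P i) F i) = \sum_(i <- s | P i) psi (F i).
Proof. exact: (big_morph psi lpsi.1 rlin0). Qed.

End Linear.

Lemma rdual_dominated (c : R) (p psi : X -> R) : 0 <= c -> real_linear R X psi ->
  (forall u, psi u <= p u) -> (forall u, p u <= c * nrm u) -> rdual c psi.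
Proof.
move=> c0 l lp pc; split=> // u; rewrite ler_norml (le_trans (lp u))// andbT.
by rewrite lerNl -rlinN// -nrmN (le_trans (lp _)).
Qed.

Lemma norming_functional u : exists2 psi, rdual 1 psi & psi u = nrm u.
Proof.
have [l ll [lp lu]] := Hahn_Banach_supporting R X nrm u sublinear_nrm.
exists l => //; apply: (rdual_dominated _ nrm) => // v.
by rewrite mul1r.
Qed.

Lemma nrm_le_dual u (c : R) : (forall psi, rdual 1 psi -> psi u <= c) -> nrm u <= c.
Proof. by have [psi dpsi <-] := norming_functional u; exact. Qed.

Lemma rdual_separated u v : (forall psi, rdual 1 psi -> psi u = psi v) -> u = v.
Proof.
move=> h; apply/eqP; rewrite -subr_eq0; apply/eqP/nrm0_eq0.
apply/le_anti; rewrite nrm_ge0 andbT; apply: nrm_le_dual => psi dpsi.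
by have [_ l _] := dpsi; rewrite rlinB// h// subrr.
Qed.

Definition ii : CC R := cplx 0 1.

(** The complex-linear functional with real part [psi] (Bohnenblust and Sobczyk). It makes
    statements about [dual_fun] available for real functionals. *)
Definition complexify psi u : CC R := cplx (psi u) (- psi (ii *: u)).

Lemma complexify_dual K psi : rdual K psi -> dual_fun (complexify psi).
Proof.
move=> [K0 l b].
have lin (z : CC R) u v :
    complexify psi (z *: u + v) = z * complexify psi u + complexify psi v.
  have scale_split (w : X) : z *: w = Rc (cRe z) *: w + Rc (cIm z) *: (ii *: w).
    rewrite scalerA -scalerDl; congr (_ *: _); apply: CC_eqP.
      by rewrite cReD cReM /=; ring.
    by rewrite cImD cImM /=; ring.
  have psiZ w : psi (z *: w) = cRe z * psi w + cIm z * psi (ii *: w).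
    by rewrite scale_split l.1 !l.2.
  have iiii (w : X) : psi (ii *: (ii *: w)) = - psi w.
    rewrite -rlinN// scalerA -[- w]scaleN1r; congr (psi (_ *: _)).
    by apply: CC_eqP; rewrite ?cReM ?cImM /=; ring.
  have comm : ii *: (z *: u) = z *: (ii *: u) by rewrite !scalerA mulrC.
  apply: CC_eqP.
    by rewrite cReD cReM /= l.1 psiZ; ring.
  by rewrite cImD cImM /= scalerDr l.1 comm psiZ iiii; ring.
split=> //.
(* The factor 2 is crude; only continuity is at stake. *)
have bound u : `|complexify psi u| <= Rc (2 * K) * `|u|.
  have -> : complexify psi u = Rc (psi u) - ii * Rc (psi (ii *: u)).
    by apply: CC_eqP; rewrite ?cReD ?cImD ?cReN ?cImN ?cReM ?cImM /=; ring.
  have nii : `|ii| = 1 by apply: CC_eqP; rewrite //= expr0n expr1n /= add0r sqrtr1.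
  apply: le_trans (ler_normB _ _) _; rewrite normrM nii mul1r !norm_Rc -RcD.
  rewrite normE -RcM ler_Rc.
  have := b (ii *: u); rewrite /nrm normrZ nii mul1r -/(nrm u).
  by have := b u; lra.
have lB u v : complexify psi (u - v) = complexify psi u - complexify psi v.
  by rewrite addrC -scaleN1r lin mulN1r addrC.
move=> u; apply/cvgrPdist_lt => e e0.
have K1 : 0 < Rc (2 * K + 1) :> CC R by rewrite -Rc0 ltr_Rc; lra.
near=> v.
rewrite -lB; apply: le_lt_trans (bound _) _.
apply: (@le_lt_trans _ _ (Rc (2 * K + 1) * `|u - v|)).
  by rewrite ler_wpM2r// ler_Rc; lra.
rewrite mulrC -ltr_pdivlMr//; near: v.
by apply: cvgr_dist_lt; rewrite ?divr_gt0.
Unshelve. all: by end_near. Qed.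

Lemma dual_fun_bounded (phi : X -> CC R) : dual_fun phi ->
  exists2 K : R, 0 <= K & forall u, `|phi u| <= Rc (K * nrm u).
Proof.
move=> [lin cphi].
have lin0 : phi 0 = 0.
  by have := lin (-1) 0 0; rewrite scaler0 addr0 mulN1r addNr.
have linZ (z : CC R) u : phi (z *: u) = z * phi u by rewrite -[_ *: _]addr0 lin lin0 addr0.
have : \forall t \near (0 : X), `|phi 0 - phi t| < 1.
  by have /cvgrPdist_lt := cphi 0; apply.
move=> /nbhs_ballP[e /= e0 he].
have eE : e = Rc (cRe e) by rewrite Rc_cRe// ltW.
have e'0 : 0 < cRe e by rewrite -ltr_Rc -eE.
exists (2 / cRe e) => [|u]; first by rewrite divr_ge0// ltW.
have [u0|un0] := eqVneq (nrm u) 0.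
  by rewrite (nrm0_eq0 _ u0) lin0 normr0 nrm0 mulr0.
have u0 : 0 < nrm u by rewrite lt_neqAle eq_sym un0 nrm_ge0.
(* Rescales [u] to norm [cRe e / 2], inside the ball where [phi] stays below 1; hence the constant
   [2 / cRe e]. *)
set c := cRe e / (2 * nrm u).
have c0 : 0 < c by rewrite divr_gt0// mulr_gt0.
have /he : ball (0 : X) e (Rc c *: u).
  rewrite -ball_normE /ball_ /= sub0r normrN normE nrmZ gtr0_norm// eE ltr_Rc.
  have -> : c * nrm u = cRe e / 2 by rewrite /c; field.
  lra.
rewrite /= lin0 sub0r normrN linZ normrM norm_Rc (gtr0_norm c0) => /ltW.
have -> : 2 / cRe e * nrm u = c^-1 by rewrite /c invf_div mulrAC.
rewrite -[X in _ * X]Rc_cRe// -RcM -[leRHS]/(Rc 1) ler_Rc => h.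
by rewrite -[leLHS]Rc_cRe// ler_Rc -[c^-1]mul1r ler_pdivlMr// mulrC.
Qed.

Lemma cRe_norm_le (z : CC R) : `|cRe z| <= cRe `|z|.
Proof.
case: z => p q /=; rewrite -{1}sqrtr_sqr ler_wsqrtr//.
by rewrite lerDl sqr_ge0.
Qed.

Lemma cIm_norm_le (z : CC R) : `|cIm z| <= cRe `|z|.
Proof.
case: z => p q /=; rewrite -{1}sqrtr_sqr ler_wsqrtr//.
by rewrite lerDr sqr_ge0.
Qed.

Lemma rdual_cRe (phi : X -> CC R) : dual_fun phi ->
  exists K, rdual K (fun u => cRe (phi u)).
Proof.
move=> dphi; have [lin _] := dphi; have [K K0 bK] := dual_fun_bounded _ dphi.
exists K; split=> //.
  split=> [u v|r u]; first by rewrite -[u]scale1r lin mul1r scale1r cReD.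
  have lin0 : phi 0 = 0 by have := lin (-1) 0 0; rewrite scaler0 addr0 mulN1r addNr.
  by rewrite -[_ *: _]addr0 lin lin0 addr0 cReM /= mul0r subr0.
by move=> u; apply: le_trans (cRe_norm_le _) _; rewrite -ler_Rc Rc_cRe// bK.
Qed.

Lemma rdual_cIm (phi : X -> CC R) : dual_fun phi ->
  exists K, rdual K (fun u => cIm (phi u)).
Proof.
move=> dphi; have [lin _] := dphi; have [K K0 bK] := dual_fun_bounded _ dphi.
exists K; split=> //.
  split=> [u v|r u]; first by rewrite -[u]scale1r lin mul1r scale1r cImD.
  have lin0 : phi 0 = 0 by have := lin (-1) 0 0; rewrite scaler0 addr0 mulN1r addNr.
  by rewrite -[_ *: _]addr0 lin lin0 addr0 cImM /= mul0r addr0.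
by move=> u; apply: le_trans (cIm_norm_le _) _; rewrite -ler_Rc Rc_cRe// bK.
Qed.

Lemma nrm_complete (z : nat -> X) :
  (forall e, 0 < e -> exists N, forall n m, (N <= n)%N -> (N <= m)%N ->
     nrm (z n - z m) <= e) ->
  exists l, forall e, 0 < e -> exists N, forall n, (N <= n)%N -> nrm (l - z n) <= e.
Proof.
move=> h.
have cz : cvg (z @ \oo).
  apply/cauchy_cvgP/cauchy_exP => e e0.
  have eE : e = Rc (cRe e) by rewrite Rc_cRe// ltW.
  have e'0 : 0 < cRe e / 2 by rewrite divr_gt0// -ltr_Rc -eE.
  have [N hN] := h _ e'0; exists (z N), N => // n /= Nn.
  rewrite -ball_normE /ball_ /= normE eE ltr_Rc.
  by apply: le_lt_trans (hN _ _ _ Nn) _ => //; lra.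
exists (lim (z @ \oo)) => e e0.
have /cvgrPdist_le/(_ (Rc e)) : z @ \oo --> lim (z @ \oo) by [].
rewrite -Rc0 ltr_Rc => /(_ e0) [N _ hN]; exists N => n Nn.
by have := hN n Nn; rewrite /= normE ler_Rc.
Qed.

End RealDual.

(** * Weakly bounded sequences are bounded, by a gliding hump *)

Section UniformBoundedness.
Variables (R : realType) (X : completeNormedModType (CC R)).

Lemma real_sequence_bounded_limit (p : nat -> R) (C : R) :
  (forall k j, `|p (k + j)%N - p k| <= C / 3 ^+ k) ->
  p @ \oo --> lim (p @ \oo) /\ forall k, `|lim (p @ \oo) - p k| <= C / 3 ^+ k.
Proof.
move=> h.
have C0 : 0 <= C by have := le_trans (normr_ge0 _) (h 0%N 0%N); rewrite expr0 divr1.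
have cp : cvg (p @ \oo).
  apply/cauchy_cvgP/cauchy_exP => e e0.
  have [N hN] : exists N, C / 3 ^+ N < e.
    have h3 : 0 <= (3^-1 : R) < 1 by apply/andP; split; lra.
    have /cvgrPdist_lt/(_ (e / (C + 1))) : (fun n => (3^-1 : R) ^+ n) @ \oo --> 0.
      by apply: cvg_expr; rewrite ger0_norm; case/andP: h3.
    rewrite divr_gt0// ?ltr_wpDl// => /(_ isT)[N _ /(_ N (leqnn N))] /=.
    rewrite sub0r normrN ger0_norm ?exprn_ge0// ltr_pdivlMr ?ltr_wpDl// => lte.
    exists N; apply: le_lt_trans lte; rewrite mulrC exprVn ler_wpM2l ?invr_ge0 ?exprn_ge0//.
    by rewrite lerDl.
  exists (p N), N => // n /= Nn; rewrite -ball_normE /ball_ /= distrC -(subnKC Nn).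
  exact: le_lt_trans (h _ _) hN.
split=> // k; apply: (@ler_cvg_to _ (\oo) _ _ (fun j => `|p j - p k|) (fun=> C / 3 ^+ k)).
- apply: cvg_norm; apply: cvgB => //; exact: cvg_cst.
- exact: cvg_cst.
- by exists k => // n /= kn; rewrite -(subnKC kn).
Qed.

(* A sequence of bounded functionals psi k is built with increments of size 3^-k, the sign
   of each increment being chosen so that nothing cancels at the k-th vector. *)
Theorem weakly_bounded_sequence (y : nat -> X) :
  (forall psi K, rdual R X K psi -> exists B : R, forall n, `|psi (y n)| <= B) ->
  exists B : R, forall n, nrm R X (y n) <= B.
Proof.
move=> wb; apply: contrapT => unb.
(* The increment of index k has size |y| / 3^(k+1) on the chosen vector and all later ones together
   at most half of that. What survives is |y| / (6 3^k), so the factor 6 makes it at least k. *)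
have /choice[z hz] : forall k : nat, exists n, 6 * 3 ^+ k * k%:R <= nrm R X (y n).
  move=> k; apply: contrapT => hk; apply: unb; exists (6 * 3 ^+ k * k%:R) => n.
  by rewrite leNgt; apply/negP => /ltW lt; apply: hk; exists n.
have /choice[L hL] : forall k, exists l, rdual R X 1 l /\ l (y (z k)) = nrm R X (y (z k)).
  by move=> k; have [l ? ?] := norming_functional R X (y (z k)); exists l.
(* The value at 0 is 1, so that the increment has full size even where the partial sum vanishes. *)
pose sg (r : R) : R := if 0 <= r then 1 else -1.
have sg1 r : `|sg r| = 1 by rewrite /sg; case: ifP; rewrite ?normrN normr1.
have sgD r s : 0 <= s -> s <= `|r + sg r * s|.
  by rewrite /sg; case: (leP 0 r) => r0 s0; [rewrite ger0_norm|rewrite ltr0_norm]; lra.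
pose P := fix P k u : R :=
  if k is k'.+1 then P k' u + sg (P k' (y (z k'))) * (L k' u / 3 ^+ k'.+1) else 0.
have Pl k : real_linear R X (P k).
  elim: k => [|k [IH1 IH2]]; first by split=> *; rewrite /= ?addr0 ?mulr0.
  have [[_ [L1 L2] _] _] := hL k.
  by split=> [u v|r u]; rewrite [LHS]/= ?IH1 ?IH2 ?L1 ?L2 [RHS]/=; ring.
have Pd k j u : `|P (k + j)%N u - P k u| <= nrm R X u / 2 / 3 ^+ k * (1 - 3^-1 ^+ j).
  elim: j => [|j IH]; first by rewrite addn0 !subrr normr0 mulr0.
  rewrite addnS [P _.+1 u]/= addrAC; apply: le_trans (ler_normD _ _) _.
  have [[_ _ Lb] _] := hL (k + j)%N; rewrite normrM sg1 mul1r normrM.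
  have e3 : 0 < (3 ^+ (k + j).+1)^-1 :> R by rewrite invr_gt0 exprn_gt0.
  rewrite (gtr0_norm e3).
  have L' : `|L (k + j)%N u| / 3 ^+ (k + j).+1 <= nrm R X u / 3 ^+ (k + j).+1.
    by rewrite ler_pM2r//; have := Lb u; rewrite mul1r.
  apply: le_trans (lerD IH L') _.
  rewrite exprS exprD !exprVn exprS.
  have a0 : (3 ^+ k : R) != 0 by rewrite expf_neq0.
  have b0 : (3 ^+ j : R) != 0 by rewrite expf_neq0.
  by rewrite le_eqVlt; apply/orP; left; apply/eqP; field; rewrite a0 b0.
have Pd' u k j : `|P (k + j)%N u - P k u| <= nrm R X u / 2 / 3 ^+ k.
  have c0 : 0 <= nrm R X u / 2 / 3 ^+ k.
    by rewrite !mulr_ge0 ?nrm_ge0// invr_ge0 exprn_ge0.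
  have j0 : 0 <= 3^-1 ^+ j :> R by rewrite exprn_ge0.
  by apply: le_trans (Pd k j u) _; rewrite ler_piMr//; lra.
pose psi u := lim ((P ^~ u) @ \oo).
have psic u : (P ^~ u) @ \oo --> psi u by have [] := real_sequence_bounded_limit _ _ (Pd' u).
have psib u k : `|psi u - P k u| <= nrm R X u / 2 / 3 ^+ k.
  by have [_] := real_sequence_bounded_limit _ _ (Pd' u); exact.
have dpsi : rdual R X 1 psi.
  split=> //.
    split=> [u v|r u]; apply/cvg_lim => //.
      rewrite (_ : P ^~ (u + v) = (fun k => P k u + P k v)); first exact: cvgD.
      by apply/funext => k; rewrite (Pl k).1.
    rewrite (_ : P ^~ (Rc r *: u) = (fun k => r * P k u)); first exact: cvgMr.
    by apply/funext => k; rewrite (Pl k).2.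
  move=> u; have := psib u 0%N; rewrite expr0 divr1 /= subr0.
  by have := nrm_ge0 _ X u; lra.
have [B hB] := wb _ _ dpsi.
have [k Bk] : exists k : nat, B < k%:R.
  by exists (Num.bound `|B|); apply: le_lt_trans (ler_norm B) (archi_boundP (normr_ge0 B)).
have [_ Lz] := hL k.
set nz := nrm R X (y (z k)) in Lz *.
have e3 : 0 < (3 ^+ k : R) by rewrite exprn_gt0.
have h1 : nz / 3 ^+ k.+1 <= `|P k.+1 (y (z k))|.
  by rewrite /= Lz; apply: sgD; rewrite divr_ge0// ?nrm_ge0// mulr_ge0// ltW.
have h2 := psib (y (z k)) k.+1; rewrite -/nz in h2.
have h3 := hB (z k).
have h4 : `|P k.+1 (y (z k))| <= `|psi (y (z k))| + `|psi (y (z k)) - P k.+1 (y (z k))|.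
  by rewrite -[X in `|X| <= _](subKr (psi (y (z k)))) ler_normB.
have h5 : k%:R <= nz / 2 / 3 ^+ k.+1.
  by rewrite exprS ler_pdivlMr ?mulr_gt0//; have := hz k; rewrite -/nz; lra.
have h6 : nz / 3 ^+ k.+1 = nz / 2 / 3 ^+ k.+1 + nz / 2 / 3 ^+ k.+1 by rewrite exprS; field; rewrite gt_eqF.
lra.
Qed.

End UniformBoundedness.

(** * Integrable real functions, domination and dominated convergence *)

Section RealIntegrals.
Variables (R : realType) (m : {measure set (measurableTypeR R) -> \bar R}) (D : set R).
Hypothesis mD : measurable (D : set (measurableTypeR R)).
Implicit Types f g : R -> R.

Definition iint f := m.-integrable D (fun s => (f s)%:E).

Lemma iint_measurable f : iint f -> measurable_fun D (f : measurableTypeR R -> R).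
Proof. by move=> /integrableP[/measurable_EFinP]. Qed.

Lemma iint_dominated f g : measurable_fun D (f : measurableTypeR R -> R) ->
  (forall s, D s -> `|f s| <= g s) -> iint g -> iint f.
Proof.
move=> mf fg ig; apply: le_integrable ig => //; first exact/measurable_EFinP.
by move=> s Ds; rewrite /= lee_fin (le_trans (fg _ Ds))// ler_norm.
Qed.

Lemma iintD f g : iint f -> iint g -> iint (fun s => f s + g s).
Proof. by move=> i1 i2; have := integrableD mD i1 i2. Qed.

Lemma iintZ (c : R) f : iint f -> iint (fun s => c * f s).
Proof. by move=> i; have := integrableZl mD c i. Qed.

Lemma iintN f : iint f -> iint (fun s => - f s).
Proof.
by move=> /(iintZ (-1)) i; rewrite (_ : (fun _ => _) = fun s => -1 * f s)//;
  apply/funext => s; rewrite mulN1r.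
Qed.

Lemma iintB f g : iint f -> iint g -> iint (fun s => f s - g s).
Proof. by move=> i1 i2; apply: iintD => //; exact: iintN. Qed.

Lemma Rintegral_dominated f g : measurable_fun D (f : measurableTypeR R -> R) ->
  (forall s, D s -> `|f s| <= g s) -> iint g ->
  `|Rintegral m D f| <= Rintegral m D g.
Proof.
move=> mf fg ig; have i := iint_dominated _ _ mf fg ig.
apply: le_trans (le_normr_Rintegral _ _) _ => //; apply: le_Rintegral => //.
apply: iint_dominated ig => [|s Ds]; last by rewrite normr_id fg.
exact: measurableT_comp.
Qed.

Lemma iint_sum (N : nat) (F : nat -> R -> R) : (forall i, iint (F i)) ->
  iint (fun s => \sum_(i < N) F i s).
Proof.
move=> iF; elim: N => [|N IH].
  rewrite (_ : (fun _ => _) = fun=> 0); last by apply/funext => s; rewrite big_ord0.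
  exact: integrable0.
rewrite (_ : (fun _ => _) = fun s => \sum_(i < N) F i s + F N s).
  exact: iintD.
by apply/funext => s; rewrite big_ord_recr.
Qed.

Lemma Rintegral_sum (N : nat) (F : nat -> R -> R) : (forall i, iint (F i)) ->
  Rintegral m D (fun s => \sum_(i < N) F i s) = \sum_(i < N) Rintegral m D (F i).
Proof.
move=> iF; elim: N => [|N IH].
  rewrite big_ord0 -[RHS](mul0r (fine (m D))) -Rintegral_cst//.
  by apply: eq_Rintegral => s _; rewrite big_ord0.
rewrite big_ord_recr/= -IH -(RintegralD mD (iint_sum N F iF) (iF N)).
by apply: eq_Rintegral => s _; rewrite big_ord_recr.
Qed.

Lemma Rintegral_dominated_cvg (f_ : nat -> R -> R) f g :
  (forall n, measurable_fun D (f_ n : measurableTypeR R -> R)) ->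
  (forall n s, D s -> `|f_ n s| <= g s) -> iint g ->
  (forall s, D s -> f_ ^~ s @ \oo --> f s) ->
  Rintegral m D (f_ n) @[n --> \oo] --> Rintegral m D f.
Proof.
move=> mf fg ig ff.
have mlim : measurable_fun D (f : measurableTypeR R -> R).
  exact: (@measurable_fun_cvg _ _ _ D f_ f).
have ilim : iint f.
  apply: (iint_dominated _ g) => // s Ds.
  apply: (@ler_cvg_to _ \oo _ _ (fun n => `|f_ n s|) (fun=> g s)).
  - by apply: cvg_norm; exact: ff.
  - exact: cvg_cst.
  - by apply: nearW => n; exact: fg.
apply: (@fine_cvg R nat \oo _ (fun n => \int[m]_(x in D) (f_ n x)%:E)%E (Rintegral m D f)).
rewrite /Rintegral fineK; last exact: integrable_fin_num.
apply: (@dominated_cvg _ _ R m D mD (fun n s => (f_ n s)%:E) (fun s => (f s)%:E)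
  (fun s => (g s)%:E)) => //.
- by move=> n; apply/measurable_EFinP; exact: mf.
- by move=> s Ds; apply: cvg_EFin; [exact: nearW|exact: ff].
Qed.

End RealIntegrals.

(** Turns dominated convergence, which speaks of sequences, into continuity of parameter
    integrals. *)
Lemma sequentially_continuous (R : realType) (f : R -> R) (x : R) :
  (forall u : nat -> R, u n @[n --> \oo] --> x -> f (u n) @[n --> \oo] --> f x) ->
  {for x, continuous f}.
Proof.
move=> h; apply/cvgrPdist_lt => e e0; apply: contrapT => nn.
have /choice[u hu] : forall n : nat, exists y, `|x - y| < n.+1%:R^-1 /\ e <= `|f x - f y|.
  move=> n; apply: contrapT => hn; apply: nn.
  exists n.+1%:R^-1; first by rewrite /= invr_gt0.
  move=> y /= xy; rewrite ltNge; apply/negP => le; apply: hn; by exists y.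
have ux : u n @[n --> \oo] --> x.
  apply/cvgrPdist_lt => d d0.
  near=> n; apply: lt_trans (hu n).1 _.
  by near: n; exact: near_infty_natSinv_lt (PosNum d0).
have /cvgrPdist_lt/(_ e e0)[N _ /(_ N (leqnn N))/=] := h u ux.
by rewrite ltNge (hu N).2.
Unshelve. all: by end_near. Qed.

(** * Bounded continuous functions on the half-line *)

Section BoundedContinuous.
Variable R : realType.
Implicit Types (h : R -> R) (B r s z : R).

(** Composition with the absolute value expresses continuity on [0, +oo[, one-sided at 0, as
    ordinary continuity on the line. *)
Definition BC B h := continuous (fun s => h `|s|) /\ forall s, 0 <= s -> `|h s| <= B.

Lemma BC_ge0 B h : BC B h -> 0 <= B.
Proof. by move=> [_ /(_ 0 (lexx _))]; exact: le_trans. Qed.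

Lemma BC_weaken B B' h : B <= B' -> BC B h -> BC B' h.
Proof. by move=> BB' [c b]; split=> // s s0; rewrite (le_trans (b s s0)). Qed.

Lemma BC_cst c : BC `|c| (fun=> c).
Proof. by split=> // s; exact: cvg_cst. Qed.

Lemma BCD B1 B2 h1 h2 : BC B1 h1 -> BC B2 h2 -> BC (B1 + B2) (fun s => h1 s + h2 s).
Proof.
move=> [c1 b1] [c2 b2]; split=> [s|s s0]; first exact: cvgD (c1 s) (c2 s).
by rewrite (le_trans (ler_normD _ _))// lerD ?b1 ?b2.
Qed.

Lemma BCM B1 B2 h1 h2 : BC B1 h1 -> BC B2 h2 -> BC (B1 * B2) (fun s => h1 s * h2 s).
Proof.
move=> [c1 b1] [c2 b2]; split=> [s|s s0]; first exact: cvgM (c1 s) (c2 s).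
by rewrite normrM ler_pM ?b1 ?b2.
Qed.

Lemma BCZ c B h : BC B h -> BC (`|c| * B) (fun s => c * h s).
Proof. by move=> bh; exact: BCM (BC_cst c) bh. Qed.

Lemma BCN B h : BC B h -> BC B (fun s => - h s).
Proof.
by move=> [c b]; split=> [s|s s0]; [exact: cvgN (c s)|rewrite normrN b].
Qed.

Lemma BCB B1 B2 h1 h2 : BC B1 h1 -> BC B2 h2 -> BC (B1 + B2) (fun s => h1 s - h2 s).
Proof. by move=> b1 b2; exact: BCD b1 (BCN _ _ b2). Qed.

Lemma BC_exp z : 0 <= z -> BC 1 (fun s => expR (- (s * z))).
Proof.
move=> z0; split=> [s|s s0]; last first.
  by rewrite ger0_norm ?expR_ge0// -expR0 ler_expR oppr_le0 mulr_ge0.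
apply: continuous_comp; last exact: continuous_expR.
by apply: cvgN; apply: cvgMl; exact: norm_continuous.
Qed.

Lemma BC_shift s B h : 0 <= s -> BC B h -> BC B (fun r => h (r + s)).
Proof.
move=> s0 [c b]; split=> [r|r r0]; last by rewrite b ?addr_ge0.
rewrite (_ : (fun r => h (`|r| + s)) = fun r => h `| `|r| + s|); last first.
  by apply/funext => t; rewrite [X in _ = h X]ger0_norm ?addr_ge0.
apply: (continuous_comp (f := fun r : R => `|r| + s) (g := fun r => h `|r|)); last exact: c.
by apply: cvgD; [exact: norm_continuous|exact: cvg_cst].
Qed.

Lemma continuous_normr_measurable h (D : set R) :
  measurable (D : set (measurableTypeR R)) -> D `<=` `[0%R, +oo[ ->
  continuous (fun s => h `|s|) -> measurable_fun (D : set (measurableTypeR R)) h.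
Proof.
move=> mD D0 c; apply: (eq_measurable_fun (fun s => h `|s|)).
  by move=> s /set_mem /D0; rewrite /= in_itv/= andbT => s0; rewrite ger0_norm.
by apply: measurable_funS (continuous_measurable_fun c).
Qed.

Lemma BC_measurable B h (D : set R) : measurable (D : set (measurableTypeR R)) ->
  D `<=` `[0%R, +oo[ -> BC B h -> measurable_fun (D : set (measurableTypeR R)) h.
Proof. by move=> mD D0 [c _]; exact: continuous_normr_measurable. Qed.

End BoundedContinuous.

(** * Convolution operators and their algebra *)

Section ConvolutionOperators.
Variable R : realType.
Implicit Types (h : R -> R) (K B r s z : R) (lam : R -> R) (P : (R -> R) -> R -> R).

(* Abstracts h |-> \int h (_ + s) rho(ds) for a finite signed measure rho; lam is the Laplace
   transform of rho. Only the values of h and P h on [0, +oo[ are meaningful. *)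
Record bop K lam P : Prop := Bop {
  bop_ge0 : 0 <= K ;
  bop_BC : forall B h, BC R B h -> BC R (K * B) (P h) ;
  bop_lin : forall B1 B2 c h1 h2, BC R B1 h1 -> BC R B2 h2 ->
    forall r, 0 <= r -> P (fun s => h1 s + c * h2 s) r = P h1 r + c * P h2 r ;
  bop_cvg : forall B (h_ : nat -> R -> R) h, (forall n, BC R B (h_ n)) -> BC R B h ->
    (forall s, 0 <= s -> h_ n s @[n --> \oo] --> h s) ->
    forall r, 0 <= r -> P (h_ n) r @[n --> \oo] --> P h r ;
  bop_exp : forall z r, 0 < z -> 0 <= r ->
    P (fun s => expR (- (s * z))) r = lam z * expR (- (r * z)) }.

Lemma bop_bound K lam P B h r : bop K lam P -> BC R B h -> 0 <= r -> `|P h r| <= K * B.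
Proof. by move=> /bop_BC bP /bP[_]; exact. Qed.

Lemma bopD K lam P B1 B2 h1 h2 r : bop K lam P -> BC R B1 h1 -> BC R B2 h2 -> 0 <= r ->
  P (fun s => h1 s + h2 s) r = P h1 r + P h2 r.
Proof.
move=> bP b1 b2 r0; rewrite -[P h2 r]mul1r -(bop_lin _ _ _ bP _ _ _ _ _ b1 b2)//.
by congr (P _ r); apply/funext => s; rewrite mul1r.
Qed.

Lemma bopB K lam P B1 B2 h1 h2 r : bop K lam P -> BC R B1 h1 -> BC R B2 h2 -> 0 <= r ->
  P (fun s => h1 s - h2 s) r = P h1 r - P h2 r.
Proof.
move=> bP b1 b2 r0; rewrite -mulN1r -(bop_lin _ _ _ bP _ _ _ _ _ b1 b2)//.
by congr (P _ r); apply/funext => s; rewrite mulN1r.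
Qed.

(** The difference satisfies [BC] with bound 0 whatever it does on negative arguments, so the norm
    bound of [P] annihilates it. *)
Lemma bop_ext K lam P B h1 h2 : bop K lam P -> BC R B h1 -> BC R B h2 ->
  (forall s, 0 <= s -> h1 s = h2 s) -> forall r, 0 <= r -> P h1 r = P h2 r.
Proof.
move=> bP b1 b2 h12 r r0; apply/eqP; rewrite -subr_eq0 -normr_le0.
rewrite -(bopB _ _ _ _ _ _ _ _ bP b1 b2)//.
rewrite (le_trans (bop_bound _ _ _ 0 _ _ bP _ _)) ?mulr0//.
split=> [|s s0]; last by rewrite h12// subrr normr0.
by have [] := BCB _ _ _ _ _ b1 b2.
Qed.

Lemma bopZ0 K lam P c B h r : bop K lam P -> BC R B h -> 0 <= r ->
  P (fun s => c * h s) r = c * P h r.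
Proof.
move=> bP bh r0.
have P0 : P (fun=> 0) r = 0.
  apply/eqP; rewrite -normr_le0 (le_trans (bop_bound _ _ _ 0 _ _ bP _ _)) ?mulr0//.
  by rewrite -{1}(@normr0 _ R); exact: BC_cst.
rewrite -[RHS]add0r -{1}P0 -(bop_lin _ _ _ bP _ _ c (fun=> 0) h (BC_cst _ 0) bh)//.
by congr (P _ r); apply/funext => s; rewrite add0r.
Qed.

Lemma bop_symbol K lam lam' P : (forall z, 0 < z -> lam z = lam' z) ->
  bop K lam P -> bop K lam' P.
Proof. by move=> ll [? ? ? ? e]; split=> // z r z0 r0; rewrite -ll// e. Qed.

Lemma bop_shift s : 0 <= s -> bop 1 (fun z => expR (- (s * z))) (fun h r => h (r + s)).
Proof.
move=> s0; split=> //.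
- by move=> B h bh; rewrite mul1r; exact: BC_shift.
- by move=> B h_ h _ _ hh r r0; apply: hh; rewrite addr_ge0.
- by move=> z r _ _; rewrite mulrDl opprD expRD mulrC.
Qed.

Lemma bop_id : bop 1 (fun=> 1) id.
Proof. by split=> //= *; rewrite mul1r. Qed.

Lemma bop_add K1 lam1 P1 K2 lam2 P2 : bop K1 lam1 P1 -> bop K2 lam2 P2 ->
  bop (K1 + K2) (fun z => lam1 z + lam2 z) (fun h r => P1 h r + P2 h r).
Proof.
move=> p1 p2; split.
- by rewrite addr_ge0 ?(bop_ge0 _ _ _ p1) ?(bop_ge0 _ _ _ p2).
- by move=> B h bh; rewrite mulrDl; apply: BCD; [exact: (bop_BC _ _ _ p1)|exact: (bop_BC _ _ _ p2)].
- move=> B1 B2 c h1 h2 b1 b2 r r0.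
  by rewrite (bop_lin _ _ _ p1 _ _ _ _ _ b1 b2)// (bop_lin _ _ _ p2 _ _ _ _ _ b1 b2)//; ring.
- by move=> B h_ h bn bh hh r r0; apply: cvgD; [exact: (bop_cvg _ _ _ p1 B)|exact: (bop_cvg _ _ _ p2 B)].
- by move=> z r z0 r0; rewrite (bop_exp _ _ _ p1)// (bop_exp _ _ _ p2)// mulrDl.
Qed.

Lemma bop_scale c K lam P : bop K lam P ->
  bop (`|c| * K) (fun z => c * lam z) (fun h r => c * P h r).
Proof.
move=> p; split.
- by rewrite mulr_ge0 ?(bop_ge0 _ _ _ p).
- by move=> B h bh; rewrite -mulrA; apply: BCZ; exact: (bop_BC _ _ _ p).
- by move=> B1 B2 d h1 h2 b1 b2 r r0; rewrite (bop_lin _ _ _ p _ _ _ _ _ b1 b2)//; ring.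
- by move=> B h_ h bn bh hh r r0; apply: cvgMr; exact: (bop_cvg _ _ _ p B).
- by move=> z r z0 r0; rewrite (bop_exp _ _ _ p)// mulrA.
Qed.

Lemma bop_sub K1 lam1 P1 K2 lam2 P2 : bop K1 lam1 P1 -> bop K2 lam2 P2 ->
  bop (K1 + K2) (fun z => lam1 z - lam2 z) (fun h r => P1 h r - P2 h r).
Proof.
move=> p1 p2; have := bop_add _ _ _ _ _ _ p1 (bop_scale (-1) _ _ _ p2).
rewrite normrN normr1 mul1r.
congr (bop _ _ _); first by apply/funext => z; rewrite mulN1r.
by apply/funext => h; apply/funext => r; rewrite mulN1r.
Qed.

Lemma bop_comp K1 lam1 P1 K2 lam2 P2 : bop K1 lam1 P1 -> bop K2 lam2 P2 ->
  bop (K1 * K2) (fun z => lam1 z * lam2 z) (fun h => P1 (P2 h)).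
Proof.
move=> p1 p2; split.
- by rewrite mulr_ge0 ?(bop_ge0 _ _ _ p1) ?(bop_ge0 _ _ _ p2).
- by move=> B h bh; rewrite -mulrA; apply: (bop_BC _ _ _ p1); exact: (bop_BC _ _ _ p2).
- move=> B1 B2 c h1 h2 b1 b2 r r0.
  have q1 := bop_BC _ _ _ p2 _ _ b1; have q2 := bop_BC _ _ _ p2 _ _ b2.
  rewrite -(bop_lin _ _ _ p1 _ _ _ _ _ q1 q2)//.
  apply: (bop_ext _ _ _ (K2 * (B1 + `|c| * B2)) _ _ p1) => //.
  + by apply: (bop_BC _ _ _ p2); apply: BCD => //; exact: BCZ.
  + by rewrite mulrDr mulrCA; apply: BCD => //; exact: BCZ.
  + by move=> s s0; rewrite (bop_lin _ _ _ p2 _ _ _ _ _ b1 b2).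
- move=> B h_ h bn bh hh r r0; apply: (bop_cvg _ _ _ p1 (K2 * B)) => //.
  + by move=> n; exact: (bop_BC _ _ _ p2).
  + exact: (bop_BC _ _ _ p2).
  + by move=> s s0; exact: (bop_cvg _ _ _ p2 B).
- move=> z r z0 r0.
  have be := BC_exp R z (ltW z0).
  rewrite mulrAC -(bop_exp _ _ _ p1)// mulrC -(bopZ0 _ _ _ _ _ _ _ p1 be)//.
  apply: (bop_ext _ _ _ (K2 * 1 + `|lam2 z| * 1) _ _ p1) => //.
  + apply: BC_weaken (bop_BC _ _ _ p2 _ _ be).
    by rewrite lerDl mulr1.
  + apply: BC_weaken (BCZ _ _ _ _ be).
    by rewrite lerDr mulr1 (bop_ge0 _ _ _ p2).
  + by move=> s s0; rewrite (bop_exp _ _ _ p2).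
Qed.

Section FamilyIntegral.
Variables (m : {measure set (measurableTypeR R) -> \bar R}) (D : set R).
Hypothesis mD : measurable (D : set (measurableTypeR R)).
Variables (k : R -> R) (lam_ : R -> R -> R) (P_ : R -> (R -> R) -> R -> R).
Hypothesis P_bop : forall s, D s -> bop (k s) (lam_ s) (P_ s).
Hypothesis ik : iint R m D k.
Hypothesis mP : forall B h r, BC R B h -> 0 <= r ->
  measurable_fun (D : set (measurableTypeR R)) (fun s => P_ s h r).

Lemma bop_integrable B h r : BC R B h -> 0 <= r -> iint R m D (fun s => P_ s h r).
Proof.
move=> bh r0; apply: (iint_dominated _ _ _ mD _ (fun s => B * k s)).
- exact: mP bh r0.
- by move=> s Ds; rewrite mulrC; exact: (bop_bound _ _ _ _ _ _ (P_bop _ Ds) bh).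
- exact: iintZ.
Qed.

(** Integrability is asked of the norm bounds [k s] and not of constants: this admits measures of
    infinite mass near 0 when [k s] is small there. Each field is dominated convergence or linearity
    under the integral. *)
Lemma bop_integral : bop (Rintegral m D k) (fun z => Rintegral m D (lam_ ^~ z))
  (fun h r => Rintegral m D (fun s => P_ s h r)).
Proof.
split.
- by apply: Rintegral_ge0 => s Ds; exact: bop_ge0 (P_bop s Ds).
- move=> B h bh; split=> [r|r r0]; last first.
    rewrite mulrC -RintegralZl//; apply: Rintegral_dominated => //.
    + exact: mP bh r0.
    + by move=> s Ds; rewrite mulrC; exact: (bop_bound _ _ _ _ _ _ (P_bop _ Ds) bh).
    + exact: iintZ.
  apply: sequentially_continuous => u ur.
  apply: (Rintegral_dominated_cvg R m D mD (fun n s => P_ s h `|u n|) (fun s => P_ s h `|r|)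
    (fun s => B * k s)).
  + by move=> n; apply: mP bh _.
  + by move=> n s Ds; rewrite mulrC; exact: (bop_bound _ _ _ _ _ _ (P_bop _ Ds) bh).
  + exact: iintZ.
  + move=> s Ds; have [cP _] := bop_BC _ _ _ (P_bop _ Ds) _ _ bh.
    exact: (cvg_comp _ _ ur (cP r)).
- move=> B1 B2 c h1 h2 b1 b2 r r0.
  rewrite -RintegralZl//; last exact: bop_integrable b2 r0.
  rewrite -RintegralD//; last 2 first.
  + exact: bop_integrable b1 r0.
  + by apply: iintZ => //; exact: bop_integrable b2 r0.
  by apply: eq_Rintegral => s /set_mem Ds; rewrite (bop_lin _ _ _ (P_bop _ Ds) _ _ _ _ _ b1 b2).
- move=> B h_ h bn bh hh r r0.
  apply: (Rintegral_dominated_cvg R m D mD (fun n s => P_ s (h_ n) r) _ (fun s => B * k s)).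
  + by move=> n; apply: mP (bn n) r0.
  + by move=> n s Ds; rewrite mulrC; exact: (bop_bound _ _ _ _ _ _ (P_bop _ Ds) (bn n)).
  + exact: iintZ.
  + by move=> s Ds; exact: (bop_cvg _ _ _ (P_bop _ Ds) B).
- move=> z r z0 r0.
  (* At r = 0 the exponential factor is 1, so integrability of the symbols is a special case of that
     of the values. *)
  have i0 := bop_integrable _ _ 0 (BC_exp R z (ltW z0)) (lexx _).
  rewrite -RintegralZr//.
    by apply: eq_Rintegral => s /set_mem Ds; rewrite (bop_exp _ _ _ (P_bop _ Ds)).
  apply: eq_integrable i0 => // s /set_mem Ds /=.
  by rewrite (bop_exp _ _ _ (P_bop _ Ds))// mul0r oppr0 expR0 mulr1.
Qed.

End FamilyIntegral.

End ConvolutionOperators.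

(** * Bernstein polynomials as binomial expectations *)

Section BernsteinPolynomials.
Variable R : realType.
Implicit Types (u c : R) (G : nat -> R).

(* The expectation of G (S_n), for S_n binomial with parameters n and u. *)
Fixpoint binomial_mean u n G : R :=
  if n is n'.+1 then
    u * binomial_mean u n' (fun k => G k.+1) + (1 - u) * binomial_mean u n' G
  else G 0%N.

Lemma binomial_mean_le u n G1 G2 : 0 <= u <= 1 -> (forall k, G1 k <= G2 k) ->
  binomial_mean u n G1 <= binomial_mean u n G2.
Proof.
move=> /andP[u0 u1]; elim: n G1 G2 => [|n IH] G1 G2 G12 //=.
by apply: lerD; rewrite ler_wpM2l ?subr_ge0// IH.
Qed.

Lemma binomial_mean_lin u n G1 G2 c :
  binomial_mean u n (fun k => G1 k + c * G2 k) =
  binomial_mean u n G1 + c * binomial_mean u n G2.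
Proof. by elim: n G1 G2 => [|n IH] G1 G2 //=; rewrite !IH; ring. Qed.

Lemma binomial_mean_cst u n c : binomial_mean u n (fun=> c) = c.
Proof. by elim: n => [|n IH] //=; rewrite IH; ring. Qed.

(** Variance plus squared mean of the shifted variable. The shift [c] is general because one step of
    the recursion raises it by 1. *)
Lemma binomial_mean_moment2 u n c :
  binomial_mean u n (fun k => (k%:R + c) ^+ 2) = n%:R * u * (1 - u) + (n%:R * u + c) ^+ 2.
Proof.
elim: n c => [|n IH] c /=; first by rewrite !mul0r !add0r.
rewrite (_ : (fun k => (k.+1%:R + c) ^+ 2) = fun k => (k%:R + (1 + c)) ^+ 2).
  by rewrite !IH -[n.+1]addn1 natrD; ring.
by apply/funext => k; rewrite -[k.+1]addn1 natrD addrA.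
Qed.

Lemma binomial_mean_bound u n G B : 0 <= u <= 1 -> (forall k, `|G k| <= B) ->
  `|binomial_mean u n G| <= B.
Proof.
move=> u01 GB; rewrite ler_norml; apply/andP; split.
  rewrite -(binomial_mean_cst u n (- B)); apply: binomial_mean_le => // k.
  by have := GB k; rewrite ler_norml => /andP[].
rewrite -[leRHS](binomial_mean_cst u n B); apply: binomial_mean_le => // k.
by have := GB k; rewrite ler_norml => /andP[].
Qed.

(** Chebyshev's inequality. Continuity is asked at [u] only, since the function it is applied to may
    have no limit at 0. *)
Lemma Bernstein_cvg u (G : R -> R) B : 0 <= u <= 1 -> (forall v, `|G v| <= B) ->
  {for u, continuous G} ->
  binomial_mean u n (fun k => G (k%:R / n%:R)) @[n --> \oo] --> G u.
Proof.
move=> u01 GB cG; apply/cvgrPdist_le => e e0.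
have [d d0 hd] : exists2 d, 0 < d & forall v, `|u - v| < d -> `|G u - G v| <= e / 2.
  have /cvgrPdist_le/(_ (e / 2)) := cG; rewrite divr_gt0// => /(_ isT).
  by move=> /nbhs_ballP[d /= d0 hd]; exists d => // v uv; exact: hd.
have B0 : 0 <= B := le_trans (normr_ge0 _) (GB 0).
near=> n.
have n0 : 0 < n%:R :> R by rewrite ltr0n; near: n; exists 1%N.
(* Chosen so that c (k - n u)^2 >= 2 B as soon as k / n is at distance at least d from u; its
   expectation is then O(1/n). *)
pose c := 2 * B / (d ^+ 2 * n%:R ^+ 2).
have c0 : 0 <= c by rewrite divr_ge0 ?mulr_ge0 ?exprn_ge0 // ltW.
have pw k : `|G u - G (k%:R / n%:R)| <= e / 2 + c * (k%:R + - (n%:R * u)) ^+ 2.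
  have [lt|ge] := ltP `|u - k%:R / n%:R| d.
    by rewrite (le_trans (hd _ lt))// lerDl mulr_ge0// sqr_ge0.
  apply: (@le_trans _ _ (2 * B)).
    by rewrite (le_trans (ler_normB _ _))//; have := GB u; have := GB (k%:R / n%:R); lra.
  suff : 2 * B <= c * (k%:R + - (n%:R * u)) ^+ 2 by lra.
  rewrite (_ : _ * _ ^+ 2 = 2 * B * ((u - k%:R / n%:R) ^+ 2 / d ^+ 2)); last first.
    by rewrite /c; field; rewrite !gt_eqF.
  rewrite ler_peMr ?mulr_ge0// ler_pdivlMr ?exprn_gt0// mul1r.
  by rewrite -(real_normK (num_real (u - _))) ler_sqr ?nnegrE // ltW.
have eqs : G u - binomial_mean u n (fun k => G (k%:R / n%:R)) =
    binomial_mean u n (fun k => G u + (-1) * G (k%:R / n%:R)).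
  by rewrite (binomial_mean_lin u n (fun=> G u) (fun k => G (k%:R / n%:R)) (-1))
    binomial_mean_cst mulN1r.
have mom : binomial_mean u n (fun k => e / 2 + c * (k%:R + - (n%:R * u)) ^+ 2) <= e.
  rewrite (binomial_mean_lin u n (fun=> e / 2)) binomial_mean_cst binomial_mean_moment2.
  rewrite subrr expr0n addr0.
  have -> : c * (n%:R * u * (1 - u)) = (2 * B / d ^+ 2) * (u * (1 - u)) / n%:R.
    by rewrite /c; field; rewrite !gt_eqF.
  have uu : u * (1 - u) <= 1.
    by move/andP: u01 => [u0 u1]; rewrite mulr_ile1 ?subr_ge0// gerBl.
  have Bd : 0 <= 2 * B / d ^+ 2 by rewrite divr_ge0 ?mulr_ge0 ?exprn_ge0 // ltW.
  have : 2 * B / d ^+ 2 * (u * (1 - u)) / n%:R <= e / 2.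
    rewrite ler_pdivrMr//; apply: (@le_trans _ _ (2 * B / d ^+ 2)); first by rewrite ler_piMr.
    rewrite -ler_pdivrMl ?divr_gt0//.
    near: n; exact: nbhs_infty_ger.
  by move=> ?; lra.
rewrite eqs ler_norml; apply/andP; split; last first.
  apply: le_trans mom; apply: binomial_mean_le => // k; rewrite mulN1r.
  exact: le_trans (ler_norm _) (pw k).
pose q k := e / 2 + c * (k%:R + - (n%:R * u)) ^+ 2.
apply: (@le_trans _ _ (binomial_mean u n (fun k => 0 + (-1) * q k))).
  by rewrite (binomial_mean_lin u n (fun=> 0) q) binomial_mean_cst /q; lra.
apply: binomial_mean_le => // k; rewrite add0r !mulN1r lerNl /q.
by apply: le_trans (pw k); rewrite -normrN ler_norm.
Unshelve. all: by end_near. Qed.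

End BernsteinPolynomials.

(** * A convolution operator is determined by its symbol *)

Section LaplaceUniqueness.
Variable R : realType.

(** In the variable v = e^{-s} the Bernstein polynomials of [h] are combinations of e^{-js} with j
    >= 1, where both operators are read off the symbols. As [h] need not have a limit at infinity,
    convergence is only bounded and pointwise, which is the mode that [bop_cvg] accepts. *)
Lemma bop_unique K1 K2 (lam1 lam2 : R -> R) P1 P2 B h r :
  bop R K1 lam1 P1 -> bop R K2 lam2 P2 -> (forall z, 0 < z -> lam1 z = lam2 z) ->
  BC R B h -> 0 <= r -> P1 h r = P2 h r.
Proof.
move=> b1 b2 lam12 bh r0.
have [ch hB] := bh.
have u01 s : 0 <= s -> 0 <= expR (- s) <= 1.
  by move=> s0; rewrite expR_ge0/= -[leRHS]expR0 ler_expR oppr_le0.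
have BCu : BC R 1 (fun s => expR (- s)).
  have := BC_exp R 1 ler01; congr (BC _ _ _).
  by apply/funext => s; rewrite mulr1.
have BCmean n G A : (forall k, `|G k| <= A) ->
    BC R A (fun s => binomial_mean R (expR (- s)) n G).
  move=> GA; split=> [s|s s0]; last by apply: binomial_mean_bound => //; exact: u01.
  elim: n G GA => [|n IH] G GA /=; first exact: cvg_cst.
  have [cu _] := BCu.
  apply: cvgD; apply: cvgM; first exact: cu.
  - by apply: IH.
  - by apply: cvgB; [exact: cvg_cst|exact: cu].
  - exact: IH.
have BCp j : BC R 1 (fun s => expR (- s) ^+ j).
  elim: j => [|j IH]; first by have := BC_cst R 1; rewrite normr1.
  have := BCM _ _ _ _ _ BCu IH; rewrite mulr1; congr (BC _ _ _).
  by apply/funext => s; rewrite exprS.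
(* the vanishing of G at 0 kills the constant term, where the symbols are not controlled *)
have key n G j A : (forall k, `|G k| <= A) -> G 0%N = 0 \/ (0 < j)%N ->
    P1 (fun s => expR (- s) ^+ j * binomial_mean R (expR (- s)) n G) r =
    P2 (fun s => expR (- s) ^+ j * binomial_mean R (expR (- s)) n G) r.
  elim: n G j => [|n IH] G j GA G0j /=.
    have fE : (fun s => expR (- s) ^+ j * G 0%N) = (fun s : R => G 0%N * expR (- s) ^+ j).
      by apply/funext => s; rewrite mulrC.
    rewrite fE (bopZ0 _ _ _ _ _ _ _ _ b1 (BCp j))// (bopZ0 _ _ _ _ _ _ _ _ b2 (BCp j))//.
    have [->|j0] := G0j; first by rewrite !mul0r.
    congr (_ * _).
    have -> : (fun s : R => expR (- s) ^+ j) = fun s => expR (- (s * j%:R)).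
      by apply/funext => s; rewrite -expRM_natl mulrN mulrC.
    by rewrite (bop_exp _ _ _ _ b1)// ?ltr0n// (bop_exp _ _ _ _ b2)// ?ltr0n// lam12 ?ltr0n.
  have GA' k : `|G k.+1| <= A by [].
  pose g1 s := expR (- s) ^+ j.+1 * binomial_mean R (expR (- s)) n (fun k => G k.+1).
  pose g2 s := expR (- s) ^+ j * binomial_mean R (expR (- s)) n G.
  pose g3 s := expR (- s) ^+ j.+1 * binomial_mean R (expR (- s)) n G.
  have fE : (fun s => expR (- s) ^+ j * (expR (- s) * binomial_mean R (expR (- s)) n (fun k => G k.+1)
      + (1 - expR (- s)) * binomial_mean R (expR (- s)) n G)) = fun s => g1 s + g2 s - g3 s.
    by apply/funext => s; rewrite /g1 /g2 /g3 exprS; ring.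
  have B1 : BC R (1 * A) g1 by apply: BCM => //; exact: BCmean.
  have B2 : BC R (1 * A) g2 by apply: BCM => //; exact: BCmean.
  have B3 : BC R (1 * A) g3 by apply: BCM => //; exact: BCmean.
  have B12 : BC R (1 * A + 1 * A) (fun s => g1 s + g2 s) by exact: BCD.
  rewrite fE (bopB _ _ _ _ _ _ _ _ _ b1 B12 B3)// (bopB _ _ _ _ _ _ _ _ _ b2 B12 B3)//.
  rewrite (bopD _ _ _ _ _ _ _ _ _ b1 B1 B2)// (bopD _ _ _ _ _ _ _ _ _ b2 B1 B2)//.
  congr (_ + _ - _).
  - by apply: IH => //; right.
  - exact: IH.
  - by apply: IH => //; right.
(* The value 0 at v = 0 removes the constant term, and the absolute value keeps [h] on its half-line
   for v > 1. *)
pose G v := if 0 < v then h `|ln v| else 0.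
have GB v : `|G v| <= B.
  by rewrite /G; case: ifP => _; [exact: hB|rewrite normr0 (BC_ge0 _ _ _ bh)].
pose h_ (n : nat) s := binomial_mean R (expR (- s)) n (fun k => G (k%:R / n%:R)).
have h_B n : BC R B (h_ n) by apply: BCmean.
have h_h s : 0 <= s -> h_ n s @[n --> \oo] --> h s.
  move=> s0.
  have -> : h s = G (expR (- s)) by rewrite /G expR_gt0 expRK normrN ger0_norm.
  apply: (Bernstein_cvg _ _ _ B); [exact: u01|exact: GB|].
  have : h `|ln v| @[v --> expR (- s)] --> G (expR (- s)).
    rewrite /G expR_gt0.
    by apply: (cvg_comp _ _ (continuous_ln (expR_gt0 (- s))) (ch (ln (expR (- s))))).
  apply: cvg_trans; apply: near_eq_cvg.
  near=> v; rewrite /G ifT//; near: v; exact: lt_nbhsr (expR_gt0 _).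
have c1 := bop_cvg _ _ _ _ b1 B h_ h h_B bh h_h r r0.
have c2 := bop_cvg _ _ _ _ b2 B h_ h h_B bh h_h r r0.
have E12 : (fun n => P1 (h_ n) r) = fun n => P2 (h_ n) r.
  apply/funext => n.
  have hE : h_ n = fun s => expR (- s) ^+ 0 * binomial_mean R (expR (- s)) n (fun k => G (k%:R / n%:R)).
    by apply/funext => s; rewrite expr0 mul1r.
  rewrite hE; apply: (key n _ 0%N B) => [k|]; first exact: GB.
  by left; rewrite mul0r /G ltxx.
rewrite E12 in c1.
exact: (cvg_unique _ c1 c2).
Unshelve. all: by end_near. Qed.

End LaplaceUniqueness.

(** * Existence of weak integrals of continuous bounded orbits *)

Section PettisIntegral.
Variables (R : realType) (X : completeNormedModType (CC R)).

Implicit Types (s : R) (h : R -> X) (u : X) (psi : X -> R) (K : R).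

Definition norm_continuous_normr h := forall s e : R, 0 < e ->
  exists2 d : R, 0 < d & forall t : R, `|s - t| < d -> nrm R X (h `|s| - h `|t|) < e.

Lemma rdual_continuous_normr K psi h : rdual R X K psi -> norm_continuous_normr h ->
  continuous (fun s => psi (h `|s|)).
Proof.
move=> [K0 l b] ch s; apply/cvgrPdist_lt => e e0.
have [d d0 hd] := ch s (e / (K + 1)) ltac:(by rewrite divr_gt0// ltr_wpDl).
apply/nbhs_ballP; exists d => // t; rewrite /ball /= => st.
rewrite -rlinB//; apply: le_lt_trans (b _) _.
have := hd t st; rewrite ltr_pdivlMr ?ltr_wpDl// => lt.
apply: le_lt_trans lt; rewrite mulrC ler_wpM2l ?nrm_ge0//; lra.
Qed.

Lemma nrm_lerB_dist (u v : X) : `|nrm R X u - nrm R X v| <= nrm R X (u - v).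
Proof.
have h (a b : X) : nrm R X a - nrm R X b <= nrm R X (a - b).
  by rewrite lerBlDr; have := nrmD R X (a - b) b; rewrite subrK.
by rewrite ler_norml h andbT lerNl opprB -(nrmN R X (u - v)) opprB h.
Qed.

Lemma nrm_continuous_normr h u : norm_continuous_normr h ->
  continuous (fun s => nrm R X (h `|s| - u)).
Proof.
move=> ch s; apply/cvgrPdist_lt => e e0.
have [d d0 hd] := ch s e e0.
apply/nbhs_ballP; exists d => // t; rewrite /ball /= => st.
by apply: le_lt_trans (hd t st); rewrite (le_trans (nrm_lerB_dist _ _))// opprB addrA subrK.
Qed.

Lemma norm_continuous_normr_separable h : norm_continuous_normr h ->
  exists q : nat -> X, forall s e, 0 <= s -> 0 < e -> exists i, nrm R X (h s - q i) < e.
Proof.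
move=> ch.
exists (fun i => if unpickle i is Some r then h `|ratr (r : rat)| else 0) => s e s0 e0.
have [d d0 hd] := ch s e e0.
have sd : s < s + d by rewrite ltrDl.
have [r] := rat_in_itvoo sd.
rewrite in_itv/= => /andP[sr rd].
exists (pickle r); rewrite pickleK -{1}(ger0_norm s0); apply: hd.
by rewrite distrC ger0_norm; lra.
Qed.

Variables (m : {measure set (measurableTypeR R) -> \bar R}) (D : set R).
Hypotheses (mD : measurable (D : set (measurableTypeR R))) (D0 : D `<=` `[0%R, +oo[).
Variables (w : R -> R) (h : R -> X) (B : R).
Hypotheses (w0 : forall s, D s -> 0 <= w s) (iw : iint R m D w).
Hypotheses (ch : norm_continuous_normr h) (hB : forall s, 0 <= s -> nrm R X (h s) <= B).

Let D_ge0 s : D s -> 0 <= s.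
Proof. by move=> /D0; rewrite /= in_itv/= andbT. Qed.

Let mw : measurable_fun D (w : measurableTypeR R -> R).
Proof. exact: iint_measurable iw. Qed.

Let iwM f C : measurable_fun D (f : measurableTypeR R -> R) ->
  (forall s, D s -> `|f s| <= C) -> iint R m D (fun s => w s * f s).
Proof.
move=> mf fC; apply: (iint_dominated _ _ _ mD _ (fun s => C * w s)).
- exact: measurable_funM.
- by move=> s Ds; rewrite normrM (ger0_norm (w0 _ Ds)) mulrC ler_wpM2r ?w0 ?fC.
- exact: iintZ.
Qed.

Lemma iint_weighted_dual psi K : rdual R X K psi -> iint R m D (fun s => w s * psi (h s)).
Proof.
move=> dpsi; apply: (iwM _ (K * B)).
  by apply: continuous_normr_measurable => //; exact: rdual_continuous_normr dpsi ch.
move=> s Ds; have [K0 _ b] := dpsi.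
by rewrite (le_trans (b _))// ler_wpM2l// hB// D_ge0.
Qed.

(** [D] is cut according to the first point [q i] within [e'] of [h s]. Finitely many pieces give a
    step function, whose integral is the vector; the part left over has small weight by dominated
    convergence. The two errors share [e] equally and are uniform over all functionals with bound
    [K]. *)
Lemma approximate_Pettis_integral e : 0 < e -> exists z : X, forall psi K, rdual R X K psi ->
  `|psi z - Rintegral m D (fun s => w s * psi (h s))| <= K * e.
Proof.
move=> e0.
have [q hq] := norm_continuous_normr_separable h ch.
set W := Rintegral m D w.
have W0 : 0 <= W by apply: Rintegral_ge0.
pose e' := e / (2 * (W + 1)).
have e'0 : 0 < e' by rewrite divr_gt0// mulr_gt0// ltr_wpDl.
pose A i s : bool := nrm R X (h s - q i) < e'.
have mA i : measurable_fun D (fun s : measurableTypeR R => A i s).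
  apply: (measurable_fun_ltr (f := fun s => nrm R X (h s - q i)) (g := fun=> e')).
    by apply: continuous_normr_measurable => //; exact: nrm_continuous_normr.
  exact: measurable_cst.
(* [t n] indicates that none of the first n points is close to [h s], and [g i] below that [q i] is
   the first close one. *)
pose t := fix t n s : R := if n is n'.+1 then t n' s * (if A n' s then 0 else 1) else 1.
have t01 n s : 0 <= t n s <= 1.
  elim: n => [|n /andP[IH1 IH2]] /=; first by rewrite ler01 lexx.
  by case: ifP => _; rewrite ?mulr0 ?lexx ?ler01// mulr1 IH1.
have mt n : measurable_fun D (t n : measurableTypeR R -> R).
  elim: n => [|n IH] /=; first exact: measurable_cst.
  apply: measurable_funM => //.
  by apply: measurable_fun_if => //; exact: measurable_cst.
pose g i s := t i s - t i.+1 s.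
have g0 i s : 0 <= g i s.
  by rewrite subr_ge0 /=; case: ifP => _; rewrite ?mulr0 ?mulr1//; case/andP: (t01 i s).
have gA i s : g i s != 0 -> A i s.
  by rewrite /g /=; case: ifP => //; rewrite mulr1 subrr eqxx.
have gsum n s : \sum_(i < n) g i s = 1 - t n s.
  elim: n => [|n IH]; first by rewrite big_ord0 subrr.
  by rewrite big_ord_recr IH /g /=; ring.
have mg i : measurable_fun D (g i : measurableTypeR R -> R) by exact: measurable_funB.
have g1 i s : `|g i s| <= 1.
  by rewrite ger0_norm//; have := t01 i s; have := t01 i.+1 s; rewrite /g => /andP[? ?] /andP[? ?]; lra.
have iwg i : iint R m D (fun s => w s * g i s) by apply: (iwM _ 1).
have B0 : 0 <= B by exact: le_trans (nrm_ge0 _ _ _) (hB 0 (lexx _)).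
have iwt n : iint R m D (fun s => w s * t n s).
  by apply: (iwM _ 1) => // s _; have /andP[? ?] := t01 n s; rewrite ger0_norm.
have [N hN] : exists N, Rintegral m D (fun s => w s * t N s) * B <= e / 2.
  have tc : Rintegral m D (fun s => w s * t n s) @[n --> \oo] --> Rintegral m D (fun=> 0).
    apply: (Rintegral_dominated_cvg R m D mD (fun n s => w s * t n s) (fun=> 0) w) => //.
    + by move=> n; apply: measurable_funM.
    + move=> n s Ds; have /andP[? ?] := t01 n s.
      by rewrite normrM !ger0_norm ?w0// ler_piMr ?w0.
    + move=> s Ds; have [i hi] := hq s e' (D_ge0 _ Ds) e'0.
      apply: cvg_near_cst; exists i.+1 => // n /= lin.
      suff -> : t n s = 0 by rewrite mulr0.
      elim: n lin => // n IH; rewrite ltnS leq_eqVlt => /predU1P[<-|lin].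
        by rewrite /= /A hi mulr0.
      by rewrite /= IH// mul0r.
  have /cvgrPdist_lt/(_ (e / (2 * (B + 1)))) := tc.
  rewrite divr_gt0 ?mulr_gt0 ?ltr_wpDl// => /(_ isT)[N _ /(_ N (leqnn N))] /=.
  rewrite Rintegral_cst// mul0r sub0r normrN => lt.
  exists N.
  have := le_lt_trans (ler_norm _) lt; rewrite ltr_pdivlMr ?mulr_gt0 ?ltr_wpDl// => lt'.
  have : 0 <= Rintegral m D (fun s => w s * t N s).
    by apply: Rintegral_ge0 => s Ds; rewrite mulr_ge0 ?w0//; case/andP: (t01 N s).
  by move: lt'; set J := Rintegral _ _ _; nra.
exists (\sum_(i < N) Rc (Rintegral m D (fun s => w s * g i s)) *: q i) => psi K dpsi.
have [K0 l b] := dpsi.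
rewrite rlin_sum//.
have -> : \sum_(i < N) psi (Rc (Rintegral m D (fun s => w s * g i s)) *: q i) =
    Rintegral m D (fun s => \sum_(i < N) psi (q i) * (w s * g i s)).
  rewrite (Rintegral_sum R m D mD N (fun i s => psi (q i) * (w s * g i s))).
    by apply: eq_bigr => i _; rewrite l.2 mulrC (RintegralZl (psi (q i)) mD (iwg i)).
  by move=> i; exact: iintZ.
rewrite -RintegralB//; last 2 first.
- by apply: (iint_sum R m D mD N (fun i s => psi (q i) * (w s * g i s))) => i; exact: iintZ.
- exact: iint_weighted_dual dpsi.
apply: (@le_trans _ _ (Rintegral m D (fun s => K * (e' * w s + B * (w s * t N s))))); last first.
  rewrite RintegralZl//; last by apply: iintD => //; exact: iintZ.
  rewrite RintegralD//; [|exact: iintZ|exact: iintZ].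
  rewrite (RintegralZl e' mD iw) (RintegralZl B mD (iwt N)) ler_wpM2l//.
  have : e' * W <= e / 2.
    by rewrite /e' invfM mulrA mulrAC ler_pdivrMr ?ltr_wpDl//; nra.
  by move: hN; rewrite mulrC -/W; lra.
apply: Rintegral_dominated => //.
- apply: measurable_funB; last exact: iint_measurable (iint_weighted_dual _ _ dpsi).
  apply: iint_measurable.
  by apply: (iint_sum R m D mD N (fun i s => psi (q i) * (w s * g i s))) => i; exact: iintZ.
- move=> s Ds.
  have -> : \sum_(i < N) psi (q i) * (w s * g i s) - w s * psi (h s) =
      w s * (\sum_(i < N) g i s * psi (q i - h s) - t N s * psi (h s)).
    have -> : \sum_(i < N) g i s * psi (q i - h s) =
        \sum_(i < N) psi (q i) * g i s - (\sum_(i < N) g i s) * psi (h s).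
      rewrite mulr_suml -sumrB; apply: eq_bigr => i _.
      by rewrite rlinB//; ring.
    have -> : \sum_(i < N) psi (q i) * (w s * g i s) = w s * \sum_(i < N) psi (q i) * g i s.
      by rewrite mulr_sumr; apply: eq_bigr => i _; ring.
    by rewrite gsum; ring.
  rewrite normrM (ger0_norm (w0 _ Ds)).
  have -> : K * (e' * w s + B * (w s * t N s)) = w s * (K * e' + t N s * (K * B)) by ring.
  rewrite ler_wpM2l ?w0//; apply: le_trans (ler_normB _ _) _; apply: lerD.
    apply: le_trans (ler_norm_sum _ _ _) _.
    apply: (@le_trans _ _ (\sum_(i < N) g i s * (K * e'))).
      apply: ler_sum => i _; rewrite normrM (ger0_norm (g0 i s)).
      have [->|/gA Ais] := eqVneq (g i s) 0; first by rewrite !mul0r.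
      rewrite ler_wpM2l//; apply: le_trans (b _) _; rewrite ler_wpM2l//.
      by rewrite -nrmN opprB ltW.
    have tN1 : 1 - t N s <= 1 by have /andP[? _] := t01 N s; lra.
    by rewrite -mulr_suml gsum ler_piMl// mulr_ge0// ltW.
  have /andP[tN0 _] := t01 N s.
  rewrite normrM (ger0_norm tN0) ler_wpM2l// (le_trans (b _))// ler_wpM2l// hB//.
  exact: D_ge0.
- by apply: iintZ => //; apply: iintD => //; exact: iintZ.
Qed.

(** Since the approximation is uniform over functionals of bound 1, the approximants are Cauchy in
    norm and completeness gives the vector. *)
Theorem Pettis_integral : exists z : X, forall psi K, rdual R X K psi ->
  psi z = Rintegral m D (fun s => w s * psi (h s)).
Proof.
have n0 n : 0 < (n.+1%:R^-1 : R) by rewrite invr_gt0.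
have /choice[z hz] := fun n : nat => approximate_Pettis_integral _ (n0 n).
have small (e : R) : 0 < e -> exists N, forall n, (N <= n)%N -> n.+1%:R^-1 <= e.
  move=> e0; have [N _ hN] := near_infty_natSinv_lt (PosNum e0).
  by exists N => n Nn; apply: ltW; exact: hN.
have [|l hl] := nrm_complete R X z.
  move=> e e0; have [N hN] := small (e / 2) (divr_gt0 e0 (ltr0n _ 2)).
  exists N => n k Nn Nk; apply: nrm_le_dual => psi dpsi.
  have [_ lpsi _] := dpsi; rewrite rlinB//.
  have := le_trans (hz n _ _ dpsi) (ler_wpM2l ler01 (hN _ Nn)).
  have := le_trans (hz k _ _ dpsi) (ler_wpM2l ler01 (hN _ Nk)).
  rewrite !ler_norml mul1r => /andP[? ?] /andP[? ?]; lra.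
exists l => psi K dpsi; have [K0 lpsi b] := dpsi.
apply/eqP; rewrite -subr_eq0 -normr_le0; apply/ler_addgt0Pr => e e0; rewrite add0r.
have e2 : 0 < e / (2 * (K + 1)) by rewrite divr_gt0// mulr_gt0// ltr_wpDl.
have [N1 h1] := small _ e2; have [N2 h2] := hl _ e2.
pose n := maxn N1 N2.
have i1 := hz n _ _ dpsi; have i2 := h1 n (leq_maxl _ _); have i3 := h2 n (leq_maxr _ _).
have i4 := b (l - z n); rewrite rlinB// in i4.
have e3 : K * (e / (2 * (K + 1))) <= e / 2.
  by rewrite invfM !mulrA ler_pdivrMr ?ltr_wpDl//; nra.
have j1 := le_trans i1 (ler_wpM2l K0 i2); have j2 := le_trans i4 (ler_wpM2l K0 i3).
have -> : psi l - Rintegral m D (fun s => w s * psi (h s)) =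
  (psi l - psi (z n)) + (psi (z n) - Rintegral m D (fun s => w s * psi (h s))) by ring.
by apply: le_trans (ler_normD _ _) _; lra.
Qed.

End PettisIntegral.

Section VectorIntegrals.
Variables (R : realType) (X : completeNormedModType (CC R)).
Implicit Types (m : {measure set (measurableTypeR R) -> \bar R}) (D : set R) (h : R -> X).
Implicit Types (psi : X -> R).

(** [vint] is 0 when there is no integral, so its defining property is available only once existence
    is known; [complexify] then transfers it to real functionals. *)
Lemma vint_rdual m D h :
  (exists z, forall psi K, rdual R X K psi ->
    iint R m D (fun s => psi (h s)) /\ psi z = Rintegral m D (fun s => psi (h s))) ->
  forall psi K, rdual R X K psi -> psi (vint m D h) = Rintegral m D (fun s => psi (h s)).
Proof.
move=> [z hz] psi K dpsi.
have vz : is_vint m D h z.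
  move=> phi dphi.
  have [K1 d1] := rdual_cRe R X phi dphi; have [K2 d2] := rdual_cIm R X phi dphi.
  have [i1 e1] := hz _ _ d1; have [i2 e2] := hz _ _ d2.
  by split; [split|apply: CC_eqP].
have := xgetPex 0 (ex_intro (fun z => is_vint m D h z) z vz).
move=> /(_ _ (complexify_dual R X K psi dpsi))[_ /(congr1 (fun c => cRe c))].
exact.
Qed.

End VectorIntegrals.

(** * Orbits of a bounded semigroup tested against functionals *)

Section Semigroup.
Variables (R : realType) (X : completeNormedModType (CC R)) (T : R -> X -> X).
Hypothesis sgT : bounded_C0_semigroup T.
Implicit Types (s t r : R) (u v : X) (psi : X -> R).

Let sg_lin s : 0 <= s -> forall (c : CC R) u v, T s (c *: u + v) = c *: T s u + T s v.
Proof. by case: sgT => + _ _ _ _; exact. Qed.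

Lemma sgD s u v : 0 <= s -> T s (u + v) = T s u + T s v.
Proof. by move=> s0; have := sg_lin _ s0 1 u v; rewrite !scale1r. Qed.

Lemma sgZ s (c : CC R) u : 0 <= s -> T s (c *: u) = c *: T s u.
Proof.
move=> s0; have T0 : T s 0 = 0.
  by have := sg_lin _ s0 (-1) 0 0; rewrite scaler0 addr0 scaleN1r addNr.
by rewrite -[c *: u]addr0 sg_lin// T0 addr0.
Qed.

Lemma sg_id u : T 0 u = u. Proof. by case: sgT. Qed.

Lemma sg_add s t u : 0 <= s -> 0 <= t -> T (s + t) u = T s (T t u).
Proof. by case: sgT => _ _ + _ _ s0 t0; exact. Qed.

Definition sg_bounded_by M := 0 <= M /\ forall s u, 0 <= s -> nrm R X (T s u) <= M * nrm R X u.

Lemma sg_bounded : exists M, sg_bounded_by M.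
Proof.
(* On the zero space the given bound may be negative. *)
case: sgT => _ _ _ _ [M hM]; exists (Num.max M 0); split; first by rewrite le_max lexx orbT.
move=> s u s0; have := hM s u s0; rewrite !normE -RcM ler_Rc => /le_trans; apply.
by rewrite ler_wpM2r ?nrm_ge0// le_max lexx.
Qed.

Lemma sg_norm_continuous u : norm_continuous_normr R X (fun s => T s u).
Proof.
case: sgT => _ _ _ cT _ s e e0.
have /subspace_continuousP/(_ `|s|) := cT u.
rewrite /= in_itv/= andbT => /(_ (normr_ge0 s))/cvgrPdist_lt/(_ (Rc e)).
rewrite -Rc0 ltr_Rc => /(_ e0); rewrite /within /= => /nbhs_ballP[d /= d0 hd].
exists d => // t st; rewrite -ltr_Rc -normE; apply: hd.
  by rewrite /ball /=; exact: le_lt_trans (ler_dist_dist _ _) st.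
by rewrite /= in_itv/= normr_ge0.
Qed.

Variable M : R.
Hypothesis TM : sg_bounded_by M.

Lemma rdual_sg K psi r : rdual R X K psi -> 0 <= r -> rdual R X (K * M) (fun u => psi (T r u)).
Proof.
have [M0 bM] := TM; move=> [K0 l b] r0; split; first by rewrite mulr_ge0.
- by split=> [u v|c u]; [rewrite sgD// l.1|rewrite sgZ// l.2].
- by move=> u; rewrite (le_trans (b _))// -mulrA ler_wpM2l// bM.
Qed.

Lemma sg_BC K psi u : rdual R X K psi -> BC R (K * (M * nrm R X u)) (fun s => psi (T s u)).
Proof.
have [M0 bM] := TM; move=> dpsi; split.
  exact: (rdual_continuous_normr R X K psi _ dpsi (sg_norm_continuous u)).
by have [K0 _ b] := dpsi; move=> s s0; rewrite (le_trans (b _))// ler_wpM2l// bM.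
Qed.

(** Applying an operator to the orbit and evaluating is again a bounded functional of the starting
    vector. This is how weak limits of vectors, and linearity in the vector, pass through
    convolution operators. *)
Lemma bop_sg_rdual Kp lam P K psi r : bop R Kp lam P -> rdual R X K psi -> 0 <= r ->
  rdual R X (Kp * (K * M)) (fun u => P (fun s => psi (T s u)) r).
Proof.
have [M0 _] := TM; move=> bP dpsi r0; have [K0 l _] := dpsi.
have BCpsi v := sg_BC _ _ v dpsi.
have absB v s : 0 <= s -> psi (T s v) = psi (T `|s| v) by move=> s0; rewrite ger0_norm.
split; first by rewrite !mulr_ge0// (bop_ge0 _ _ _ _ bP).
- split=> [u v|c u].
    rewrite -(bopD _ _ _ _ _ _ _ _ _ bP (BCpsi u) (BCpsi v))//.
    apply: (bop_ext _ _ _ _ (K * (M * nrm R X u) + K * (M * nrm R X v)) _ _ bP) => //.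
    + apply: BC_weaken (BCpsi _); rewrite -!mulrDr !ler_wpM2l//; exact: nrmD.
    + exact: BCD.
    + by move=> s s0; rewrite sgD// l.1.
  rewrite -(bopZ0 _ _ _ _ _ _ _ _ bP (BCpsi u))//.
  apply: (bop_ext _ _ _ _ (`|c| * (K * (M * nrm R X u))) _ _ bP) => //.
  + by apply: BC_weaken (BCpsi _); rewrite nrmZ le_eqVlt; apply/orP; left; apply/eqP; ring.
  + exact: BCZ.
  + by move=> s s0; rewrite sgZ// l.2.
- by move=> u; rewrite (le_trans (bop_bound _ _ _ _ _ _ _ bP (BCpsi u) r0))// !mulrA.
Qed.

Section Weighted.
Variables (m : {measure set (measurableTypeR R) -> \bar R}) (D : set R).
Hypotheses (mD : measurable (D : set (measurableTypeR R))) (D0 : D `<=` `[0%R, +oo[).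
Variable w : R -> R.
Hypotheses (w0 : forall s, D s -> 0 <= w s) (iw : iint R m D w).

Let D_ge0 s : D s -> 0 <= s.
Proof. by move=> /D0; rewrite /= in_itv/= andbT. Qed.

Lemma sg_bounded_orbit u s : 0 <= s -> nrm R X (T s u) <= M * nrm R X u.
Proof. by have [_] := TM; exact. Qed.

Lemma vint_sg_weighted u psi K : rdual R X K psi ->
  psi (vint m D (fun s => Rc (w s) *: T s u)) = Rintegral m D (fun s => w s * psi (T s u)).
Proof.
move=> dpsi.
have key psi' K' : rdual R X K' psi' -> (fun s => psi' (Rc (w s) *: T s u)) =
    (fun s => w s * psi' (T s u)).
  by move=> [_ l _]; apply/funext => s; rewrite l.2.
rewrite (vint_rdual R X m D _ _ _ _ dpsi) ?(key _ _ dpsi)//.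
have [z hz] := Pettis_integral R X m D mD D0 w (fun s => T s u) _ w0 iw
  (sg_norm_continuous u) (sg_bounded_orbit u).
exists z => psi' K' d'; rewrite (key _ _ d'); split; last exact: hz d'.
exact: (iint_weighted_dual R X m D mD D0 w (fun s => T s u) _ w0 iw
  (sg_norm_continuous u) (sg_bounded_orbit u) psi' K').
Qed.

End Weighted.

End Semigroup.

(** * Convolution with a measure having a density *)

Section WeightedShifts.
Variables (R : realType) (m : {measure set (measurableTypeR R) -> \bar R}) (D : set R).
Hypotheses (mD : measurable (D : set (measurableTypeR R))) (D0 : D `<=` `[0%R, +oo[).
Variable w : R -> R.
Hypotheses (w0 : forall s, D s -> 0 <= w s) (iw : iint R m D w).

Lemma bop_weighted_shift : bop R (Rintegral m D w)
  (fun z => Rintegral m D (fun s => w s * expR (- (s * z))))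
  (fun h r => Rintegral m D (fun s => w s * h (r + s))).
Proof.
apply: (bop_integral R m D mD w (fun s z => w s * expR (- (s * z)))
  (fun s h r => w s * h (r + s))) => //.
- move=> s Ds; have s0 : 0 <= s by have := D0 _ Ds; rewrite /= in_itv/= andbT.
  have := bop_scale R (w s) _ _ _ (bop_shift R s s0).
  by rewrite mulr1 ger0_norm ?w0.
- move=> B h r bh r0; apply: measurable_funM; first exact: iint_measurable iw.
  have := BC_measurable _ _ _ _ mD D0 (BC_shift R r B h r0 bh).
  by apply: eq_measurable_fun => s _; rewrite addrC.
Qed.

End WeightedShifts.

(** * Bernstein functions without constant term *)

Section Bernstein.
Variables (R : realType) (b : R) (nu : {measure set (measurableTypeR R) -> \bar R}).
Implicit Types (s t z : R).

Lemma itv0y_measurable : measurable (`[0%R, +oo[%classic : set (measurableTypeR R)).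
Proof. exact: measurable_itv. Qed.

Lemma itv0y_open_measurable : measurable (`]0%R, +oo[%classic : set (measurableTypeR R)).
Proof. exact: measurable_itv. Qed.

Lemma subset_itv0y_open : (`]0%R, +oo[%classic : set R) `<=` `[0%R, +oo[%classic.
Proof. by move=> s; rewrite /= !in_itv/= !andbT => /ltW. Qed.

Lemma one_minus_exp_ge0 s z : 0 <= s -> 0 <= z -> 0 <= 1 - expR (- (s * z)).
Proof. by move=> s0 z0; rewrite subr_ge0 -expR0 ler_expR oppr_le0 mulr_ge0. Qed.

Lemma one_minus_exp_le s z : 0 <= s -> 0 <= z ->
  1 - expR (- (s * z)) <= (1 + z) * Num.min 1 s.
Proof.
move=> s0 z0; have e1 := expR_ge0 (- (s * z)); have e2 := expR_ge1Dx (- (s * z)).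
rewrite /Num.min; case: ltP => _; first by lra.
by nra.
Qed.

(** Passes through t / (1 + t), using e^{-t} <= 1 / (1 + t). It bounds \int min(1, s/t) nu(ds) by 2
    g (1/t). *)
Lemma min_le_one_minus_exp t : 0 <= t -> Num.min 1 t <= 2 * (1 - expR (- t)).
Proof.
move=> t0; have e1 : expR (- t) <= (1 + t)^-1.
  by rewrite expRN lef_pV2 ?posrE ?expR_gt0 ?expR_ge1Dx//; lra.
have t1 : 0 < 1 + t by lra.
apply: (@le_trans _ _ (2 * (1 - (1 + t)^-1))); last by rewrite ler_pM2l//; lra.
have -> : 2 * (1 - (1 + t)^-1) = 2 * t / (1 + t) by field; rewrite gt_eqF.
by rewrite ler_pdivlMr// /Num.min; case: ltP => ?; nra.
Qed.

Hypothesis bd : bernstein_data 0 b nu.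

Lemma iint_min : iint R nu `]0%R, +oo[ (Num.min 1).
Proof.
have [_ _ _ i] := bd.
apply: (iint_dominated _ _ _ itv0y_open_measurable _ (fun s => 2 * (s / (1 + s)))).
- by apply: measurable_minr => //; exact: measurable_cst.
- move=> s; rewrite /= in_itv/= andbT => s0.
  have s1 : 0 < 1 + s by lra.
  rewrite ger0_norm ?le_min ?ler01 ?(ltW s0)//.
  by rewrite mulrA ler_pdivlMr// /Num.min; case: ltP => ?; nra.
- by apply: iintZ => //; exact: itv0y_open_measurable.
Qed.

Lemma iint_one_minus_exp z : 0 <= z -> iint R nu `]0%R, +oo[ (fun s => 1 - expR (- (s * z))).
Proof.
move=> z0.
apply: (iint_dominated _ _ _ itv0y_open_measurable _ (fun s => (1 + z) * Num.min 1 s)).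
- apply: BC_measurable itv0y_open_measurable subset_itv0y_open _.
  exact: BCB (BC_cst _ _) (BC_exp R z z0).
- move=> s; rewrite /= in_itv/= andbT => /ltW s0.
  by rewrite ger0_norm ?one_minus_exp_ge0// one_minus_exp_le.
- by apply: iintZ; [exact: itv0y_open_measurable|exact: iint_min].
Qed.

Let g := bernstein 0 b nu.

Lemma bernstein_ge0 z : 0 <= z -> 0 <= g z.
Proof.
have [_ b0 _ _] := bd; move=> z0; rewrite /g /bernstein add0r addr_ge0 ?mulr_ge0//.
apply: Rintegral_ge0 => s; rewrite /= in_itv/= andbT => /ltW s0.
exact: one_minus_exp_ge0.
Qed.

Lemma bernstein_homo z t : 0 <= z -> z <= t -> g z <= g t.
Proof.
have [_ b0 _ _] := bd; move=> z0 zt; have t0 := le_trans z0 zt.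
rewrite /g /bernstein !add0r; apply: lerD; first by rewrite ler_wpM2l.
apply: le_Rintegral; [exact: itv0y_open_measurable|exact: iint_one_minus_exp..|].
move=> s; rewrite /= in_itv/= andbT => /ltW s0.
by rewrite lerD2l lerN2 ler_expR lerN2 ler_wpM2l.
Qed.

(** The increment is the transform of a positive measure: the mass b al at 0 plus the density 1 -
    e^{-s al} with respect to nu. Its total mass, hence the norm bound, is g al. *)
Lemma bop_bernstein_increment al : 0 <= al ->
  bop R (g al) (fun z => g (al + z) - g z)
    (fun h r => b * al * h r +
      Rintegral nu `]0%R, +oo[ (fun s => (1 - expR (- (s * al))) * h (r + s))).
Proof.
have [_ b0 _ _] := bd; move=> al0.
have w0 s : (`]0%R, +oo[%classic : set R) s -> 0 <= 1 - expR (- (s * al)).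
  by rewrite /= in_itv/= andbT => /ltW s0; exact: one_minus_exp_ge0.
have := bop_add R _ _ _ _ _ _ (bop_scale R (b * al) _ _ _ (bop_id R))
  (bop_weighted_shift R nu _ itv0y_open_measurable subset_itv0y_open _ w0
    (iint_one_minus_exp _ al0)).
rewrite mulr1 ger0_norm ?mulr_ge0//= => bQ.
rewrite {1}/g /bernstein add0r.
apply: bop_symbol bQ => z z0; rewrite mulr1 /g /bernstein !add0r mulrDr.
have i1 := iint_one_minus_exp (al + z) (addr_ge0 al0 (ltW z0)).
have i2 := iint_one_minus_exp z (ltW z0).
have -> : Rintegral nu `]0%R, +oo[ (fun s => (1 - expR (- (s * al))) * expR (- (s * z))) =
    Rintegral nu `]0%R, +oo[ (fun s => 1 - expR (- (s * (al + z)))) -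
    Rintegral nu `]0%R, +oo[ (fun s => 1 - expR (- (s * z))).
  rewrite -(RintegralB itv0y_open_measurable i1 i2); apply: eq_Rintegral => s _.
  by rewrite mulrDr opprD expRD; ring.
by move: (Rintegral _ _ _) (Rintegral _ _ _) => J1 J2; ring.
Qed.

End Bernstein.

(** * Consequences of f(0+) = oo *)

Section Potential.
Variables (R : realType) (a b : R).
Variables (mu nu : {measure set (measurableTypeR R) -> \bar R}).
Hypothesis bda : bernstein_data a b nu.
Hypothesis fE : forall z, 0 < z -> Laplace mu z = (bernstein a b nu z)^-1.
Hypothesis finf : Laplace mu z @[z --> 0^'+] --> +oo.

Lemma bernstein_small e : 0 < e ->
  exists2 d : R, 0 < d & forall z, 0 < z -> z < d -> bernstein a b nu z < e.
Proof.
move=> e0; have /cvgryPgt/(_ e^-1) := finf.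
move=> /nbhs_ballP[d /= d0 hd]; exists d => // z z0 zd.
have := hd z; rewrite /ball /= sub0r normrN gtr0_norm// => /(_ zd z0).
rewrite fE// => lt; have g0 : 0 < bernstein a b nu z.
  by rewrite -invr_gt0 (lt_trans _ lt)// invr_gt0.
by rewrite -ltf_pV2.
Qed.

Lemma bernstein_constant0 : a = 0.
Proof.
have [a0 b0 _ _] := bda; apply/le_anti; rewrite a0 andbT; apply/ler_addgt0Pr => e e0.
have [d d0 hd] := bernstein_small e e0; rewrite add0r.
have d2 : 0 < d / 2 by lra.
apply: le_trans (ltW (hd _ d2 _)); last by lra.
rewrite /bernstein -addrA lerDl; apply: addr_ge0; first exact: mulr_ge0 b0 (ltW d2).
apply: Rintegral_ge0 => s; rewrite /= in_itv/= andbT => /ltW s0.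
by apply: one_minus_exp_ge0 => //; exact: ltW.
Qed.

End Potential.

(** * Inversion of the potential along the Abel means *)

Section Inversion.
Variables (R : realType) (X : completeNormedModType (CC R)) (b : R).
Variables (mu nu : {measure set (measurableTypeR R) -> \bar R}).
Variables (T : R -> X -> X) (x y : X).
Hypothesis muL : laplace_transformable mu.
Hypothesis bd : bernstein_data 0 b nu.
Hypothesis fE : forall z, 0 < z -> Laplace mu z = (bernstein 0 b nu z)^-1.
Hypothesis finf : Laplace mu z @[z --> 0^'+] --> +oo.
Hypothesis sgT : bounded_C0_semigroup T.

Notation g := (bernstein 0 b nu).

(** A zero at z would by monotonicity make g nonpositive on ]0, z], while f, and with it g = 1/f, is
    positive near 0. *)
Lemma potential_gt0 z : 0 < z -> 0 < g z.
Proof.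
move=> z0; rewrite lt_neqAle eq_sym (bernstein_ge0 _ _ _ bd) ?(ltW z0)// andbT.
apply/eqP => gz0.
have := finf => /cvgryPgt/(_ 0)/nbhs_ballP[d /= d0 hd].
pose v := Num.min z (d / 2).
have v0 : 0 < v by rewrite lt_min z0; lra.
have vd : v < d by rewrite gt_min; apply/orP; right; lra.
have := hd v; rewrite /ball /= sub0r normrN gtr0_norm// => /(_ vd v0).
rewrite fE// invr_gt0 => gv0.
have vz : v <= z by rewrite ge_min lexx.
by have := bernstein_homo R b nu bd _ _ (ltW v0) vz; rewrite gz0 leNgt gv0.
Qed.

Definition abel_mean al := vint mu `[0%R, +oo[ (fun s => Rc (expR (- (al * s))) *: T s x).

Hypothesis weak_limit : forall phi : X -> CC R, dual_fun phi ->
  phi (abel_mean al) @[al --> 0^'+] --> phi y.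

Lemma weak_limit_seq K psi (al : nat -> R) : rdual R X K psi ->
  (forall n, 0 < al n) -> al n @[n --> \oo] --> (0:R) ->
  psi (abel_mean (al n)) @[n --> \oo] --> psi y.
Proof.
move=> dpsi al0 alc.
have := weak_limit _ (complexify_dual R X K psi dpsi).
move=> /cvgrPdist_lt hc; apply/cvgrPdist_lt => e e0.
have := hc (Rc e); rewrite -Rc0 ltr_Rc => /(_ e0)/nbhs_ballP[d /= d0 hd].
have /cvgrPdist_lt/(_ d d0) := alc; apply: filterS => n lt.
have := hd (al n) lt (al0 n).
rewrite -[X in X < _]Rc_cRe ?normr_ge0// ltr_Rc; apply: le_lt_trans.
by have := cRe_norm_le R (complexify R X psi y - complexify R X psi (abel_mean (al n)));
  rewrite cReD cReN.
Qed.

Lemma iint_laplace_weight al : 0 < al -> iint R mu `[0%R, +oo[ (fun s => expR (- (al * s))).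
Proof.
move=> al0; have := muL al al0; rewrite /iint.
by under [X in _ -> _.-integrable _ X]eq_fun do rewrite mulrC.
Qed.

Lemma rdual_abel_mean K psi al : rdual R X K psi -> 0 < al ->
  psi (abel_mean al) = Rintegral mu `[0%R, +oo[ (fun s => expR (- (al * s)) * psi (T s x)).
Proof.
move=> dpsi al0; have [M TM] := sg_bounded R X T sgT.
apply: (vint_sg_weighted R X T sgT M TM mu _ (itv0y_measurable R)) dpsi => //.
exact: iint_laplace_weight.
Qed.

(* With f = 1/g, the symbol identity lamS f_al + lamR (g_al - g) f_al = lamR, where
   f_al z = f (al + z) and g_al z = g (al + z), expresses P_R x through P_S (abel_mean al) up to
   an error of norm at most g al times that of abel_mean al, which is bounded by the
   uniform boundedness principle. *)
Theorem potential_inversion KS KR lamS lamR PS PR K psi :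
  bop R KS lamS PS -> bop R KR lamR PR -> (forall z, 0 < z -> lamS z = lamR z * g z) ->
  rdual R X K psi ->
  PR (fun s => psi (T s x)) 0 = PS (fun s => psi (T s y)) 0.
Proof.
move=> bS bR SR dpsi; have [M TM] := sg_bounded R X T sgT; have [M0 _] := TM.
have [K0 _ _] := dpsi.
pose orb u s := psi (T s u).
have orbBC u : BC R (K * (M * nrm R X u)) (orb u) by exact: (sg_BC R X T sgT M TM).
pose al n : R := n.+1%:R^-1.
have al0 n : 0 < al n by rewrite invr_gt0.
have alc : al n @[n --> \oo] --> (0 : R).
  apply/cvgrPdist_lt => e e0; near=> n; rewrite sub0r normrN gtr0_norm//.
  by near: n; exact: near_infty_natSinv_lt (PosNum e0).
have [C hC] : exists C, forall n, nrm R X (abel_mean (al n)) <= C.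
  apply: weakly_bounded_sequence => psi' K' d'.
  have cc := weak_limit_seq _ _ _ d' al0 alc.
  have [B [_ hB]] : bounded_fun (fun n => psi' (abel_mean (al n))).
    by apply: cvg_seq_bounded; apply/cvg_ex; exists (psi' y).
  by exists (B + 1) => n; apply: hB => //; lra.
have C0 : 0 <= C := le_trans (nrm_ge0 _ _ _) (hC 0%N).
pose E n := PR (fun r => b * al n * orb (abel_mean (al n)) r +
  Rintegral nu `]0%R, +oo[ (fun s => (1 - expR (- (s * al n))) * orb (abel_mean (al n)) (r + s))) 0.
have split n : PR (orb x) 0 = PS (orb (abel_mean (al n))) 0 + E n.
  set A := abel_mean (al n).
  have w0 s : (`[0%R, +oo[%classic : set R) s -> 0 <= expR (- (al n * s)).
    by move=> _; exact: expR_ge0.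
  have bF := bop_weighted_shift R mu _ (itv0y_measurable R) (@subset_refl _ _) _ w0
    (iint_laplace_weight _ (al0 n)).
  have bQ := bop_bernstein_increment R b nu bd _ (ltW (al0 n)).
  set PF := (fun h r => Rintegral mu _ _) in bF.
  set PQ := (fun h r => b * al n * h r + _) in bQ.
  (* The orbit of the Abel mean is the convolution of the orbit of [x], because [psi] composed with
     [T s] is again a bounded functional. *)
  have FA s : 0 <= s -> PF (orb x) s = orb A s.
    move=> s0; rewrite /PF /orb /A.
    rewrite (rdual_abel_mean _ _ _ (rdual_sg R X T sgT M TM _ _ _ dpsi s0) (al0 n)).
    apply: eq_Rintegral => t /set_mem; rewrite /= in_itv/= andbT => t0.
    by rewrite sg_add.
  have bT := bop_add R _ _ _ _ _ _ (bop_comp R _ _ _ _ _ _ bS bF)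
    (bop_comp R _ _ _ _ _ _ bR (bop_comp R _ _ _ _ _ _ bQ bF)).
  have sym z : 0 < z -> lamR z = lamS z * Rintegral mu `[0%R, +oo[ (fun s => expR (- (al n * s)) * expR (- (s * z)))
     + lamR z * ((g (al n + z) - g z) * Rintegral mu `[0%R, +oo[ (fun s => expR (- (al n * s)) * expR (- (s * z)))).
    move=> z0.
    have -> : Rintegral mu `[0%R, +oo[ (fun s => expR (- (al n * s)) * expR (- (s * z))) = (g (al n + z))^-1.
      rewrite -fE ?addr_gt0// /Laplace; apply: eq_Rintegral => s _.
      by rewrite mulrDr opprD expRD (mulrC (al n)).
    have gn0 : g (al n + z) != 0 by rewrite gt_eqF// potential_gt0// addr_gt0.
    by rewrite SR//; move: (g (al n + z)) (g z) (lamR z) gn0 => u v l u0; field; exact: u0.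
  have FBC := bop_BC _ _ _ _ bF _ _ (orbBC x).
  set BF := _ * _ in FBC.
  have ABC := orbBC A.
  (* [bop_ext] asks for one bound common to both functions, here the sum of the two. *)
  have FBC' := BC_weaken _ _ _ _ (ler_wpDr (BC_ge0 _ _ _ ABC) (lexx BF)) FBC.
  have ABC' := BC_weaken _ _ _ _ (ler_wpDl (BC_ge0 _ _ _ FBC) (lexx _)) ABC.
  rewrite (bop_unique R _ _ _ _ _ _ _ _ _ bR bT sym (orbBC x) (lexx 0)).
  rewrite (bop_ext _ _ _ _ _ _ _ bS FBC' ABC' FA 0 (lexx _)); congr (_ + _).
  have bRQ := bop_comp R _ _ _ _ _ _ bR bQ.
  exact: (bop_ext _ _ _ _ _ _ _ bRQ FBC' ABC' FA 0 (lexx _)).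
have Ec : E n @[n --> \oo] --> (0 : R).
  have Eb n : `|E n| <= g (al n) * (KR * (K * (M * C))).
    have bQ := bop_bernstein_increment R b nu bd _ (ltW (al0 n)).
    have := bop_bound _ _ _ _ _ _ _ (bop_comp R _ _ _ _ _ _ bR bQ) (orbBC (abel_mean (al n))) (lexx 0).
    move=> /le_trans; apply.
    rewrite [leRHS]mulrCA -mulrA ler_wpM2l ?(bop_ge0 _ _ _ _ bR)//.
    rewrite ler_wpM2l ?(bernstein_ge0 _ _ _ bd) ?(ltW (al0 n))//.
    by rewrite !ler_wpM2l.
  set C' := KR * (K * (M * C)) in Eb.
  have C'0 : 0 <= C' by rewrite !mulr_ge0// (bop_ge0 _ _ _ _ bR).
  apply/cvgrPdist_lt => e e0.
  have [d d0 hd] := bernstein_small R 0 b mu nu fE finf (e / (C' + 1)) ltac:(by rewrite divr_gt0// ltr_wpDl).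
  have /cvgrPdist_lt/(_ d d0) := alc; apply: filterS => n.
  rewrite sub0r normrN gtr0_norm// => lt; rewrite sub0r normrN (le_lt_trans (Eb n))//.
  have := hd _ (al0 n) lt; rewrite ltr_pdivlMr ?ltr_wpDl//; apply: le_lt_trans.
  rewrite ler_wpM2l ?(bernstein_ge0 _ _ _ bd) ?(ltW (al0 n))//; lra.
have Sc : PS (orb (abel_mean (al n))) 0 @[n --> \oo] --> PS (orb y) 0.
  (* [PS] of an orbit at 0 depends on the vector through a bounded functional, to which the weak
     limit applies. *)
  have dS := bop_sg_rdual R X T sgT M TM _ _ _ _ _ _ bS dpsi (lexx 0).
  exact: weak_limit_seq _ _ _ dS al0 alc.
have splitE : (fun n => PS (orb (abel_mean (al n))) 0 + E n) = fun=> PR (orb x) 0.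
  by apply/funext => n; rewrite -split.
have := cvgD Sc Ec; rewrite addr0 => SEc.
have SEc' : (fun n => PS (orb (abel_mean (al n))) 0 + E n) @ \oo --> PS (orb y) 0 by exact: SEc.
by rewrite splitE in SEc'; exact: (cvg_unique _ (cvg_cst _) SEc').
Unshelve. all: by end_near. Qed.

End Inversion.

(** * Integrals of decaying exponentials *)

Section ExponentialIntegrals.
Variables (R : realType) (z : R).
Hypothesis z0 : 0 < z.
Notation leb := (@lebesgue_measure R).

Let F (x : R) : R := - z^-1 * expR (- (x * z)).

Let dF (x : R) : is_derive x (1 : R) F (expR (- (x * z))).
Proof.
have d1 : is_derive x (1 : R) (fun x => - (x * z)) (- z).
  have -> : (fun x : R => - (x * z)) = (fun x => - z * x).
    by apply/funext => y; rewrite mulNr mulrC.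
  have := is_deriveZ (- z) (is_derive_id x (1 : R)).
  by rewrite /GRing.scale /= mulr1.
have d2 := @is_derive1_comp R expR (fun x => - (x * z)) x _ _ (is_derive_expR _) d1.
have d3 := is_deriveZ (- z^-1) d2.
apply: (is_derive_eq d3); rewrite /GRing.scale /=.
have -> : - z^-1 * (expR (- (x * z)) * - z) = z^-1 * z * expR (- (x * z)) by ring.
by rewrite mulVf ?gt_eqF// mul1r.
Qed.

Let cexp : continuous (fun x : R => expR (- (x * z))).
Proof.
move=> x; apply: continuous_comp; last exact: continuous_expR.
by apply: cvgN; apply: cvgMl; exact: cvg_id.
Qed.

Let cF : continuous F.
Proof. by move=> x; apply: cvgMr; exact: cexp. Qed.

Lemma Rintegral_exp_itv t : 0 < t ->
  Rintegral leb `[0%R, t] (fun s => expR (- (s * z))) = (1 - expR (- (t * z))) / z.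
Proof.
move=> t0; rewrite /Rintegral (@continuous_FTC2 _ _ F)//.
- by rewrite /= /F mul0r oppr0 expR0; ring.
- exact: continuous_subspaceT.
- split.
  + by move=> x _; exact: ex_derive.
  + by apply: cvg_at_right_filter; exact: cF.
  + by apply: cvg_at_left_filter; exact: cF.
- by move=> x _; rewrite derive1E (@derive_val _ _ _ _ _ _ _ (dF x)).
Qed.

Let integral_exp_itvy c :
  (\int[leb]_(s in `[c, +oo[) (expR (- (s * z)))%:E = (expR (- (c * z)) / z)%:E)%E.
Proof.
rewrite (@ge0_continuous_FTC2y _ _ F _ 0).
- by rewrite -EFinB /F; congr (_%:E); ring.
- by move=> x _; exact: expR_ge0.
- exact: continuous_subspaceT.
- rewrite -[0](mulr0 (- z^-1)); apply: cvgMr.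
  apply: (cvg_comp _ _ _ (@cvgr_expR R)).
  apply/cvgryPge => A; have := nbhs_pinfty_ge (num_real (A / z)).
  by apply: filterS => x; rewrite ler_pdivrMr.
- by move=> x _; exact: ex_derive.
- by apply: cvg_at_right_filter; exact: cF.
- by move=> x _; rewrite derive1E (@derive_val _ _ _ _ _ _ _ (dF x)).
Qed.

Lemma Rintegral_exp_itvy c :
  Rintegral leb `[c, +oo[ (fun s => expR (- (s * z))) = expR (- (c * z)) / z.
Proof. by rewrite /Rintegral integral_exp_itvy. Qed.

Lemma iint_exp_itvy c : iint R leb `[c, +oo[ (fun s => expR (- (s * z))).
Proof.
apply/integrableP; split.
  apply/measurable_EFinP; apply: measurable_funS (continuous_measurable_fun cexp) => //.
rewrite (eq_integral (fun s : measurableTypeR R => (expR (- (s * z)))%:E)).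
  by rewrite integral_exp_itvy ltry.
by move=> s _; rewrite /= ger0_norm ?expR_ge0.
Qed.

End ExponentialIntegrals.

(** * Cesaro averages, the resolvent at -1, and g(A) composed with a regularizing operator *)

Section CesaroAndExponentialOperators.
Variable R : realType.
Implicit Types (h : R -> R) (r s t z : R).
Notation leb := (@lebesgue_measure R).

(** The algebra of operators bounds P minus its shift by a constant independent of the shift, which
    need not be integrable against nu; a Lipschitz estimate can be put in its place. *)
Lemma bop_sharpen K K' lam P : bop R K lam P -> 0 <= K' ->
  (forall B h r, BC R B h -> 0 <= r -> `|P h r| <= K' * B) -> bop R K' lam P.
Proof.
move=> [K0 bb ll cc ee] K'0 bnd; split=> // B h bh; split; first by have [] := bb _ _ bh.
by move=> s s0; exact: bnd.
Qed.

Definition cesaro_op t h r := Rintegral leb `[0%R, t] (fun s => t^-1 * h (r + s)).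

Lemma subset_itv0y t : (`[0%R, t]%classic : set R) `<=` `[0%R, +oo[%classic.
Proof. by move=> s; rewrite /= !in_itv/= andbT => /andP[]. Qed.

Lemma itv_measurable (i : interval R) : measurable ([set` i] : set (measurableTypeR R)).
Proof. exact: measurable_itv. Qed.

Lemma iint_cst (m : {measure set (measurableTypeR R) -> \bar R}) (D : set R) (c : R) :
  measurable (D : set (measurableTypeR R)) -> (m D < +oo)%E -> iint R m D (fun=> c).
Proof.
move=> mD mDy; apply/integrableP; split; first exact: measurable_cst.
under eq_integral do rewrite /=.
by rewrite integral_cst//= lte_mul_pinfty.
Qed.

Lemma lebesgue_itv0 t : 0 <= t -> leb `[0%R, t]%classic = t%:E.
Proof.
move=> t0; rewrite lebesgue_measure_itv/= lte_fin; case: ltP => h.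
  by rewrite oppr0 adde0.
by congr (_%:E); apply/le_anti; rewrite t0 h.
Qed.

Lemma bop_cesaro t : 0 < t ->
  bop R 1 (fun z => (1 - expR (- (t * z))) / (t * z)) (cesaro_op t).
Proof.
move=> t0.
have lt : (leb `[0%R, t]%classic < +oo)%E by rewrite lebesgue_itv0 ?ltry// ltW.
have it := iint_cst leb `[0%R, t] t^-1 (itv_measurable _) lt.
have w0 s : (`[0%R, t]%classic : set R) s -> 0 <= t^-1 by move=> _; rewrite invr_ge0 ltW.
have := bop_weighted_shift R leb _ (itv_measurable _) (subset_itv0y t) _ w0 it.
have -> : Rintegral leb `[0%R, t] (fun=> t^-1) = 1.
  rewrite Rintegral_cst; last exact: itv_measurable.
  by rewrite [X in fine X](lebesgue_itv0 t (ltW t0))/= mulVf ?gt_eqF.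
apply: bop_symbol => z z0.
have iz : iint R leb `[0%R, t] (fun s => expR (- (s * z))).
  apply: integrableS (iint_exp_itvy R z z0 0); [exact: itv_measurable..|exact: subset_itv0y].
rewrite (RintegralZl t^-1 (itv_measurable _) iz) Rintegral_exp_itv//.
by rewrite mulrC invfM -mulrA (mulrC z^-1).
Qed.

(** Both sides have the symbol (1 - e^{-sz}) (1 - e^{-tz}) / (t z), which up to the factor 1/t is
    symmetric in s and t. *)
Lemma cesaro_op_difference t s B h r : 0 < t -> 0 < s -> BC R B h -> 0 <= r ->
  cesaro_op t h r - cesaro_op t h (r + s) = s / t * (cesaro_op s h r - cesaro_op s h (r + t)).
Proof.
move=> t0 s0 bh r0.
have diff p q : 0 < p -> 0 < q -> bop R (1 + 1 * 1)
    (fun z => (1 - expR (- (p * z))) / (p * z) - expR (- (q * z)) * ((1 - expR (- (p * z))) / (p * z)))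
    (fun h r => cesaro_op p h r - cesaro_op p h (r + q)).
  move=> p0 q0; apply: (bop_sub R _ _ _ _ _ _ (bop_cesaro p p0)).
  exact: (bop_comp R _ _ _ _ _ _ (bop_shift R q (ltW q0)) (bop_cesaro p p0)).
apply: (bop_unique R _ _ _ _ _ _ B h r (diff t s t0 s0)
  (bop_scale R (s / t) _ _ _ (diff s t s0 t0))) => // z z0.
move: (expR _) (expR _) => u v; field; rewrite !gt_eqF//.
Qed.

(** The resolvent (1 + A)^-1 in convolution form. *)
Definition exp_op h r := Rintegral leb `[0%R, +oo[ (fun s => expR (- s) * h (r + s)).

Lemma iint_expN c : iint R leb `[c, +oo[ (fun s => expR (- s)).
Proof.
have := iint_exp_itvy R 1 ltr01 c; congr (iint _ _ _ _).
by apply/funext => s; rewrite mulr1.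
Qed.

Lemma Rintegral_expN_itvy c : Rintegral leb `[c, +oo[ (fun s => expR (- s)) = expR (- c).
Proof.
have := Rintegral_exp_itvy R 1 ltr01 c; rewrite divr1 mulr1 => <-.
by apply: eq_Rintegral => s _; rewrite mulr1.
Qed.

Lemma bop_exp_op : bop R 1 (fun z => (1 + z)^-1) exp_op.
Proof.
have w0 s : (`[0%R, +oo[%classic : set R) s -> 0 <= expR (- s) by move=> _; exact: expR_ge0.
have := bop_weighted_shift R leb _ (itv_measurable _) (@subset_refl _ _) _ w0 (iint_expN 0).
rewrite Rintegral_expN_itvy oppr0 expR0; apply: bop_symbol => z z0.
have z1 : 0 < 1 + z by lra.
have := Rintegral_exp_itvy R (1 + z) z1 0; rewrite mul0r oppr0 expR0 mul1r => <-.
by apply: eq_Rintegral => s _; rewrite mulrDr mulr1 opprD expRD.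
Qed.

Lemma bop_exp_truncated s : 0 < s ->
  bop R (Rintegral leb `[0%R, s] (fun u => expR (- u)))
    (fun z => (1 - expR (- (s * (1 + z)))) / (1 + z))
    (fun h r => Rintegral leb `[0%R, s] (fun u => expR (- u) * h (r + u))).
Proof.
move=> s0.
have w0 u : (`[0%R, s]%classic : set R) u -> 0 <= expR (- u) by move=> _; exact: expR_ge0.
have iu : iint R leb `[0%R, s] (fun u => expR (- u)).
  by apply: integrableS (iint_expN 0); [exact: itv_measurable..|exact: subset_itv0y].
have := bop_weighted_shift R leb _ (itv_measurable _) (subset_itv0y s) _ w0 iu.
apply: bop_symbol => z z0; have z1 : 0 < 1 + z by lra.
have := Rintegral_exp_itv R (1 + z) z1 s s0 => <-.
by apply: eq_Rintegral => u _; rewrite mulrDr mulr1 opprD expRD.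
Qed.

Lemma bop_exp_tail s : 0 < s ->
  bop R (Rintegral leb `[s, +oo[ (fun u => expR (- u)))
    (fun z => expR (- (s * (1 + z))) / (1 + z))
    (fun h r => Rintegral leb `[s, +oo[ (fun u => expR (- u) * h (r + u))).
Proof.
move=> s0.
have w0 u : (`[s, +oo[%classic : set R) u -> 0 <= expR (- u) by move=> _; exact: expR_ge0.
have sub : (`[s, +oo[%classic : set R) `<=` `[0%R, +oo[%classic.
  by move=> u; rewrite /= !in_itv/= !andbT; apply: le_trans; exact: ltW.
have := bop_weighted_shift R leb _ (itv_measurable _) sub _ w0 (iint_expN s).
apply: bop_symbol => z z0; have z1 : 0 < 1 + z by lra.
have := Rintegral_exp_itvy R (1 + z) z1 s => <-.
by apply: eq_Rintegral => u _; rewrite mulrDr mulr1 opprD expRD.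
Qed.

Lemma exp_op_step s B h r : 0 < s -> BC R B h -> 0 <= r ->
  exp_op h r = Rintegral leb `[0%R, s] (fun u => expR (- u) * h (r + u)) +
    expR (- s) * exp_op h (r + s).
Proof.
move=> s0 bh r0.
apply: (bop_unique R _ _ _ _ _ _ B h r bop_exp_op (bop_add R _ _ _ _ _ _ (bop_exp_truncated s s0)
  (bop_scale R (expR (- s)) _ _ _ (bop_comp R _ _ _ _ _ _ (bop_shift R s (ltW s0)) bop_exp_op))))
  => // z z0.
have z1 : 0 < 1 + z by lra.
have -> : expR (- (s * (1 + z))) = expR (- s) * expR (- (s * z)).
  by rewrite mulrDr mulr1 opprD expRD.
by move: (expR _) (expR _) => u v; field; rewrite gt_eqF.
Qed.

(** Each term on the right is the integral against a positive measure of mass 1 - e^{-s}, integrable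
    against nu. On the left the two masses are 1, and their separate integrals over s may
    diverge. *)
Lemma exp_op_difference s B h : 0 < s -> BC R B h ->
  exp_op h 0 - exp_op h s =
  Rintegral leb `[0%R, s] (fun u => expR (- u) * h u) -
  (expR s - 1) * Rintegral leb `[s, +oo[ (fun u => expR (- u) * h u).
Proof.
move=> s0 bh.
have e0 (D : set R) : Rintegral leb D (fun u => expR (- u) * h u) =
    Rintegral leb D (fun u => expR (- u) * h (0 + u)).
  by apply: eq_Rintegral => u _; rewrite add0r.
have -> : exp_op h s = exp_op h (0 + s) by rewrite add0r.
rewrite !e0.
apply: (bop_unique R _ _ _ _ _ _ B h 0
  (bop_sub R _ _ _ _ _ _ bop_exp_op (bop_comp R _ _ _ _ _ _ (bop_shift R s (ltW s0)) bop_exp_op))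
  (bop_sub R _ _ _ _ _ _ (bop_exp_truncated s s0)
    (bop_scale R (expR s - 1) _ _ _ (bop_exp_tail s s0)))) => // z z0.
have z1 : 0 < 1 + z by lra.
have -> : expR (- (s * (1 + z))) = expR (- s) * expR (- (s * z)).
  by rewrite mulrDr mulr1 opprD expRD.
have : expR s * expR (- s) = 1 by rewrite -expRD subrr expR0.
move: (expR s) (expR (- s)) (expR (- (s * z))) => e u v eu.
transitivity ((1 - u * v) / (1 + z) - (e * u * v - u * v) / (1 + z)); last by ring.
by rewrite eu; field; rewrite gt_eqF.
Qed.

(** For s <= 1 the step formula writes the difference as an integral over [0, s] minus (1 - e^{-s})
    times a value of [exp_op]; each is at most s B. *)
Lemma exp_op_lipschitz s B h r : 0 < s -> BC R B h -> 0 <= r ->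
  `|exp_op h r - exp_op h (r + s)| <= 2 * Num.min 1 s * B.
Proof.
move=> s0 bh r0; have rs0 : 0 <= r + s by rewrite addr_ge0// ltW.
have B0 := BC_ge0 _ _ _ bh.
have b1 := bop_bound _ _ _ _ _ _ _ bop_exp_op bh r0.
have b2 := bop_bound _ _ _ _ _ _ _ bop_exp_op bh rs0.
have b3 := bop_bound _ _ _ _ _ _ _ (bop_exp_truncated s s0) bh r0.
have KE : Rintegral leb `[0%R, s] (fun u => expR (- u)) = 1 - expR (- s).
  have := Rintegral_exp_itv R 1 ltr01 s s0; rewrite divr1 mulr1 => <-.
  by apply: eq_Rintegral => u _; rewrite mulr1.
rewrite /= KE in b3.
have e1 : 1 - expR (- s) <= s by have := expR_ge1Dx (- s); lra.
have e0 := one_minus_exp_ge0 R s 1 (ltW s0) ler01; rewrite mulr1 in e0.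
rewrite /Num.min; case: ltP => s1.
  by rewrite (le_trans (ler_normB _ _))//; lra.
rewrite (exp_op_step s B h r s0 bh r0).
set I := Rintegral _ _ _ in b3 *; set E := exp_op h (r + s) in b2 *.
have -> : I + expR (- s) * E - E = I - (1 - expR (- s)) * E by ring.
rewrite (le_trans (ler_normB _ _))// normrM (ger0_norm e0).
have := ler_pM e0 (normr_ge0 E) e1 b2; have := ler_wpM2r B0 e1; lra.
Qed.

Section BernsteinOfGenerator.
Variables (b : R) (nu : {measure set (measurableTypeR R) -> \bar R}).
Hypothesis bd : bernstein_data 0 b nu.
Variables (KR KD C : R) (lamR lamD : R -> R) (PR PD : (R -> R) -> R -> R).
Hypotheses (bR : bop R KR lamR PR) (bD : bop R KD lamD PD).
Hypothesis lamDE : forall z, 0 < z -> lamD z = z * lamR z.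
Hypothesis C0 : 0 <= C.
Hypothesis PR_lipschitz : forall B h r s, 0 < s -> BC R B h -> 0 <= r ->
  `|PR h r - PR h (r + s)| <= C * Num.min 1 s * B.

(* The operator g(A) PR, for g the Bernstein function with data (0, b, nu) and PD = A PR. *)
Definition bernstein_op h r :=
  b * PD h r + Rintegral nu `]0%R, +oo[ (fun s => PR h r - PR h (r + s)).

Lemma bop_bernstein_op : bop R
  (b * KD + Rintegral nu `]0%R, +oo[ (fun s => C * Num.min 1 s))
  (fun z => lamR z * bernstein 0 b nu z) bernstein_op.
Proof.
have [_ b0 _ _] := bd.
have mD := itv0y_open_measurable R; have sD := subset_itv0y_open R.
have min0 s : 0 < s -> 0 <= Num.min 1 s by move=> s0; rewrite le_min ler01 ltW.
have bs s : (`]0%R, +oo[%classic : set R) s -> bop R (C * Num.min 1 s)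
    (fun z => lamR z - expR (- (s * z)) * lamR z) (fun h r => PR h r - PR h (r + s)).
  rewrite /= in_itv/= andbT => s0.
  apply: (bop_sharpen (KR + 1 * KR)).
  - apply: (bop_sub R _ _ _ _ _ _ bR).
    exact: (bop_comp R _ _ _ _ _ _ (bop_shift R s (ltW s0)) bR).
  - by rewrite mulr_ge0// min0.
  - by move=> B h r bh r0; exact: PR_lipschitz.
have ik : iint R nu `]0%R, +oo[ (fun s => C * Num.min 1 s).
  by apply: iintZ => //; exact: iint_min bd.
have mP B h r : BC R B h -> 0 <= r ->
    measurable_fun (`]0%R, +oo[%classic : set (measurableTypeR R)) (fun s => PR h r - PR h (r + s)).
  move=> bh r0; apply: measurable_funB; first exact: measurable_cst.
  have := BC_measurable _ _ _ _ mD sD (BC_shift R r _ _ r0 (bop_BC _ _ _ _ bR _ _ bh)).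
  by apply: eq_measurable_fun => s _; rewrite addrC.
have := bop_add R _ _ _ _ _ _ (bop_scale R b _ _ _ bD)
  (bop_integral R nu _ mD _ _ _ bs ik mP).
rewrite (ger0_norm b0); apply: bop_symbol => z z0.
have iz := iint_one_minus_exp R b nu bd z (ltW z0).
rewrite lamDE// /bernstein add0r mulrDr -(RintegralZl (lamR z) mD iz).
congr (_ + _); first by ring.
by apply: eq_Rintegral => s _; ring.
Qed.

End BernsteinOfGenerator.

End CesaroAndExponentialOperators.

(** * Cesaro means of vectors and their upper limit *)

Section CesaroMeans.
Variables (R : realType) (X : completeNormedModType (CC R)) (T : R -> X -> X).
Hypothesis sgT : bounded_C0_semigroup T.
Variable M : R.
Hypothesis TM : sg_bounded_by R X T M.
Implicit Types (s t r : R) (u v : X) (psi : X -> R).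

Lemma rdual_cesaro_mean K psi t u : rdual R X K psi -> 0 < t ->
  psi (cesaro_mean T t u) = cesaro_op R t (fun s => psi (T s u)) 0.
Proof.
move=> dpsi t0; have [_ l _] := dpsi; rewrite /cesaro_mean l.2.
have lt : ((@lebesgue_measure R) `[0%R, t]%classic < +oo)%E by rewrite lebesgue_itv0 ?ltry// ltW.
have i1 := iint_cst R (@lebesgue_measure R) `[0%R, t] 1 (itv_measurable R _) lt.
have w0 s : (`[0%R, t]%classic : set R) s -> 0 <= 1 :> R by [].
have := vint_sg_weighted R X T sgT M TM _ _ (itv_measurable R _) (subset_itv0y R t) (fun=> 1)
  w0 i1 u _ _ dpsi.
have -> : (fun s => Rc 1 *: T s u) = (fun s => T s u) by apply/funext => s; rewrite Rc1 scale1r.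
move=> ->; have := iint_weighted_dual R X _ _ (itv_measurable R _) (subset_itv0y R t) (fun=> 1)
  (fun s => T s u) _ w0 i1 (sg_norm_continuous R X T sgT u)
  (fun s => sg_bounded_orbit R X T M TM u s) _ _ dpsi.
move=> iw; rewrite -(RintegralZl t^-1 (itv_measurable R _) iw) /cesaro_op.
by apply: eq_Rintegral => s _; rewrite mul1r add0r.
Qed.

Lemma cesaro_op_orbit K psi t u r : rdual R X K psi -> 0 < t -> 0 <= r ->
  cesaro_op R t (fun s => psi (T s u)) r = psi (T r (cesaro_mean T t u)).
Proof.
move=> dpsi t0 r0.
rewrite (rdual_cesaro_mean _ _ _ _ (rdual_sg R X T sgT M TM _ _ _ dpsi r0) t0).
apply: eq_Rintegral => s /set_mem; rewrite /= in_itv/= => /andP[s0 _].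
by rewrite add0r sg_add.
Qed.

Lemma nrm_cesaro_mean_le t u : 0 < t -> nrm R X (cesaro_mean T t u) <= M * nrm R X u.
Proof.
move=> t0; apply: nrm_le_dual => psi dpsi.
rewrite (rdual_cesaro_mean _ _ _ _ dpsi t0).
have := bop_bound _ _ _ _ _ _ _ (bop_cesaro R t t0) (sg_BC R X T sgT M TM _ _ u dpsi) (lexx 0).
by rewrite !mul1r; apply: le_trans; exact: ler_norm.
Qed.

Lemma nrm_cesaro_meanD t u v : 0 < t ->
  nrm R X (cesaro_mean T t (u + v)) <= nrm R X (cesaro_mean T t u) + nrm R X (cesaro_mean T t v).
Proof.
move=> t0; apply: nrm_le_dual => psi dpsi.
have [_ [add _] _] := bop_sg_rdual R X T sgT M TM _ _ _ _ _ _ (bop_cesaro R t t0) dpsi (lexx 0).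
have [_ _ b] := dpsi.
rewrite (rdual_cesaro_mean _ _ _ _ dpsi t0) add -!(rdual_cesaro_mean _ _ _ _ dpsi t0).
by rewrite lerD// (le_trans (ler_norm _))// (le_trans (b _))// mul1r.
Qed.

Lemma nrm_cesaro_meanZ t (c : R) u : 0 < t -> 0 <= c ->
  nrm R X (cesaro_mean T t (Rc c *: u)) <= c * nrm R X (cesaro_mean T t u).
Proof.
move=> t0 c0; apply: nrm_le_dual => psi dpsi.
have [_ [_ hom] _] := bop_sg_rdual R X T sgT M TM _ _ _ _ _ _ (bop_cesaro R t t0) dpsi (lexx 0).
have [_ _ b] := dpsi.
rewrite (rdual_cesaro_mean _ _ _ _ dpsi t0) hom -!(rdual_cesaro_mean _ _ _ _ dpsi t0).
by rewrite ler_wpM2l// (le_trans (ler_norm _))// (le_trans (b _))// mul1r.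
Qed.

Definition cesaro_eventually_le u (c : R) :=
  exists2 S, 0 < S & forall t, S <= t -> nrm R X (cesaro_mean T t u) <= c.

(** The upper limit as the infimum of eventual bounds; this form makes sublinearity a comparison of
    bounds. *)
Definition cesaro_limsup u : R := inf [set c | cesaro_eventually_le u c].

Lemma cesaro_eventually_ge0 u c : cesaro_eventually_le u c -> 0 <= c.
Proof. by move=> [S _ hS]; exact: le_trans (nrm_ge0 _ _ _) (hS S (lexx _)). Qed.

Lemma cesaro_limsup_le u c : cesaro_eventually_le u c -> cesaro_limsup u <= c.
Proof.
move=> h; apply: ge_inf => //; exists 0 => d; exact: cesaro_eventually_ge0.
Qed.

Let nonempty u : [set c | cesaro_eventually_le u c] !=set0.
Proof.
by exists (M * nrm R X u); exists 1 => // t t1; apply: nrm_cesaro_mean_le; lra.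
Qed.

Lemma cesaro_limsup_ge u c : (forall d, cesaro_eventually_le u d -> c <= d) -> c <= cesaro_limsup u.
Proof. by move=> h; apply: lb_le_inf. Qed.

Lemma cesaro_limsup_lt u c : cesaro_limsup u < c -> cesaro_eventually_le u c.
Proof.
move=> h; have hi : has_inf [set c | cesaro_eventually_le u c].
  by split => //; exists 0 => d; exact: cesaro_eventually_ge0.
have [d [S S0 hS] dc] := inf_lt hi.1 h.
by exists S => // t St; apply: le_trans (hS t St) (ltW dc).
Qed.

Lemma sublinear_cesaro_limsup : sublinear R X cesaro_limsup.
Proof.
have scale r u : 0 < r -> cesaro_limsup (Rc r *: u) <= r * cesaro_limsup u.
  move=> r0; rewrite -ler_pdivrMl//; apply: cesaro_limsup_ge => d [S S0 hS].
  rewrite ler_pdivrMl//; apply: cesaro_limsup_le; exists S => // t St.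
  have t0 : 0 < t := lt_le_trans S0 St.
  by apply: le_trans (nrm_cesaro_meanZ _ _ _ t0 (ltW r0)) _; rewrite ler_wpM2l ?hS// ltW.
split=> [u v|r u].
  rewrite -lerBlDr; apply: cesaro_limsup_ge => d [S S0 hS].
  rewrite lerBlDr -lerBlDl; apply: cesaro_limsup_ge => d' [S' S'0 hS'].
  rewrite lerBlDl; apply: cesaro_limsup_le.
  exists (Num.max S S'); first by rewrite lt_max S0.
  move=> t; rewrite ge_max => /andP[St S't].
  have t0 : 0 < t := lt_le_trans S0 St.
  by apply: le_trans (nrm_cesaro_meanD _ _ _ t0) _; rewrite lerD ?hS ?hS'.
rewrite le_eqVlt => /predU1P[<-|r0].
  rewrite Rc0 scale0r mul0r; apply/le_anti/andP; split.
    apply: cesaro_limsup_le; exists 1 => // t t1; have t0 : 0 < t by lra.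
    by have := nrm_cesaro_mean_le _ 0 t0; rewrite nrm0 mulr0.
  by apply: cesaro_limsup_ge => d; exact: cesaro_eventually_ge0.
apply/le_anti/andP; split; first exact: scale.
have ri : 0 < r^-1 by rewrite invr_gt0.
rewrite mulrC -ler_pdivlMr// mulrC.
have uE : Rc r^-1 *: (Rc r *: u) = u by rewrite scalerA -RcM mulVf ?gt_eqF// Rc1 scale1r.
by have := scale _ (Rc r *: u) ri; rewrite uE.
Qed.

Lemma cesaro_limsup_le_nrm u : cesaro_limsup u <= M * nrm R X u.
Proof.
by apply: cesaro_limsup_le; exists 1 => // t t1; apply: nrm_cesaro_mean_le; lra.
Qed.

End CesaroMeans.

(** * Decay of the Cesaro means *)

Section CesaroEstimate.
Variables (R : realType) (X : completeNormedModType (CC R)) (b : R).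
Variables (mu nu : {measure set (measurableTypeR R) -> \bar R}).
Variables (T : R -> X -> X) (x y : X).
Hypothesis muL : laplace_transformable mu.
Hypothesis bd : bernstein_data 0 b nu.
Hypothesis fE : forall z, 0 < z -> Laplace mu z = (bernstein 0 b nu z)^-1.
Hypothesis finf : Laplace mu z @[z --> 0^'+] --> +oo.
Hypothesis sgT : bounded_C0_semigroup T.
Hypothesis weak_limit : forall phi : X -> CC R, dual_fun phi ->
  phi (abel_mean R X mu T x al) @[al --> 0^'+] --> phi y.
Variable M : R.
Hypothesis TM : sg_bounded_by R X T M.

Notation g := (bernstein 0 b nu).
Notation ces t u := (nrm R X (cesaro_mean T t u)).

Let J := Rintegral nu `]0%R, +oo[ (Num.min 1).

(** One estimate serves both parts: [c = 0] for the rate O, and small [e] with a large [c] for the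
    rate o, the term [c * Num.min 1 s] covering the small s. The three summands come from the drift,
    from min(1, s/t) <= 2 (1 - e^{-s/t}), and from [c]. *)
Lemma cesaro_estimate t (e c : R) : 0 < t -> 0 <= e -> 0 <= c ->
  (forall s, 0 < s -> s < t -> s * ces s y <= e * s + c * Num.min 1 s) -> ces t y <= e ->
  ces t x <= (1 + M) * (b * nrm R X y / t + 2 * e * g t^-1 + c * J / t).
Proof.
move=> t0 e0 c0 small_s small_t; have [M0 bM] := TM; have [_ b0 _ _] := bd.
have mD := itv0y_open_measurable R.
have ti0 : 0 < t^-1 by rewrite invr_gt0.
apply: nrm_le_dual => psi dpsi; have [_ l bpsi] := dpsi.
have orbBC u := sg_BC R X T sgT M TM _ _ u dpsi.
have bC := bop_cesaro R t t0.
(* A C_t = (1 - T(t)) / t. *)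
have bD : bop R (t^-1 * (1 + 1)) (fun z => t^-1 * (1 - expR (- (t * z))))
    (fun h r => t^-1 * (h r - h (r + t))).
  have := bop_scale R t^-1 _ _ _ (bop_sub R _ _ _ _ _ _ (bop_id R) (bop_shift R t (ltW t0))).
  by rewrite ger0_norm ?ltW.
have symD z : 0 < z -> t^-1 * (1 - expR (- (t * z))) = z * ((1 - expR (- (t * z))) / (t * z)).
  by move=> z0; move: (expR _) => u; field; rewrite !gt_eqF.
(* This constant only secures integrability against nu; it does not enter the final bound. *)
have Clip B h r s : 0 < s -> BC R B h -> 0 <= r ->
    `|cesaro_op R t h r - cesaro_op R t h (r + s)| <= 2 * (1 + t^-1) * Num.min 1 s * B.
  move=> s0 bh r0; have B0 := BC_ge0 _ _ _ bh.
  have bnd p q : 0 < p -> 0 <= q -> `|cesaro_op R p h q| <= B.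
    by move=> p0 q0; have := bop_bound _ _ _ _ _ _ _ (bop_cesaro R p p0) bh q0; rewrite mul1r.
  have diff p q : 0 < p -> 0 < q -> `|cesaro_op R p h r - cesaro_op R p h (r + q)| <= 2 * B.
    move=> p0 q0; rewrite (le_trans (ler_normB _ _))//.
    have := bnd _ _ p0 r0; have := bnd _ _ p0 (addr_ge0 r0 (ltW q0)); lra.
  have tB : 0 <= t^-1 * B by rewrite mulr_ge0// ltW.
  rewrite /Num.min; case: ltP => s1.
    by apply: le_trans (diff _ _ t0 s0) _; lra.
  have st0 : 0 <= s / t by rewrite divr_ge0// ltW.
  rewrite (cesaro_op_difference R t s B)// normrM (ger0_norm st0).
  apply: (@le_trans _ _ (s / t * (2 * B))).
    by rewrite ler_wpM2l// diff.
  have : 0 <= s * B by rewrite mulr_ge0// ltW.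
  by set q := t^-1; move=> ?; lra.
have C0 : 0 <= 2 * (1 + t^-1) by lra.
have bS := bop_bernstein_op R b nu bd _ _ _ _ _ _ _ bC bD symD C0 Clip.
have inv := potential_inversion R X b mu nu T x y muL bd fE finf sgT weak_limit
  _ _ _ _ _ _ _ _ bS bC (fun z _ => erefl) dpsi.
rewrite (rdual_cesaro_mean R X T sgT M TM _ _ _ _ dpsi t0) inv /bernstein_op add0r.
have bT u s : 0 <= s -> `|psi u - psi (T s u)| <= (1 + M) * nrm R X u.
  move=> s0; rewrite (le_trans (ler_normB _ _))// mulrDl lerD ?mul1r//.
    by have := bpsi u; rewrite mul1r.
  by apply: le_trans (bpsi _) _; rewrite mul1r bM.
rewrite (le_trans (ler_norm _))// (le_trans (ler_normD _ _))//.
have -> : (1 + M) * (b * nrm R X y / t + 2 * e * g t^-1 + c * J / t) =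
    b * (t^-1 * ((1 + M) * nrm R X y)) + (1 + M) * (2 * e * g t^-1 + c / t * J) by ring.
apply: lerD.
  rewrite normrM (ger0_norm b0) ler_wpM2l// normrM (gtr0_norm ti0) ler_wpM2l ?(ltW ti0)//.
  by rewrite sg_id// bT// ltW.
have i1 := iint_one_minus_exp R b nu bd t^-1 (ltW ti0).
have i2 := iint_min R b nu bd.
have j1 : iint R nu `]0%R, +oo[ (fun s => 2 * e * (1 - expR (- (s * t^-1)))) by exact: iintZ.
have j2 : iint R nu `]0%R, +oo[ (fun s => c / t * Num.min 1 s) by exact: iintZ.
have i3 : iint R nu `]0%R, +oo[ (fun s => 2 * e * (1 - expR (- (s * t^-1))) + c / t * Num.min 1 s).
  exact: iintD.
apply: (@le_trans _ _ (Rintegral nu `]0%R, +oo[ (fun s => (1 + M) *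
    (2 * e * (1 - expR (- (s * t^-1))) + c / t * Num.min 1 s)))); last first.
  rewrite (RintegralZl (1 + M) mD i3); apply: ler_wpM2l; first by lra.
  rewrite (RintegralD mD j1 j2) (RintegralZl (2 * e) mD i1) (RintegralZl (c / t) mD i2) lerD2r.
  apply: ler_wpM2l; first by rewrite mulr_ge0.
  by rewrite /bernstein add0r lerDr mulr_ge0// ltW.
apply: Rintegral_dominated => //; last exact: iintZ.
  apply: measurable_funB; first exact: measurable_cst.
  apply: BC_measurable mD (subset_itv0y_open R) _.
  have := bop_BC _ _ _ _ bC _ _ (orbBC y); congr (BC _ _ _).
  by apply/funext => s; rewrite add0r.
move=> s; rewrite /= in_itv/= andbT => s0; have s00 := ltW s0.
have min0 : 0 <= Num.min 1 s by rewrite le_min ler01 ltW.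
have st0 : 0 <= s / t by rewrite divr_ge0// ltW.
have hmin := min_le_one_minus_exp R (s / t) st0.
set q := 1 - expR (- (s / t)) in hmin *.
(* Below t the roles of s and t are exchanged, so that C_s y appears with the factor s/t; above t
   the difference is bounded directly by C_t y. *)
have [st|ts] := ltP s t.
  rewrite (cesaro_op_difference R t s _ _ 0 t0 s0 (orbBC y) (lexx _)) add0r.
  rewrite !(cesaro_op_orbit R X T sgT M TM _ _ _ _ _ dpsi)// ?(ltW t0)// sg_id//.
  rewrite normrM (ger0_norm st0).
  apply: (@le_trans _ _ (s / t * ((1 + M) * ces s y))).
    by rewrite ler_wpM2l// bT// ltW.
  have -> : s / t * ((1 + M) * ces s y) = (1 + M) * ((s * ces s y) / t) by ring.
  rewrite ler_wpM2l ?addr_ge0//.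
  apply: (@le_trans _ _ ((e * s + c * Num.min 1 s) / t)).
    by rewrite ler_pM2r// small_s.
  rewrite mulrDl [c * _ / t]mulrAC lerD2r -mulrA [2 * e]mulrC -mulrA ler_wpM2l//.
  by move: hmin; rewrite min_r// ler_pdivrMr// mul1r ltW.
rewrite !(cesaro_op_orbit R X T sgT M TM _ _ _ _ _ dpsi)// ?add0r// sg_id//.
apply: (@le_trans _ _ ((1 + M) * ces t y)); first exact: bT.
rewrite ler_wpM2l ?addr_ge0//; apply: le_trans small_t _.
have ct : 0 <= c / t * Num.min 1 s by rewrite mulr_ge0// divr_ge0// ltW.
rewrite min_l in hmin; last by rewrite ler_pdivlMr// mul1r.
by have := ler_wpM2l e0 hmin; lra.
Qed.

Lemma cesaro_mean_bigO t : 0 < t ->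
  ces t x <= (1 + M) * (nrm R X y + 2 * (M * nrm R X y)) * g t^-1.
Proof.
move=> t0; have [M0 _] := TM; have [_ b0 _ _] := bd.
have y0 := nrm_ge0 _ X y.
have MY0 : 0 <= M * nrm R X y by rewrite mulr_ge0.
have hs s : 0 < s -> s < t -> s * ces s y <= M * nrm R X y * s + 0 * Num.min 1 s.
  move=> s0 _; rewrite mul0r addr0 mulrC ler_wpM2r ?(ltW s0)//.
  exact: (nrm_cesaro_mean_le R X T sgT M TM).
have := cesaro_estimate t _ 0 t0 MY0 (lexx 0) hs (nrm_cesaro_mean_le R X T sgT M TM t y t0).
move=> /le_trans; apply; rewrite -[leRHS]mulrA ler_wpM2l ?addr_ge0//.
rewrite !mul0r addr0 [leRHS]mulrDl lerD2r.
(* The drift is absorbed: b/t is one of the summands of g (1/t). *)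
rewrite mulrAC [leRHS]mulrC ler_wpM2r// /bernstein add0r lerDl.
apply: Rintegral_ge0 => s; rewrite /= in_itv/= andbT => /ltW s0.
by apply: one_minus_exp_ge0 => //; rewrite invr_ge0 ltW.
Qed.

(** Convolution operators commute, so this is the Abel mean of C_t x; its weight has total mass
    [Laplace mu al] and the semigroup contributes [M]. *)
Lemma cesaro_mean_abel_mean al t : 0 < al -> 0 < t ->
  ces t (abel_mean R X mu T x al) <= (Laplace mu al * M) * ces t x.
Proof.
move=> al0 t0; have [M0 bM] := TM; apply: nrm_le_dual => psi dpsi.
set A := abel_mean R X mu T x al.
have orbBC u := sg_BC R X T sgT M TM _ _ u dpsi.
have w0 s : (`[0%R, +oo[%classic : set R) s -> 0 <= expR (- (al * s)).
  by move=> _; exact: expR_ge0.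
have iw := iint_laplace_weight R mu muL al al0.
have bF := bop_weighted_shift R mu _ (itv0y_measurable R) (@subset_refl _ _) _ w0 iw.
have bC := bop_cesaro R t t0.
set PF := (fun h r => Rintegral mu _ _) in bF.
have FA s : 0 <= s -> PF (fun s => psi (T s x)) s = psi (T s A).
  move=> s0; rewrite /PF /A.
  rewrite (rdual_abel_mean R X mu T x muL sgT _ _ _ (rdual_sg R X T sgT M TM _ _ _ dpsi s0) al0).
  apply: eq_Rintegral => u /set_mem; rewrite /= in_itv/= andbT => u0.
  by rewrite sg_add.
have FBC := bop_BC _ _ _ _ bF _ _ (orbBC x).
set BF := _ * _ in FBC.
have ABC := orbBC A.
have FBC' := BC_weaken _ _ _ _ (ler_wpDr (BC_ge0 _ _ _ ABC) (lexx BF)) FBC.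
have ABC' := BC_weaken _ _ _ _ (ler_wpDl (BC_ge0 _ _ _ FBC) (lexx _)) ABC.
rewrite (rdual_cesaro_mean R X T sgT M TM _ _ _ _ dpsi t0).
rewrite -(bop_ext _ _ _ _ _ _ _ bC FBC' ABC' FA 0 (lexx _)).
rewrite (bop_unique R _ _ _ _ _ _ _ _ _ (bop_comp R _ _ _ _ _ _ bC bF)
  (bop_comp R _ _ _ _ _ _ bF bC) (fun z _ => mulrC _ _) (orbBC x) (lexx 0)).
have LE : Laplace mu al = Rintegral mu `[0%R, +oo[ (fun s => expR (- (al * s))).
  by apply: eq_Rintegral => s _; rewrite mulrC.
rewrite LE -mulrA mulrC -(RintegralZl _ (itv0y_measurable R) iw).
apply: le_trans (ler_norm _) _; apply: (Rintegral_dominated R mu _ (itv0y_measurable R)).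
- apply: measurable_funM; first exact: iint_measurable iw.
  have := BC_measurable _ _ _ _ (itv0y_measurable R) (@subset_refl _ _)
    (bop_BC _ _ _ _ bC _ _ (orbBC x)).
  by apply: eq_measurable_fun => s _; rewrite add0r.
- move=> s; rewrite /= in_itv/= andbT => s0.
  rewrite add0r (cesaro_op_orbit R X T sgT M TM _ _ _ _ _ dpsi t0 s0) mulrC normrM.
  rewrite (ger0_norm (expR_ge0 _)) ler_wpM2r ?expR_ge0//.
  have [_ _ bpsi] := dpsi; apply: le_trans (bpsi _) _; rewrite mul1r.
  exact: bM.
- exact: (iintZ R mu _ (itv0y_measurable R)).
Qed.

(* Every functional dominated by cesaro_limsup vanishes at the Abel means of x, hence at
   their weak limit y. *)
Lemma cesaro_limsup_limit : cesaro_limsup R X T y = 0.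
Proof.
have [M0 _] := TM.
have sub := sublinear_cesaro_limsup R X T sgT M TM.
have ge0 u : 0 <= cesaro_limsup R X T u.
  by apply: (cesaro_limsup_ge R X T sgT M TM) => d; exact: cesaro_eventually_ge0.
(* C_t x tends to 0, by the bound with g (1/t) and g (0+) = 0. *)
have limx (e : R) : 0 < e -> cesaro_eventually_le R X T x e.
  move=> e0; set C := (1 + M) * (nrm R X y + 2 * (M * nrm R X y)).
  have C0 : 0 <= C by rewrite !(mulr_ge0, addr_ge0)// nrm_ge0.
  have [d d0 hd] := bernstein_small R 0 b mu nu fE finf (e / (C + 1)) ltac:(by rewrite divr_gt0// ltr_wpDl).
  exists (2 / d); first by rewrite divr_gt0.
  move=> t td; have t0 : 0 < t by apply: lt_le_trans td; rewrite divr_gt0.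
  have tid : t^-1 < d.
    by rewrite -[d]invrK ltf_pV2 ?posrE ?invr_gt0//; apply: lt_le_trans td;
      rewrite ltr_pdivlMr// mulVf ?gt_eqF//; lra.
  have ti0 : 0 < t^-1 by rewrite invr_gt0.
  apply: le_trans (cesaro_mean_bigO t t0) _; rewrite -/C.
  have := hd _ ti0 tid; rewrite ltr_pdivlMr ?ltr_wpDl// => lt.
  have g0 := bernstein_ge0 R b nu bd _ (ltW ti0).
  by apply: ltW; apply: le_lt_trans lt; rewrite mulrC ler_wpM2l//; lra.
have limA al : 0 < al -> cesaro_limsup R X T (abel_mean R X mu T x al) = 0.
  move=> al0; apply/le_anti; rewrite ge0 andbT; apply/ler_addgt0Pr => e e0; rewrite add0r.
  set L := Laplace mu al * M.
  have L0 : 0 <= L by rewrite mulr_ge0// Rintegral_ge0// => s _; exact: expR_ge0.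
  have [S S0 hS] := limx (e / (L + 1)) ltac:(by rewrite divr_gt0// ltr_wpDl).
  apply: (cesaro_limsup_le R X T); exists S => // t St.
  have t0 : 0 < t := lt_le_trans S0 St.
  apply: le_trans (cesaro_mean_abel_mean al t al0 t0) _; rewrite -/L.
  have := hS t St; rewrite ler_pdivlMr ?ltr_wpDl//; apply: le_trans.
  by rewrite mulrC ler_wpM2l ?nrm_ge0//; lra.
have [l ll [lp ly]] := Hahn_Banach_supporting R X _ y sub.
have dl : rdual R X M l.
  by apply: rdual_dominated lp _ => // u; exact: (cesaro_limsup_le_nrm R X T sgT M TM).
have lA al : 0 < al -> l (abel_mean R X mu T x al) = 0.
  move=> al0; apply/le_anti/andP; split; first by rewrite (le_trans (lp _))// limA.
  rewrite -oppr_le0 -(rlinN _ _ _ ll) (le_trans (lp _))//.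
  apply/ler_addgt0Pr => e e0; rewrite add0r.
  have := cesaro_limsup_lt R X T sgT M TM _ _ (_ : cesaro_limsup R X T (abel_mean R X mu T x al) < e).
  rewrite limA// => /(_ e0)[S S0 hS]; apply: (cesaro_limsup_le R X T); exists S => // t St.
  have t0 : 0 < t := lt_le_trans S0 St.
  apply: le_trans (hS t St); apply: nrm_le_dual => psi [_ lpsi bpsi].
  have dpsi : rdual R X 1 psi by split.
  have [_ lC _] := bop_sg_rdual R X T sgT M TM _ _ _ _ _ _ (bop_cesaro R t t0) dpsi (lexx 0).
  rewrite (rdual_cesaro_mean R X T sgT M TM _ _ _ _ dpsi t0) (rlinN _ _ _ lC).
  rewrite -(rdual_cesaro_mean R X T sgT M TM _ _ _ _ dpsi t0).
  by rewrite -(rlinN _ _ _ lpsi) (le_trans (ler_norm _))// (le_trans (bpsi _))// mul1r nrmN.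
rewrite -ly.
pose al n : R := n.+1%:R^-1.
have al0 n : 0 < al n by rewrite invr_gt0.
have alc : al n @[n --> \oo] --> (0 : R).
  apply/cvgrPdist_lt => e e0; near=> n; rewrite sub0r normrN gtr0_norm//.
  by near: n; exact: near_infty_natSinv_lt (PosNum e0).
have := weak_limit_seq R X mu T x y weak_limit _ _ al dl al0 alc.
rewrite (_ : (fun n => l _) = fun=> 0); last by apply/funext => n; rewrite lA.
by move=> h; apply/esym; exact: (cvg_unique _ (cvg_cst _) h).
Unshelve. all: by end_near. Qed.

Lemma cesaro_mean_littleo : t * g t^-1 @[t --> +oo] --> +oo -> forall e : R, 0 < e ->
  exists t0 : R, forall t, t0 <= t -> ces t x <= e * g t^-1.
Proof.
move=> tg e e0; have [M0 _] := TM; have [_ b0 _ _] := bd.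
have M1 : 0 < 1 + M by lra.
(* Makes the middle term of the estimate equal to half of e g (1/t); the other half is left for the
   terms of order 1/t. *)
pose e' := e / (4 * (1 + M)).
have e'0 : 0 < e' by rewrite divr_gt0// mulr_gt0.
have [|S S0 hS] := cesaro_limsup_lt R X T sgT M TM y e'.
  by rewrite cesaro_limsup_limit.
have MY0 : 0 <= M * nrm R X y by rewrite mulr_ge0// nrm_ge0.
(* For s < S one has s <= (1 + S) min(1, s), and [nrm_cesaro_mean_le] bounds C_s y. *)
pose c := M * nrm R X y * (1 + S).
have c0 : 0 <= c by rewrite mulr_ge0//; lra.
pose A := (1 + M) * (b * nrm R X y + c * J).
move/cvgryPge : tg => /(_ (2 * A / e))[t1 [_ ht1]].
exists (Num.max S (t1 + 1)) => t; rewrite ge_max => /andP[St t1t].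
have t0 : 0 < t := lt_le_trans S0 St.
have tt1 : t1 < t by lra.
have := ht1 t tt1; rewrite /= ler_pdivrMr// => hA.
have hs s : 0 < s -> s < t -> s * ces s y <= e' * s + c * Num.min 1 s.
  move=> s0 st; have min0 : 0 <= Num.min 1 s by rewrite le_min ler01 ltW.
  have [Ss|sS] := leP S s.
    apply: ler_wpDr; first exact: mulr_ge0.
    by rewrite mulrC ler_wpM2r ?(ltW s0)// hS.
  apply: ler_wpDl; first exact: mulr_ge0 (ltW e'0) (ltW s0).
  apply: (@le_trans _ _ (s * (M * nrm R X y))).
    by rewrite ler_wpM2l ?(ltW s0)// (nrm_cesaro_mean_le R X T sgT M TM).
  rewrite /c mulrC -mulrA ler_wpM2l//.
  by rewrite /Num.min; case: ltP => s1; nra.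
have := cesaro_estimate t e' c t0 (ltW e'0) c0 hs (hS t St).
move=> /le_trans; apply.
set G := g t^-1 in hA *.
have -> : (1 + M) * (b * nrm R X y / t + 2 * e' * G + c * J / t) = A / t + e / 2 * G.
  by rewrite /A /e'; field; rewrite !gt_eqF.
have : A / t <= e / 2 * G by rewrite ler_pdivrMr//; lra.
lra.
Qed.

End CesaroEstimate.

(** * Measurable functions as series of weighted indicators *)

Section BinaryExpansion.
Variables (R : realType) (f : R -> R).
Hypothesis mf : measurable_fun setT (f : measurableTypeR R -> R).
Hypothesis f01 : forall s, 0 <= f s <= 1.

Let digit (k : nat) : R := 2^-1 ^+ k.+1.

(** Greedy binary expansion: [rest k s] is what remains of [f s] after k digits, and [A k] is where
    the next digit is 1. *)
Let rest := fix rest k s : R :=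
  if k is k'.+1 then rest k' s - (if digit k' <= rest k' s then digit k' else 0) else f s.

Let A k : set (measurableTypeR R) := [set s | digit k <= rest k s].

Let digit_gt0 k : 0 < digit k. Proof. by rewrite exprn_gt0. Qed.

Let pow_digit k : 2^-1 ^+ k = 2 * digit k :> R.
Proof. by rewrite /digit exprS mulrA mulfV ?mul1r. Qed.

Let restP k s : 0 <= rest k s <= 2^-1 ^+ k.
Proof.
elim: k => [|k IH]; first exact: f01.
move: IH; rewrite pow_digit [rest k.+1 s]/= -/(digit k) => /andP[].
move: (rest k s) => r r0 r1.
by have := digit_gt0 k; case: (leP (digit k) r) => h d0; apply/andP; split; lra.
Qed.

Let mrest k : measurable_fun setT (rest k : measurableTypeR R -> R).
Proof.
elim: k => [|k IH] //=; apply: measurable_funB => //.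
apply: measurable_fun_if; [exact: measurableT|exact: measurable_fun_ler|exact: measurable_cst..].
Qed.

Let mA k : measurable (A k).
Proof.
have := measurable_fun_ler (@measurable_cst _ _ (measurableTypeR R) _ setT (digit k)) (mrest k).
by move=> /(_ measurableT [set true]); rewrite setTI; apply.
Qed.

Lemma binary_expansion : exists2 c : nat -> R, (forall k, 0 <= c k) &
  exists2 E : nat -> set (measurableTypeR R), (forall k, measurable (E k)) &
  forall s, (f s)%:E = (\sum_(0 <= k <oo) (c k * \1_(E k) s)%:E)%E.
Proof.
exists digit => [k|]; first exact: ltW.
exists A => // s; apply/esym/cvg_lim => //.
have partial n : (\sum_(0 <= k < n) (digit k * \1_(A k) s)%:E = (f s - rest n s)%:E)%E.
  elim: n => [|n IH]; first by rewrite big_geq// subrr.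
  rewrite big_nat_recr//= IH -EFinD; congr (_%:E).
  rewrite indicE; have [h|h] := boolP (digit n <= rest n s).
    by rewrite mem_set// ?h mulr1; ring.
  by rewrite memNset//= ?(negbTE h) ?mulr0; [ring|exact/negP].
under eq_fun do rewrite partial.
apply: cvg_EFin; first exact: nearW.
rewrite -[X in _ --> X]subr0; apply: cvgB; first exact: cvg_cst.
apply: (@squeeze_cvgr _ _ _ _ (fun=> 0) (fun n => 2^-1 ^+ n)).
- by apply: nearW => n; exact: restP.
- exact: cvg_cst.
- by apply: cvg_expr; rewrite ger0_norm; lra.
Qed.

(** Weights and sets do not depend on the measure, so one expansion can be integrated against a
    whole family. *)
Lemma integral_binary_expansion c (E : nat -> set (measurableTypeR R)) :
  (forall k, 0 <= c k) -> (forall k, measurable (E k)) ->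
  (forall s, (f s)%:E = (\sum_(0 <= k <oo) (c k * \1_(E k) s)%:E)%E) ->
  forall m : {measure set (measurableTypeR R) -> \bar R},
  (\int[m]_s (f s)%:E = \sum_(0 <= k <oo) (c k)%:E * m (E k))%E.
Proof.
move=> c0 mE fE m.
under eq_integral do rewrite fE.
rewrite integral_nneseries//.
- apply: eq_eseriesr => k _.
  rewrite (eq_integral (fun s => (c k)%:E * (\1_(E k) s)%:E)%E); last by move=> s _; rewrite EFinM.
  rewrite ge0_integralZl_EFin//.
  + by rewrite integral_indic// setIT.
  + by apply/measurable_EFinP; exact: measurable_indic.
- move=> k; apply/measurable_EFinP; apply: measurable_funM; first exact: measurable_cst.
  exact: measurable_indic.
- by move=> k s _; rewrite lee_fin mulr_ge0.
Qed.

End BinaryExpansion.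

(** * Mixtures of a family of measures *)

Section Mixture.
Variables (R : realType) (m : {measure set (measurableTypeR R) -> \bar R}).
Variables (D : set (measurableTypeR R)) (w : R -> R).
Variable kappa : R -> {measure set (measurableTypeR R) -> \bar R}.
Hypothesis mD : measurable D.
Hypothesis w0 : forall s, D s -> 0 <= w s.
Hypothesis mw : measurable_fun D (w : measurableTypeR R -> R).
Hypothesis mkappa : forall A, measurable A ->
  measurable_fun D (fun s : measurableTypeR R => kappa s A).

Definition mixture (A : set (measurableTypeR R)) : \bar R :=
  (\int[m]_(s in D) ((w s)%:E * kappa s A))%E.

Let mwkappa A : measurable A -> measurable_fun D (fun s : measurableTypeR R => (w s)%:E * kappa s A)%E.
Proof. by move=> mA; apply: emeasurable_funM; [exact/measurable_EFinP|exact: mkappa]. Qed.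

Let wkappa_ge0 A s : D s -> (0 <= (w s)%:E * kappa s A)%E.
Proof. by move=> Ds; rewrite mule_ge0// lee_fin w0. Qed.

Let mixture0 : mixture set0 = 0%E.
Proof. by rewrite /mixture integral0_eq// => s _; rewrite measure0 mule0. Qed.

Let mixture_ge0 A : (0 <= mixture A)%E.
Proof. by apply: integral_ge0 => s; exact: wkappa_ge0. Qed.

Let mixture_sigma_additive : semi_sigma_additive mixture.
Proof.
move=> U mU tU mUU; rewrite [X in _ --> X](_ : _ =
    (\sum_(0 <= n <oo) mixture (U n))%E); last first.
  rewrite -integral_nneseries//; last first.
  - by move=> n s; exact: wkappa_ge0.
  - by move=> n; exact: mwkappa.
  apply: eq_integral => s /set_mem Ds.
  rewrite nneseriesZl; last by move=> n _; exact: measure_ge0.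
  by congr (_ * _)%E; apply/esym/cvg_lim => //; exact: measure_semi_sigma_additive.
by apply: is_cvg_nneseries => n _ _; exact: mixture_ge0.
Qed.

HB.instance Definition _ :=
  isMeasure.Build _ (measurableTypeR R) R mixture mixture0 mixture_ge0 mixture_sigma_additive.

(** By the common binary expansion, integration against the mixture reduces to its values on sets,
    series and integrals being exchanged by positivity. *)
Lemma mixture_measure : exists m' : {measure set (measurableTypeR R) -> \bar R},
  forall f : R -> R, measurable_fun setT (f : measurableTypeR R -> R) ->
    (forall s, 0 <= f s <= 1) ->
    (\int[m']_u (f u)%:E = \int[m]_(s in D) ((w s)%:E * \int[kappa s]_u (f u)%:E))%E.
Proof.
exists mixture => f mf f01.
have [c c0 [E mE fE]] := binary_expansion R f mf f01.
rewrite (integral_binary_expansion R f c E c0 mE fE).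
transitivity (\sum_(0 <= k <oo) \int[m]_(s in D) ((c k)%:E * ((w s)%:E * kappa s (E k))))%E.
  apply: eq_eseriesr => k _; rewrite ge0_integralZl_EFin//.
  - by move=> s; exact: wkappa_ge0.
  - exact: mwkappa.
rewrite -integral_nneseries//; last first.
- by move=> k s Ds; rewrite mule_ge0// ?lee_fin// wkappa_ge0.
- by move=> k; apply: measurable_funeM; exact: mwkappa.
apply: eq_integral => s Ds.
rewrite (integral_binary_expansion R f c E c0 mE fE) -nneseriesZl.
  by apply: eq_eseriesr => k _; rewrite muleCA.
by move=> k _; rewrite mule_ge0// lee_fin.
Qed.

End Mixture.

(** * Measures behind positive convolution operators *)

Section Representation.
Variable R : realType.
Implicit Types (h f : R -> R) (m : {measure set (measurableTypeR R) -> \bar R}).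
Notation D0 := (`[0%R, +oo[%classic : set R).

Definition represents m (P : (R -> R) -> R -> R) :=
  (m D0 < +oo)%E /\ forall B h, BC R B h -> Rintegral m D0 h = P h 0.

Lemma EFin_Rintegral m (D : set R) f : measurable (D : set (measurableTypeR R)) ->
  iint R m D f -> (\int[m]_(s in D) (f s)%:E)%E = (Rintegral m D f)%:E.
Proof. by move=> mD i; rewrite /Rintegral fineK//; exact: integrable_fin_num. Qed.

Lemma iint_BC m B h : (m D0 < +oo)%E -> BC R B h -> iint R m D0 h.
Proof.
move=> my bh; have mD := itv0y_measurable R.
apply: (iint_dominated R m D0 mD h (fun=> B)).
- exact: BC_measurable mD (@subset_refl _ _) bh.
- by move=> s; rewrite /= in_itv/= andbT => s0; have [_] := bh; exact.
- exact: iint_cst.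
Qed.

(** Functions with values in [0, 1] are enough: the constant 1 gives finiteness of the mass, and a
    bounded function becomes one of them by an affine change. *)
Lemma bop_representation m K lam P : bop R K lam P ->
  (forall h, BC R 1 h -> (forall s, 0 <= s -> 0 <= h s <= 1) ->
    (\int[m]_u ((h \_ D0) u)%:E)%E = (P h 0)%:E) -> represents m P.
Proof.
move=> bP HP; have mD := itv0y_measurable R.
have BC1 : BC R 1 (fun=> 1) by have := BC_cst R 1; rewrite normr1.
have HD h : BC R 1 h -> (forall s, 0 <= s -> 0 <= h s <= 1) ->
    (\int[m]_(u in D0) (h u)%:E)%E = (P h 0)%:E.
  move=> bh h01; rewrite -HP// integral_mkcond; apply: eq_integral => u _.
  by rewrite !patchE; case: ifP.
have one01 (s : R) : 0 <= s -> 0 <= (1 : R) <= 1 by rewrite ler01 lexx.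
have my : (m D0 < +oo)%E.
  by have := HD _ BC1 one01; rewrite integral_cst// mul1e => ->; exact: ltry.
split=> // B h bh.
have B0 := BC_ge0 _ _ _ bh.
(* The added 1 keeps the divisor [2 * C] positive when [B] is 0. *)
pose C := B + 1; have C0 : 0 < C by rewrite /C; lra.
pose f s := (h s + C) / (2 * C).
have f01 s : 0 <= s -> 0 <= f s <= 1.
  move=> s0; have [_ /(_ s s0)] := bh; rewrite ler_norml => /andP[h1 h2].
  rewrite /f ler_pdivrMr ?mulr_gt0// ler_pdivlMr ?mulr_gt0// mul0r mul1r /C.
  by apply/andP; split; lra.
have bf : BC R 1 f.
  split; last by move=> s s0; have /andP[? ?] := f01 s s0; rewrite ger0_norm.
  have [ch _] := bh; move=> s; apply: cvgMl; apply: cvgD; [exact: ch|exact: cvg_cst].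
have hE : h = fun s => 2 * C * f s - C * 1.
  by apply/funext => s; rewrite /f; field; rewrite gt_eqF.
have i1 := iint_BC _ _ _ my BC1; have if_ := iint_BC _ _ _ my bf.
have e1 : Rintegral m D0 (fun=> 1) = P (fun=> 1) 0.
  by rewrite /Rintegral (HD _ BC1 one01).
have ef : Rintegral m D0 f = P f 0 by rewrite /Rintegral HD.
have b1 := BCZ R (2 * C) _ _ bf; have b2 := BCZ R C _ _ BC1.
rewrite hE (bopB _ _ _ _ _ _ _ _ _ bP b1 b2)//.
rewrite (bopZ0 _ _ _ _ _ _ _ _ bP bf)// (bopZ0 _ _ _ _ _ _ _ _ bP BC1)// -e1 -ef.
have j1 : iint R m D0 (fun s => 2 * C * f s) by exact: iintZ.
have j2 : iint R m D0 (fun s => C * 1) by exact: iintZ.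
by rewrite (RintegralB mD j1 j2) (RintegralZl _ mD if_) (RintegralZl _ mD i1).
Qed.

Lemma represents_add m1 m2 P1 P2 : represents m1 P1 -> represents m2 P2 ->
  represents (measure_add m1 m2) (fun h r => P1 h r + P2 h r).
Proof.
move=> [y1 r1] [y2 r2]; have mD := itv0y_measurable R; split.
  by rewrite /measure_add /= /msum !big_ord_recr big_ord0 /= add0e; exact: lte_add_pinfty.
move=> B h bh; have i1 := iint_BC _ _ _ y1 bh; have i2 := iint_BC _ _ _ y2 bh.
rewrite -(r1 _ _ bh) -(r2 _ _ bh) /Rintegral integral_measure_add// fineD//; exact: integrable_fin_num.
Qed.

(** The measure with density [w] is the mixture of the unit masses at s with weight [w s]. *)
Lemma density_measure m (D : set R) (w : R -> R) : measurable (D : set (measurableTypeR R)) ->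
  (forall s, D s -> 0 <= w s) -> measurable_fun D (w : measurableTypeR R -> R) ->
  exists m' : {measure set (measurableTypeR R) -> \bar R},
  forall f, measurable_fun setT (f : measurableTypeR R -> R) ->
    (forall s, 0 <= f s <= 1) ->
    (\int[m']_u (f u)%:E = \int[m]_(s in D) (w s * f s)%:E)%E.
Proof.
move=> mD w0 mw.
have [|m' hm'] := mixture_measure R m D w (fun s => dirac (s : measurableTypeR R)) mD w0 mw.
  move=> A mA; rewrite /dirac /=; apply/measurable_EFinP.
  exact: measurable_indic.
exists m' => f mf f01; rewrite hm'//; apply: eq_integral => s _.
rewrite integral_dirac//; last exact/measurable_EFinP.
by rewrite diracT mul1e.
Qed.

Lemma BC_patch_measurable B h : BC R B h ->
  measurable_fun setT (h \_ D0 : measurableTypeR R -> R).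
Proof.
move=> bh; apply/(measurable_restrictT _ _).1; first exact: itv0y_measurable.
exact: BC_measurable (itv0y_measurable R) (@subset_refl _ _) bh.
Qed.

Lemma patch01 h : (forall s, 0 <= s -> 0 <= h s <= 1) -> forall s, 0 <= (h \_ D0) s <= 1.
Proof.
move=> h01 s; rewrite patchE; case: ifP => [/set_mem|_]; last by rewrite lexx ler01.
by rewrite /= in_itv/= andbT; exact: h01.
Qed.

Lemma weighted_shift_represented m (D : set R) (w : R -> R) :
  measurable (D : set (measurableTypeR R)) -> D `<=` D0 ->
  (forall s, D s -> 0 <= w s) -> iint R m D w ->
  exists m', represents m' (fun h r => Rintegral m D (fun s => w s * h (r + s))).
Proof.
move=> mD DD0 w0 iw; have mw := iint_measurable _ _ _ _ iw.
have [m' hm'] := density_measure m D w mD w0 mw; exists m'.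
apply: (bop_representation _ _ _ _ (bop_weighted_shift R m D mD DD0 w w0 iw)) => h bh h01.
rewrite hm'; [|exact: BC_patch_measurable bh|exact: patch01].
rewrite -EFin_Rintegral//.
  apply: eq_integral => s /set_mem Ds.
  by rewrite patchE mem_set ?add0r//; exact: DD0.
apply: (iint_dominated R m D mD _ w) => //.
  apply: measurable_funM => //; have := BC_measurable _ _ _ _ mD DD0 bh.
  by apply: eq_measurable_fun => s _; rewrite add0r.
move=> s Ds; rewrite add0r normrM (ger0_norm (w0 _ Ds)) ler_piMr ?w0//.
by have [_] := bh; apply; have := DD0 _ Ds; rewrite /= in_itv/= andbT.
Qed.

End Representation.

(** * The measures with transforms 1 / (1 + z) and g (z) / (1 + z) *)

Section RegularizingMeasures.
Variable R : realType.
Implicit Types (h f : R -> R) (m : {measure set (measurableTypeR R) -> \bar R}).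
Notation D0 := (`[0%R, +oo[%classic : set R).
Notation Dp := (`]0%R, +oo[%classic : set R).
Notation leb := (@lebesgue_measure R).

Section MixtureOfExponentials.
Variables (nu : {measure set (measurableTypeR R) -> \bar R}) (Dom : R -> set R) (w : R -> R).
Hypothesis mDom : forall s, measurable (Dom s : set (measurableTypeR R)).
Hypothesis iDom : forall s, iint R leb (Dom s) (fun u => expR (- u)).
Hypothesis Dom0 : forall s, Dp s -> Dom s `<=` D0.
Hypothesis mono : (forall s t, s <= t -> Dom s `<=` Dom t) \/
  (forall s t, s <= t -> Dom t `<=` Dom s).
Hypothesis w0 : forall s, Dp s -> 0 <= w s.
Hypothesis mw : measurable_fun Dp (w : measurableTypeR R -> R).
Variables (k : R -> R) (lam : R -> R -> R).
Hypothesis bops : forall s, Dp s -> bop R (k s) (lam s)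
  (fun h r => w s * Rintegral leb (Dom s) (fun u => expR (- u) * h (r + u))).
Hypothesis ik : iint R nu Dp k.
Hypothesis mP : forall B h r, BC R B h -> 0 <= r -> measurable_fun (Dp : set (measurableTypeR R))
  (fun s => w s * Rintegral leb (Dom s) (fun u => expR (- u) * h (r + u))).

Let iDomM f s : measurable_fun setT (f : measurableTypeR R -> R) ->
  (forall s, 0 <= f s <= 1) -> iint R leb (Dom s) (fun u => expR (- u) * f u).
Proof.
move=> mf f01; apply: (iint_dominated R leb _ (mDom s) _ (fun u => expR (- u))) => //.
  apply: measurable_funM; first exact: iint_measurable (iDom s).
  exact: measurable_funS mf.
move=> u _; have /andP[f0 f1] := f01 u.
by rewrite normrM !ger0_norm ?expR_ge0// ler_piMr ?expR_ge0.
Qed.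

(** The measures [kappa s] are chosen separately for each s. As [Dom s] is monotone in s, so is the
    mass of any fixed set, and monotone functions are measurable. *)
Lemma mixture_represented : exists m', represents R m' (fun h r =>
  Rintegral nu Dp (fun s => w s * Rintegral leb (Dom s) (fun u => expR (- u) * h (r + u)))).
Proof.
have mD := itv0y_open_measurable R.
have /choice[kappa hk] : forall s, exists m' : {measure set (measurableTypeR R) -> \bar R},
    forall f, measurable_fun setT (f : measurableTypeR R -> R) -> (forall u, 0 <= f u <= 1) ->
    (\int[m']_u (f u)%:E = (Rintegral leb (Dom s) (fun u => (expR (- u) * f u)%R))%:E)%E.
  move=> s.
  have e0 u : Dom s u -> 0 <= expR (- u) by move=> _; exact: expR_ge0.
  have [m' hm'] := density_measure R leb (Dom s) (fun u => expR (- u)) (mDom s) e0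
    (iint_measurable _ _ _ _ (iDom s)).
  by exists m' => f mf f01; rewrite hm'// -EFin_Rintegral//; exact: iDomM.
have mkappa A : measurable A -> measurable_fun Dp (fun s : measurableTypeR R => kappa s A).
  move=> mA.
  have m1 : measurable_fun setT (\1_A : measurableTypeR R -> R) by exact: measurable_indic.
  have i01 u : 0 <= (\1_A u : R) <= 1 by rewrite indicE; case: (_ \in _); rewrite ?lexx ?ler01.
  have kE s : kappa s A = (Rintegral leb (Dom s) (fun u => expR (- u) * \1_A u))%:E.
    by rewrite -hk// integral_indic// setIT.
  rewrite (_ : (fun s => _) = fun s => (Rintegral leb (Dom s) (fun u => expR (- u) * \1_A u))%:E).
    apply/measurable_EFinP.
    have le s t : Dom s `<=` Dom t -> Rintegral leb (Dom s) (fun u => expR (- u) * \1_A u) <=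
        Rintegral leb (Dom t) (fun u => expR (- u) * \1_A u).
      move=> st; rewrite -lee_fin -!EFin_Rintegral//; [|exact: iDomM..].
      apply: (ge0_subset_integral leb (mDom s) (mDom t) _ _ st).
        by apply/measurable_EFinP; exact: iint_measurable (iDomM _ t m1 i01).
      by move=> u _; rewrite lee_fin mulr_ge0 ?expR_ge0//; case/andP: (i01 u).
    case: mono => mo.
      by apply: nondecreasing_measurable => // s t st; apply: le; exact: mo.
    by apply: nonincreasing_measurable => // s t st; apply: le; exact: mo.
  by apply/funext => s; rewrite kE.
have [m' hm'] := mixture_measure R nu Dp w kappa mD w0 mw mkappa; exists m'.
apply: (bop_representation R m' _ _ _ (bop_integral R nu Dp mD k lam _ bops ik mP)) => h bh h01.
have mh := BC_patch_measurable R _ _ bh; have hp := patch01 R _ h01.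
rewrite hm'// -EFin_Rintegral//; last exact: (bop_integrable R nu Dp mD k lam _ bops ik mP _ _ 0 bh).
apply: eq_integral => s /set_mem Ds; rewrite hk// -EFinM; congr ((_ * _)%:E).
apply: eq_Rintegral => u /set_mem us; rewrite patchE mem_set ?add0r//.
exact: Dom0 us.
Qed.

End MixtureOfExponentials.

Lemma exp_tail_shift s B h r : 0 < s -> BC R B h -> 0 <= r ->
  Rintegral leb `[s, +oo[ (fun u => expR (- u) * h (r + u)) = expR (- s) * exp_op R h (r + s).
Proof.
move=> s0 bh r0.
apply: (bop_unique R _ _ _ _ _ _ B h r (bop_exp_tail R s s0)
  (bop_scale R (expR (- s)) _ _ _ (bop_comp R _ _ _ _ _ _ (bop_shift R s (ltW s0)) (bop_exp_op R))))
  => // z z0.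
by rewrite mulrDr mulr1 opprD expRD mulrA.
Qed.

Variables (b : R) (nu : {measure set (measurableTypeR R) -> \bar R}).
Hypothesis bd : bernstein_data 0 b nu.

(** g(A) (1 + A)^-1; the drift part uses z / (1 + z) = 1 - 1 / (1 + z). *)
Definition reg_op h r := bernstein_op R b nu (exp_op R) (fun h r => h r - exp_op R h r) h r.

Let mDp := itv0y_open_measurable R.
Let sDp := subset_itv0y_open R.

Lemma exp_op_represented : exists m, represents R m (exp_op R).
Proof.
apply: (weighted_shift_represented R leb D0 (fun s => expR (- s)) (itv0y_measurable R)) => //.
exact: iint_expN.
Qed.

Let mshift B h r : BC R B h -> 0 <= r ->
  measurable_fun (Dp : set (measurableTypeR R)) (fun s => exp_op R h (r + s)).
Proof.
move=> bh r0.
have := BC_measurable _ _ _ _ mDp sDp (BC_shift R r _ _ r0 (bop_BC _ _ _ _ (bop_exp_op R) _ _ bh)).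
by apply: eq_measurable_fun => s _; rewrite addrC.
Qed.

Let mexp (c : R) : measurable_fun (Dp : set (measurableTypeR R)) (fun s : R => expR (c * s)).
Proof.
apply: (measurable_funS measurableT) => //; apply: continuous_measurable_fun => s.
by apply: continuous_comp; [apply: cvgMr; exact: cvg_id|exact: continuous_expR].
Qed.

Let mexpN : measurable_fun (Dp : set (measurableTypeR R)) (fun s : R => expR (- s)).
Proof. by have := mexp (-1); apply: eq_measurable_fun => s _; rewrite mulN1r. Qed.

Let mexp1 : measurable_fun (Dp : set (measurableTypeR R)) (fun s : R => expR s - 1).
Proof.
apply: measurable_funB; last exact: measurable_cst.
by have := mexp 1; apply: eq_measurable_fun => s _; rewrite mul1r.
Qed.

Let Dp_gt0 s : Dp s -> 0 < s. Proof. by rewrite /= in_itv/= andbT. Qed.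

Let i1exp : iint R nu Dp (fun s => 1 - expR (- s)).
Proof.
have := iint_one_minus_exp R b nu bd 1 ler01; congr (iint _ _ _ _).
by apply/funext => s; rewrite mulr1.
Qed.

Let bop1 s : Dp s -> bop R (`|1| * Rintegral leb `[0%R, s] (fun u => expR (- u)))
  (fun z => 1 * ((1 - expR (- (s * (1 + z)))) / (1 + z)))
  (fun h r => 1 * Rintegral leb `[0%R, s] (fun u => expR (- u) * h (r + u))).
Proof. by move=> /Dp_gt0 s0; exact: bop_scale (bop_exp_truncated R s s0). Qed.

Let bop2 s : Dp s -> bop R (`|expR s - 1| * Rintegral leb `[s, +oo[ (fun u => expR (- u)))
  (fun z => (expR s - 1) * (expR (- (s * (1 + z))) / (1 + z)))
  (fun h r => (expR s - 1) * Rintegral leb `[s, +oo[ (fun u => expR (- u) * h (r + u))).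
Proof. by move=> /Dp_gt0 s0; exact: bop_scale (bop_exp_tail R s s0). Qed.

Let ik1 : iint R nu Dp (fun s => `|1| * Rintegral leb `[0%R, s] (fun u => expR (- u))).
Proof.
apply: eq_integrable i1exp => // s /set_mem /Dp_gt0 s0; congr (_%:E).
have := Rintegral_exp_itv R 1 ltr01 s s0; rewrite divr1 mulr1 normr1 mul1r => <-.
by apply: eq_Rintegral => u _; rewrite mulr1.
Qed.

Let ik2 : iint R nu Dp (fun s => `|expR s - 1| * Rintegral leb `[s, +oo[ (fun u => expR (- u))).
Proof.
apply: eq_integrable i1exp => // s /set_mem /Dp_gt0 s0; congr (_%:E).
have e1 : 1 <= expR s by rewrite -expR0 ler_expR ltW.
rewrite Rintegral_expN_itvy ger0_norm ?subr_ge0// mulrBl -expRD subrr expR0 mul1r.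
by [].
Qed.

Let mP1 B h r : BC R B h -> 0 <= r -> measurable_fun (Dp : set (measurableTypeR R))
  (fun s => 1 * Rintegral leb `[0%R, s] (fun u => expR (- u) * h (r + u))).
Proof.
move=> bh r0.
apply: (eq_measurable_fun (fun s : measurableTypeR R => exp_op R h r - expR (- s) * exp_op R h (r + s))).
  by move=> s /set_mem /Dp_gt0 s0; rewrite (exp_op_step R s B h r)//; ring.
apply: measurable_funB; first exact: measurable_cst.
by apply: measurable_funM => //; exact: mshift bh r0.
Qed.

Let mP2 B h r : BC R B h -> 0 <= r -> measurable_fun (Dp : set (measurableTypeR R))
  (fun s => (expR s - 1) * Rintegral leb `[s, +oo[ (fun u => expR (- u) * h (r + u))).
Proof.
move=> bh r0.
apply: (eq_measurable_fun (fun s : measurableTypeR R => (expR s - 1) * (expR (- s) * exp_op R h (r + s)))).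
  by move=> s /set_mem /Dp_gt0 s0; rewrite (exp_tail_shift s B h r).
by do 2 apply: measurable_funM => //; exact: mshift bh r0.
Qed.

(* The positive and negative parts of (1 + z)^-1 \int (1 - e^{-sz}) nu(ds) come from
   (1 - e^{-sz}) / (1 + z) = \int_0^s e^{-u} e^{-uz} du - (e^s - 1) \int_s^oo e^{-u} e^{-uz} du. *)
Lemma reg_op_represented : exists m1 m2 P1 P2, [/\ represents R m1 P1, represents R m2 P2 &
  forall B h, BC R B h -> reg_op h 0 = P1 h 0 - P2 h 0].
Proof.
have [_ b0 _ _] := bd.
have [n1 hn1] : exists m', represents R m' (fun h r => Rintegral nu Dp (fun s =>
    1 * Rintegral leb `[0%R, s] (fun u => expR (- u) * h (r + u)))).
  have mI s : measurable (`[0%R, s]%classic : set (measurableTypeR R)) by exact: itv_measurable.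
  have iI s : iint R leb `[0%R, s] (fun u => expR (- u)).
    by apply: integrableS (iint_expN R 0); [exact: itv_measurable..|exact: subset_itv0y].
  have sI s : Dp s -> `[0%R, s]%classic `<=` D0 by move=> _; exact: subset_itv0y.
  have monoI : (forall s t, s <= t -> (`[0%R, s]%classic : set R) `<=` `[0%R, t]%classic) \/
      (forall s t, s <= t -> (`[0%R, t]%classic : set R) `<=` `[0%R, s]%classic).
    by left=> s t st u; rewrite /= !in_itv/= => /andP[-> us]; exact: le_trans us st.
  exact: (mixture_represented nu (fun s => `[0%R, s]%classic) (fun=> 1) mI iI sI monoI
    (fun _ _ => ler01) (measurable_cst _) _ _ bop1 ik1 mP1).
have [n2 hn2] : exists m', represents R m' (fun h r => Rintegral nu Dp (fun s =>
    (expR s - 1) * Rintegral leb `[s, +oo[ (fun u => expR (- u) * h (r + u)))).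
  have mI (s : R) : measurable (`[s, +oo[%classic : set (measurableTypeR R)) by exact: itv_measurable.
  have sI s : Dp s -> `[s, +oo[%classic `<=` D0.
    by move=> /Dp_gt0 s0 u; rewrite /= !in_itv/= !andbT; apply: le_trans; exact: ltW.
  have monoI : (forall s t : R, s <= t -> `[s, +oo[%classic `<=` `[t, +oo[%classic) \/
      (forall s t : R, s <= t -> `[t, +oo[%classic `<=` `[s, +oo[%classic).
    by right=> s t st u; rewrite /= !in_itv/= !andbT; exact: le_trans.
  have wI s : Dp s -> 0 <= expR s - 1 by move=> /Dp_gt0 s0; rewrite subr_ge0 -expR0 ler_expR ltW.
  exact: (mixture_represented nu (fun s => `[s, +oo[%classic) (fun s => expR s - 1) mI (iint_expN R)
    sI monoI wI mexp1 _ _ bop2 ik2 mP2).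
(* The drift b z / (1 + z) = b - b / (1 + z) contributes a mass b at 0 to the positive part and the
   density b e^{-s} to the negative one. *)
have [d1 hd1] : exists m', represents R m' (fun h r =>
    Rintegral (dirac (0 : measurableTypeR R)) D0 (fun s => b * h (r + s))).
  apply: (weighted_shift_represented R _ D0 (fun=> b) (itv0y_measurable R)) => //.
  by apply: iint_cst; [exact: itv0y_measurable|rewrite /= diracE ltry].
have [d2 hd2] : exists m', represents R m' (fun h r =>
    Rintegral leb D0 (fun s => b * expR (- s) * h (r + s))).
  apply: (weighted_shift_represented R _ D0 (fun s => b * expR (- s)) (itv0y_measurable R)) => //.
    by move=> s _; rewrite mulr_ge0// expR_ge0.
  by apply: iintZ; [exact: itv0y_measurable|exact: iint_expN].
do 4 eexists; split; [exact: represents_add hd1 hn1|exact: represents_add hd2 hn2|].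
move=> B h bh; rewrite /reg_op /bernstein_op.
have mD := itv0y_measurable R.
have -> : Rintegral (dirac (0 : measurableTypeR R)) D0 (fun s => b * h (0 + s)) = b * h 0.
  rewrite /Rintegral integral_dirac//.
    by rewrite diracE mem_set ?mul1e ?addr0//= in_itv/= lexx.
  apply/measurable_EFinP; apply: measurable_funM; first exact: measurable_cst.
  have := BC_measurable _ _ _ _ mD (@subset_refl _ _) bh.
  by apply: eq_measurable_fun => s _; rewrite add0r.
have -> : Rintegral leb D0 (fun s => b * expR (- s) * h (0 + s)) = b * exp_op R h 0.
  rewrite /exp_op -RintegralZl//.
    by apply: eq_Rintegral => s _; rewrite mulrA.
  apply: (iint_dominated R leb D0 mD _ (fun s => B * expR (- s))).
  - apply: measurable_funM; first exact: iint_measurable (iint_expN R 0).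
    have := BC_measurable _ _ _ _ mD (@subset_refl _ _) bh.
    by apply: eq_measurable_fun => s _; rewrite add0r.
  - move=> s; rewrite /= in_itv/= andbT => s0; rewrite add0r normrM mulrC.
    by rewrite (ger0_norm (expR_ge0 _)) ler_wpM2r ?expR_ge0//; have [_] := bh; exact.
  - by apply: iintZ => //; exact: iint_expN.
set I := Rintegral nu Dp (fun s => exp_op R h 0 - exp_op R h (0 + s)).
set I1 := Rintegral nu Dp (fun s => 1 * _); set I2 := Rintegral nu Dp (fun s => (expR s - 1) * _).
suff -> : I = I1 - I2 by ring.
have j1 := bop_integrable R nu Dp mDp _ _ _ bop1 ik1 mP1 _ _ 0 bh (lexx _).
have j2 := bop_integrable R nu Dp mDp _ _ _ bop2 ik2 mP2 _ _ 0 bh (lexx _).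
rewrite /I1 /I2 -(RintegralB mDp j1 j2); apply: eq_Rintegral => s /set_mem /Dp_gt0 s0.
rewrite add0r (exp_op_difference R s B h s0 bh) mul1r; congr (_ - _ * _).
  by apply: eq_Rintegral => u _; rewrite add0r.
by apply: eq_Rintegral => u _; rewrite add0r.
Qed.

End RegularizingMeasures.

(** * Complex measures and their transforms on the real axis *)

Section ComplexMeasures.
Variable R : realType.
Implicit Types (m : {measure set (measurableTypeR R) -> \bar R}) (h : R -> R) (z : R).
Notation D0 := (`[0%R, +oo[%classic : set R).

Lemma cRe_cmint (rho : cmeasure R) (k : R -> CC R) : cRe (cmint rho k) =
  (Rintegral (cm1 rho) D0 (fun s => cRe (k s)) - Rintegral (cm2 rho) D0 (fun s => cRe (k s))) -
  (Rintegral (cm3 rho) D0 (fun s => cIm (k s)) - Rintegral (cm4 rho) D0 (fun s => cIm (k s))).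
Proof. by rewrite /cmint cReD cReM cReD cReN cImD cImN /=; ring. Qed.

Lemma cIm_cmint (rho : cmeasure R) (k : R -> CC R) : cIm (cmint rho k) =
  (Rintegral (cm1 rho) D0 (fun s => cIm (k s)) - Rintegral (cm2 rho) D0 (fun s => cIm (k s))) +
  (Rintegral (cm3 rho) D0 (fun s => cRe (k s)) - Rintegral (cm4 rho) D0 (fun s => cRe (k s))).
Proof. by rewrite /cmint cImD cImM cImD cImN cReD cReN /=; ring. Qed.

Lemma cexpn_real s z : cexpn s (Rc z) = Rc (expR (- (s * z))).
Proof. by apply: CC_eqP; rewrite /= ?mulr0 ?cos0 ?sin0 ?mulr1 ?mulr0 ?oppr0. Qed.

(** The factor 1 makes this literally a weighted shift. *)
Definition mop m h r := Rintegral m D0 (fun s => 1 * h (r + s)).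

Lemma mop0 m h : mop m h 0 = Rintegral m D0 h.
Proof. by apply: eq_Rintegral => s _; rewrite mul1r add0r. Qed.

Lemma mop_bop m : (m D0 < +oo)%E -> exists K,
  bop R K (fun z => Rintegral m D0 (fun s => expR (- (s * z)))) (mop m).
Proof.
move=> my; have mD := itv0y_measurable R; eexists.
have := bop_weighted_shift R m D0 mD (@subset_refl _ _) (fun=> 1) (fun _ _ => ler01)
  (iint_cst R m D0 1 mD my).
by apply: bop_symbol => z z0; apply: eq_Rintegral => s _; rewrite mul1r.
Qed.

(** The exponential is real at real z, so the real part of the transform sees only [cm1] and [cm2];
    the imaginary part sees [cm3] and [cm4]. *)
Lemma cRe_cLaplace (rho : cmeasure R) z : cRe (cLaplace rho (Rc z)) =
  Rintegral (cm1 rho) D0 (fun s => expR (- (s * z))) -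
  Rintegral (cm2 rho) D0 (fun s => expR (- (s * z))).
Proof.
have E0 m : Rintegral m D0 (fun s => cIm (cexpn s (Rc z))) = 0.
  rewrite -[RHS](mul0r (fine (m D0))) -Rintegral_cst; last exact: itv0y_measurable.
  by apply: eq_Rintegral => s _; rewrite cexpn_real.
rewrite /cLaplace cRe_cmint !E0 subrr subr0.
by congr (_ - _); apply: eq_Rintegral => s _; rewrite cexpn_real.
Qed.

Lemma cIm_cLaplace (rho : cmeasure R) z : cIm (cLaplace rho (Rc z)) =
  Rintegral (cm3 rho) D0 (fun s => expR (- (s * z))) -
  Rintegral (cm4 rho) D0 (fun s => expR (- (s * z))).
Proof.
have E0 m : Rintegral m D0 (fun s => cIm (cexpn s (Rc z))) = 0.
  rewrite -[RHS](mul0r (fine (m D0))) -Rintegral_cst; last exact: itv0y_measurable.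
  by apply: eq_Rintegral => s _; rewrite cexpn_real.
rewrite /cLaplace cIm_cmint !E0 subrr add0r.
by congr (_ - _); apply: eq_Rintegral => s _; rewrite cexpn_real.
Qed.

Lemma bernsteinC_real a b nu z : bernsteinC a b nu (Rc z) = Rc (bernstein a b nu z).
Proof.
have E0 : Rintegral nu `]0%R, +oo[ (fun s => cIm (Rc 1 - cexpn s (Rc z))) = 0.
  rewrite -[RHS](mul0r (fine (nu `]0%R, +oo[%classic))) -Rintegral_cst; last exact: itv0y_open_measurable.
  by apply: eq_Rintegral => s _; rewrite cexpn_real cImD cImN /= oppr0 addr0.
apply: CC_eqP; last by rewrite /bernsteinC !cImD cImM /= E0; ring.
have E1 : cRe (cint nu `]0%R, +oo[ (fun s => Rc 1 - cexpn s (Rc z))) =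
    Rintegral nu `]0%R, +oo[ (fun s => 1 - expR (- (s * z))).
  by apply: eq_Rintegral => s _; rewrite cexpn_real cReD cReN.
by rewrite /bernsteinC !cReD cReM E1 /= mulr0 subr0.
Qed.

End ComplexMeasures.

(** * The Hille-Phillips calculus and injectivity of the resolvent *)

Section HillePhillips.
Variables (R : realType) (X : completeNormedModType (CC R)) (T : R -> X -> X).
Hypothesis sgT : bounded_C0_semigroup T.
Notation D0 := (`[0%R, +oo[%classic : set R).

Lemma cmintegrable_orbit (rho : cmeasure R) u phi : bounded_cmeasure rho -> dual_fun phi ->
  cmintegrable rho (phi \o (fun s => T s u)).
Proof.
move=> [y1 y2 y3 y4] dphi; have [M TM] := sg_bounded R X T sgT.
have [K1 d1] := rdual_cRe R X phi dphi; have [K2 d2] := rdual_cIm R X phi dphi.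
have b1 := sg_BC R X T sgT M TM _ _ u d1; have b2 := sg_BC R X T sgT M TM _ _ u d2.
by split; split; [exact: iint_BC b1|exact: iint_BC b2|exact: iint_BC b1|exact: iint_BC b2
  |exact: iint_BC b1|exact: iint_BC b2|exact: iint_BC b1|exact: iint_BC b2].
Qed.

(** The two defining predicates are the same set of vectors, so [xget] returns the same element,
    whether or not the set is inhabited. *)
Lemma HP_eq (rho sigma : cmeasure R) u v : bounded_cmeasure rho -> bounded_cmeasure sigma ->
  (forall phi, dual_fun phi ->
    cmint rho (phi \o (fun s => T s u)) = cmint sigma (phi \o (fun s => T s v))) ->
  HP T rho u = HP T sigma v.
Proof.
move=> br bs E; rewrite /HP; congr (xget _ _); apply/seteqP; split=> w /= h phi dphi.
  split; first exact: cmintegrable_orbit.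
  by rewrite -E//; case: (h phi dphi).
split; first exact: cmintegrable_orbit.
by rewrite E//; case: (h phi dphi).
Qed.

(** At real z the symbol identity separates into one for [cm1 - cm2] and one for [cm3 - cm4], each
    settled by [potential_inversion]. Applying both to the real and imaginary parts of [phi]
    recovers the complex integrals. *)
Lemma HP_regularized b (mu nu : {measure set (measurableTypeR R) -> \bar R}) (x y : X)
    (rho sigma : cmeasure R) :
  laplace_transformable mu -> bernstein_data 0 b nu ->
  (forall z, 0 < z -> Laplace mu z = (bernstein 0 b nu z)^-1) ->
  Laplace mu z @[z --> 0^'+] --> +oo ->
  (forall phi : X -> CC R, dual_fun phi ->
    phi (abel_mean R X mu T x al) @[al --> 0^'+] --> phi y) ->
  bounded_cmeasure rho -> bounded_cmeasure sigma ->
  (forall z : CC R, 0 < cRe z -> cLaplace sigma z = cLaplace rho z * bernsteinC 0 b nu z) ->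
  HP T rho x = HP T sigma y.
Proof.
move=> muL bd fE finf wl br bs sym; apply: HP_eq => // phi dphi.
have [r1 r2 r3 r4] := br; have [s1 s2 s3 s4] := bs.
have [Kr1 br1] := mop_bop R _ r1; have [Kr2 br2] := mop_bop R _ r2.
have [Kr3 br3] := mop_bop R _ r3; have [Kr4 br4] := mop_bop R _ r4.
have [Ks1 bs1] := mop_bop R _ s1; have [Ks2 bs2] := mop_bop R _ s2.
have [Ks3 bs3] := mop_bop R _ s3; have [Ks4 bs4] := mop_bop R _ s4.
have symRe z : 0 < z -> cRe (cLaplace sigma (Rc z)) = cRe (cLaplace rho (Rc z)) * bernstein 0 b nu z.
  by move=> z0; rewrite sym// bernsteinC_real cReM /= mulr0 subr0.
have symIm z : 0 < z -> cIm (cLaplace sigma (Rc z)) = cIm (cLaplace rho (Rc z)) * bernstein 0 b nu z.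
  by move=> z0; rewrite sym// bernsteinC_real cImM /= mulr0 add0r.
have inv psi K : rdual R X K psi ->
    Rintegral (cm1 rho) D0 (fun s => psi (T s x)) - Rintegral (cm2 rho) D0 (fun s => psi (T s x)) =
    Rintegral (cm1 sigma) D0 (fun s => psi (T s y)) - Rintegral (cm2 sigma) D0 (fun s => psi (T s y)) /\
    Rintegral (cm3 rho) D0 (fun s => psi (T s x)) - Rintegral (cm4 rho) D0 (fun s => psi (T s x)) =
    Rintegral (cm3 sigma) D0 (fun s => psi (T s y)) - Rintegral (cm4 sigma) D0 (fun s => psi (T s y)).
  move=> dpsi; rewrite -!mop0; split.
    apply: (potential_inversion R X b mu nu T x y muL bd fE finf sgT wl _ _ _ _ _ _ _ _
      (bop_sub R _ _ _ _ _ _ bs1 bs2) (bop_sub R _ _ _ _ _ _ br1 br2) _ dpsi) => z z0.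
    by have := symRe z z0; rewrite !cRe_cLaplace.
  apply: (potential_inversion R X b mu nu T x y muL bd fE finf sgT wl _ _ _ _ _ _ _ _
    (bop_sub R _ _ _ _ _ _ bs3 bs4) (bop_sub R _ _ _ _ _ _ br3 br4) _ dpsi) => z z0.
  by have := symIm z z0; rewrite !cIm_cLaplace.
have [K1 d1] := rdual_cRe R X phi dphi; have [K2 d2] := rdual_cIm R X phi dphi.
have [e1 e2] := inv _ _ d1; have [e3 e4] := inv _ _ d2.
apply: CC_eqP; rewrite ?cRe_cmint ?cIm_cmint /=.
  by rewrite e1 e4.
by rewrite e2 e3.
Qed.

Definition real_cmeasure m1 m2 : cmeasure R := CMeasure m1 m2 mzero mzero.

Lemma cmint_real m1 m2 k : cmint (real_cmeasure m1 m2) k =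
  cplx (Rintegral m1 D0 (fun s => cRe (k s)) - Rintegral m2 D0 (fun s => cRe (k s)))
    (Rintegral m1 D0 (fun s => cIm (k s)) - Rintegral m2 D0 (fun s => cIm (k s))).
Proof.
have z0 (f : R -> R) : Rintegral (mzero : {measure set (measurableTypeR R) -> \bar R}) D0 f = 0.
  by rewrite /Rintegral integral_measure_zero.
by apply: CC_eqP; rewrite ?cRe_cmint ?cIm_cmint /= !z0 subrr ?subr0 ?addr0.
Qed.

Lemma bounded_real_cmeasure (m1 m2 : {measure set (measurableTypeR R) -> \bar R}) : (m1 D0 < +oo)%E -> (m2 D0 < +oo)%E ->
  bounded_cmeasure (real_cmeasure m1 m2).
Proof. by move=> y1 y2; split=> //=; rewrite /mzero ltry. Qed.

Variable mE : {measure set (measurableTypeR R) -> \bar R}.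
Hypothesis repE : represents R mE (exp_op R).

Notation resolvent_measure := (real_cmeasure mE mzero).

Lemma rdual_HP_resolvent u K psi : rdual R X K psi ->
  psi (HP T resolvent_measure u) = exp_op R (fun s => psi (T s u)) 0.
Proof.
move=> dpsi; have [yE rE] := repE; have [M TM] := sg_bounded R X T sgT.
have mD := itv0y_measurable R.
have z0 (f : R -> R) : Rintegral (mzero : {measure set (measurableTypeR R) -> \bar R}) D0 f = 0.
  by rewrite /Rintegral integral_measure_zero.
have bz : bounded_cmeasure resolvent_measure.
  by apply: bounded_real_cmeasure => //; rewrite /mzero /= ltry.
have [z hz] := Pettis_integral R X mE D0 mD (@subset_refl _ _) (fun=> 1) (fun s => T s u) _
  (fun _ _ => ler01) (iint_cst R mE D0 1 mD yE) (sg_norm_continuous R X T sgT u)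
  (sg_bounded_orbit R X T M TM u).
have vz : is_cmvint resolvent_measure (fun s => T s u) z.
  move=> phi dphi; split; first exact: cmintegrable_orbit.
  have [K1 d1] := rdual_cRe R X phi dphi; have [K2 d2] := rdual_cIm R X phi dphi.
  rewrite cmint_real; apply: CC_eqP; rewrite /= z0 subr0.
    by rewrite (hz _ _ d1); apply: eq_Rintegral => s _; rewrite mul1r.
  by rewrite (hz _ _ d2); apply: eq_Rintegral => s _; rewrite mul1r.
have := xgetPex 0 (ex_intro (fun z => is_cmvint resolvent_measure (fun s => T s u) z) z vz).
move=> /(_ _ (complexify_dual R X K psi dpsi))[_ /(congr1 (fun c => cRe c))].
rewrite cmint_real /= z0 subr0 -/(HP T resolvent_measure u) => ->.
exact: rE (sg_BC R X T sgT M TM _ _ u dpsi).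
Qed.

(** Vanishing at 0 and at s leaves \int_0^s e^{-u} h(u) du = 0 by the step formula. With s so small
    that h is within e of h 0, this gives |h 0| <= e. *)
Lemma exp_op_injective B h : BC R B h -> (forall r, 0 <= r -> exp_op R h r = 0) -> h 0 = 0.
Proof.
move=> bh Eh; have [ch _] := bh.
apply/eqP; rewrite -normr_le0; apply/ler_addgt0Pr => e e0; rewrite add0r.
have := ch 0; rewrite /continuous_at normr0 => /cvgrPdist_le/(_ e e0)/nbhs_ballP[d /= d0 hd].
pose s := d / 2; have s0 : 0 < s by rewrite /s; lra.
have := exp_op_step R s B h 0 s0 bh (lexx 0); rewrite !Eh ?add0r ?(ltW s0)// mulr0 addr0.
have mI : measurable (`[0%R, s]%classic : set (measurableTypeR R)) by exact: itv_measurable.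
have i1 : iint R lebesgue_measure `[0%R, s] (fun u => expR (- u)).
  by apply: integrableS (iint_expN R 0); [exact: itv_measurable..|exact: subset_itv0y].
have I1 : 0 < Rintegral lebesgue_measure `[0%R, s] (fun u => expR (- u)).
  have := Rintegral_exp_itv R 1 ltr01 s s0; rewrite divr1 mulr1.
  under eq_Rintegral do rewrite mulr1.
  by move=> ->; rewrite subr_gt0 -expR0 ltr_expR; lra.
have ih : iint R lebesgue_measure `[0%R, s] (fun u => expR (- u) * h (0 + u)).
  apply: (iint_dominated R _ _ mI _ (fun u => B * expR (- u))); last exact: iintZ.
    apply: measurable_funM; first exact: iint_measurable i1.
    have := BC_measurable _ _ _ _ mI (subset_itv0y R s) bh.
    by apply: eq_measurable_fun => u _; rewrite add0r.
  move=> u; rewrite /= in_itv/= => /andP[u0 _].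
  rewrite add0r normrM mulrC (ger0_norm (expR_ge0 _)) ler_wpM2r ?expR_ge0//.
  by have [_] := bh; exact.
move=> /esym I0.
have D1 : `|Rintegral lebesgue_measure `[0%R, s] (fun u => h 0 * expR (- u) - expR (- u) * h (0 + u))|
    <= Rintegral lebesgue_measure `[0%R, s] (fun u => e * expR (- u)).
  apply: (Rintegral_dominated R _ _ mI).
  - apply: measurable_funB; last exact: iint_measurable ih.
    by apply: measurable_funM; [exact: measurable_cst|exact: iint_measurable i1].
  - move=> u; rewrite /= in_itv/= => /andP[u0 us].
    rewrite add0r mulrC -mulrBr normrM (ger0_norm (expR_ge0 _)) mulrC ler_wpM2r ?expR_ge0//.
    have := hd u; rewrite /ball /= sub0r normrN ger0_norm//; apply.
    by apply: le_lt_trans us _; rewrite /s; lra.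
  - exact: iintZ.
have ih0 : iint R lebesgue_measure `[0%R, s] (fun u => h 0 * expR (- u)) by exact: iintZ.
rewrite (RintegralB mI ih0 ih) I0 subr0 in D1.
rewrite (RintegralZl _ mI i1) (RintegralZl _ mI i1) normrM (ger0_norm (ltW I1)) in D1.
by rewrite ler_pM2r in D1.
Qed.

(** Testing with [psi] composed with [T r] for all r >= 0 makes [exp_op] agree on the two orbits
    along the whole half-line, as [exp_op_injective] requires. *)
Lemma HP_resolvent_injective : injective (HP T resolvent_measure).
Proof.
have [M TM] := sg_bounded R X T sgT.
move=> u v uv; apply: rdual_separated => psi dpsi.
have bu := sg_BC R X T sgT M TM _ _ u dpsi; have bv := sg_BC R X T sgT M TM _ _ v dpsi.
have Euv r : 0 <= r -> exp_op R (fun s => psi (T s u)) r = exp_op R (fun s => psi (T s v)) r.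
  move=> r0; have dr := rdual_sg R X T sgT M TM _ _ _ dpsi r0.
  have shift w : exp_op R (fun s => psi (T s w)) r = exp_op R (fun s => psi (T r (T s w))) 0.
    apply: eq_Rintegral => s /set_mem; rewrite /= in_itv/= andbT => s0.
    by rewrite add0r sg_add.
  by rewrite !shift -!(rdual_HP_resolvent _ _ _ dr) uv.
have := exp_op_injective _ _ (BCB _ _ _ _ _ bu bv).
rewrite !(sg_id R X T sgT) => h; apply/eqP; rewrite -subr_eq0; apply/eqP/h => r r0.
by rewrite (bopB _ _ _ _ _ _ _ _ _ (bop_exp_op R) bu bv)// Euv// subrr.
Qed.

End HillePhillips.

(** * The symbol identity of the regularizer at a complex point x + i y *)

Section ComplexResolvent.
Variables (R : realType) (x y : R).
Hypothesis x0 : 0 < x.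
Notation leb := (@lebesgue_measure R).
Notation D0 := (`[0%R, +oo[%classic : set R).
Notation Dp := (`]0%R, +oo[%classic : set R).

(** [C] and [S] are the real and imaginary parts of e^{-s (x + i y)}; the sign of the sine is part
    of [S]. *)
Let C (s : R) : R := expR (- (s * x)) * cos (s * y).
Let S (s : R) : R := - (expR (- (s * x)) * sin (s * y)).

Let cC : continuous C.
Proof.
move=> s; apply: cvgM.
  apply: continuous_comp; last exact: continuous_expR.
  by apply: cvgN; apply: cvgMl; exact: cvg_id.
by apply: continuous_comp; [apply: cvgMl; exact: cvg_id|exact: continuous_cos].
Qed.

Let cS : continuous S.
Proof.
move=> s; apply: cvgN; apply: cvgM.
  apply: continuous_comp; last exact: continuous_expR.
  by apply: cvgN; apply: cvgMl; exact: cvg_id.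
by apply: continuous_comp; [apply: cvgMl; exact: cvg_id|exact: continuous_sin].
Qed.

Let exp_le1 s : 0 <= s -> expR (- (s * x)) <= 1.
Proof. by move=> s0; rewrite -expR0 ler_expR oppr_le0 mulr_ge0// ltW. Qed.

Lemma BC_exp_cos : BC R 1 C.
Proof.
split=> [s|s s0]; first by apply: (continuous_comp (@norm_continuous _ R s)); exact: cC.
rewrite /C normrM (ger0_norm (expR_ge0 _)) mulr_ile1 ?expR_ge0 ?exp_le1//.
by rewrite ler_norml cos_geN1 cos_le1.
Qed.

Lemma BC_exp_sin : BC R 1 S.
Proof.
split=> [s|s s0]; first by apply: (continuous_comp (@norm_continuous _ R s)); exact: cS.
rewrite /S normrN normrM (ger0_norm (expR_ge0 _)) mulr_ile1 ?expR_ge0 ?exp_le1//.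
by rewrite ler_norml sin_geN1 sin_le1.
Qed.

Let CD r s : C (r + s) = C r * C s - S r * S s.
Proof. by rewrite /C /S !mulrDl opprD expRD cosD; ring. Qed.

Let SD r s : S (r + s) = C r * S s + S r * C s.
Proof. by rewrite /C /S !mulrDl opprD expRD sinD; ring. Qed.

(** p + i q is the value of the transform 1 / (1 + z) at z = x + i y, as the two symbol lemmas below
    establish. *)
Let p := exp_op R C 0.
Let q := exp_op R S 0.

Let iexp h : BC R 1 h -> iint R leb D0 (fun s => expR (- s) * h s).
Proof.
move=> bh; have mD := itv0y_measurable R.
apply: (iint_dominated R leb D0 mD _ (fun s => expR (- s))); last exact: iint_expN.
  apply: measurable_funM; first exact: iint_measurable (iint_expN R 0).
  exact: BC_measurable mD (@subset_refl _ _) bh.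
move=> s; rewrite /= in_itv/= andbT => s0.
by rewrite normrM (ger0_norm (expR_ge0 _)) ler_piMr ?expR_ge0//; have [_] := bh; exact.
Qed.

Let exp_op0 h : exp_op R h 0 = Rintegral leb D0 (fun s => expR (- s) * h s).
Proof. by apply: eq_Rintegral => s _; rewrite add0r. Qed.

(** The complex exponential is an eigenfunction of [exp_op] with eigenvalue p + i q; this is the
    real part of that relation. *)
Let EC r : exp_op R C r = C r * p - S r * q.
Proof.
have mD := itv0y_measurable R; have i1 := iexp _ BC_exp_cos; have i2 := iexp _ BC_exp_sin.
rewrite /p /q !exp_op0 -(RintegralZl _ mD i1) -(RintegralZl _ mD i2).
rewrite -(RintegralB mD (iintZ R leb _ mD (C r) _ i1) (iintZ R leb _ mD (S r) _ i2)).
by apply: eq_Rintegral => s _; rewrite CD; ring.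
Qed.

Let ES r : exp_op R S r = C r * q + S r * p.
Proof.
have mD := itv0y_measurable R; have i1 := iexp _ BC_exp_cos; have i2 := iexp _ BC_exp_sin.
rewrite /p /q !exp_op0 -(RintegralZl _ mD i1) -(RintegralZl _ mD i2).
rewrite -(RintegralD mD (iintZ R leb _ mD (C r) _ i2) (iintZ R leb _ mD (S r) _ i1)).
by apply: eq_Rintegral => s _; rewrite SD; ring.
Qed.

Let w := 1 + x.
Let G1 (s : R) : R := expR (- s) * C s.
Let G2 (s : R) : R := expR (- s) * S s.

Let dlin (c s : R) : is_derive s (1 : R) (fun s : R => s * c) c.
Proof.
have -> : (fun s : R => s * c) = (fun s => c * s) by apply/funext => r; rewrite mulrC.
by have := is_deriveZ c (is_derive_id s (1 : R)); rewrite /GRing.scale /= mulr1.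
Qed.

Let G1E : G1 = (fun s => expR (s * - w)) * (fun s => cos (s * y)).
Proof.
apply/funext => s; rewrite /G1 /C /w fctE mulrA -expRD; congr (expR _ * _); ring.
Qed.

Let G2E : G2 = (fun s => expR (s * - w)) * (fun s => - sin (s * y)).
Proof.
apply/funext => s; rewrite /G2 /S /w fctE mulrN mulrA -expRD -mulrN; congr (expR _ * _); ring.
Qed.

Let dG1 s : is_derive s (1 : R) G1 (- w * G1 s + y * G2 s).
Proof.
have d1 := @is_derive1_comp R expR (fun s => s * - w) s _ _ (is_derive_expR _) (dlin (- w) s).
have d2 := @is_derive1_comp R cos (fun s => s * y) s _ _ (is_derive_cos _) (dlin y s).
rewrite G1E; apply: (is_derive_eq (is_deriveM d1 d2)).
by rewrite G2E !fctE /GRing.scale /=; ring.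
Qed.

Let dG2 s : is_derive s (1 : R) G2 (- w * G2 s - y * G1 s).
Proof.
have d1 := @is_derive1_comp R expR (fun s => s * - w) s _ _ (is_derive_expR _) (dlin (- w) s).
have d2 := @is_derive1_comp R sin (fun s => s * y) s _ _ (is_derive_sin _) (dlin y s).
have d3 := is_deriveN d2.
rewrite G2E; apply: (is_derive_eq (is_deriveM d1 d3)).
by rewrite G1E !fctE /GRing.scale /=; ring.
Qed.

Let cexpN : continuous (fun s : R => expR (- s)).
Proof. by move=> s; apply: continuous_comp; [apply: cvgN; exact: cvg_id|exact: continuous_expR]. Qed.

Let cG1 : continuous G1. Proof. by move=> s; apply: cvgM; [exact: cexpN|exact: cC]. Qed.
Let cG2 : continuous G2. Proof. by move=> s; apply: cvgM; [exact: cexpN|exact: cS]. Qed.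

Let FTC (F f : R -> R) t : 0 < t -> continuous F -> continuous f ->
  (forall s : R, is_derive s (1 : R) F (f s)) -> Rintegral leb `[0%R, t] f = F t - F 0.
Proof.
move=> t0 cF cf dF; rewrite /Rintegral (@continuous_FTC2 _ f F)//.
- exact: continuous_subspaceT.
- split.
  + by move=> s _; have [] := dF s.
  + by apply: cvg_at_right_filter; exact: cF.
  + by apply: cvg_at_left_filter; exact: cF.
- by move=> s _; rewrite derive1E (@derive_val _ _ _ _ _ _ _ (dF s)).
Qed.

Let exp_small (c v : R) : (forall t, 0 < t -> `|v| <= c * expR (- t)) -> v = 0.
Proof.
move=> h; apply/eqP; rewrite -normr_le0 leNgt; apply/negP => v0.
have c0 : 0 < c.
  by have := lt_le_trans v0 (h 1 ltr01); rewrite pmulr_lgt0// expR_gt0.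
have t0 : 0 < c / `|v| by rewrite divr_gt0.
have := h _ t0; have := expR_ge1Dx (c / `|v|).
rewrite expRN ler_pdivlMr ?expR_gt0// => h1 h2.
have := le_trans (ler_wpM2l (ltW v0) h1) h2.
by rewrite mulrDr mulr1 mulrCA divff ?gt_eqF// mulr1 gerDr leNgt v0.
Qed.

Let itv_iint (F : R -> R) t : continuous F -> iint R leb `[0%R, t] F.
Proof.
move=> cF; apply: continuous_compact_integrable; first exact: segment_compact.
exact: continuous_subspaceT.
Qed.

Let step h t : BC R 1 h -> 0 < t -> exp_op R h 0 =
  Rintegral leb `[0%R, t] (fun u => expR (- u) * h u) + expR (- t) * exp_op R h t.
Proof.
move=> bh t0; rewrite (exp_op_step R t 1 h 0 t0 bh (lexx _)) add0r; congr (_ + _).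
by apply: eq_Rintegral => u _; rewrite add0r.
Qed.

Let bnd h t : BC R 1 h -> 0 < t -> `|exp_op R h t| <= 1.
Proof.
move=> bh t0; have := bop_bound _ _ _ _ _ _ _ (bop_exp_op R) bh (ltW t0).
by rewrite mulr1.
Qed.

Let C0 : C 0 = 1. Proof. by rewrite /C !mul0r oppr0 expR0 cos0 mulr1. Qed.
Let S0 : S 0 = 0. Proof. by rewrite /S !mul0r sin0 mulr0 oppr0. Qed.

(** Real part of (1 + z) (p + i q) = 1. On [0, t] it follows from the fundamental theorem of
    calculus for e^{-s (1 + z)}; the step formula leaves an error of a constant times e^{-t}, for
    every t. *)
Lemma resolvent_symbol_re : w * p - y * q = 1.
Proof.
apply/eqP; rewrite -subr_eq0; apply/eqP; apply: (exp_small (1 + w + `|y|)) => t t0.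
have mI := itv_measurable R `[0%R, t]%R.
have I : Rintegral leb `[0%R, t] (fun s => - w * G1 s + y * G2 s) = G1 t - G1 0.
  apply: (FTC G1) => // s; apply: cvgD; apply: cvgMr; [exact: cG1|exact: cG2].
have i1 := itv_iint G1 t cG1; have i2 := itv_iint G2 t cG2.
have E1 := step _ t BC_exp_cos t0; have E2 := step _ t BC_exp_sin t0.
rewrite -/p in E1; rewrite -/q in E2.
have j1 : iint R leb `[0%R, t] (fun s => - w * G1 s) by exact: iintZ.
have j2 : iint R leb `[0%R, t] (fun s => y * G2 s) by exact: iintZ.
rewrite (RintegralD mI j1 j2) (RintegralZl _ mI i1) (RintegralZl _ mI i2) in I.
have -> : w * p - y * q - 1 =
    expR (- t) * (w * exp_op R C t - y * exp_op R S t - C t).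
  rewrite E1 E2; move: I; rewrite /G1 C0 oppr0 expR0 mulr1 => I.
  move: I; rewrite /G2; set J1 := Rintegral _ _ _; set J2 := Rintegral _ _ _ => I.
  have -> : expR (- t) * (w * exp_op R C t - y * exp_op R S t - C t) =
    w * (expR (- t) * exp_op R C t) - y * (expR (- t) * exp_op R S t) - expR (- t) * C t by ring.
  lra.
rewrite normrM (ger0_norm (expR_ge0 _)) mulrC ler_wpM2r ?expR_ge0//.
have [_ /(_ t (ltW t0)) bc] := BC_exp_cos.
have b1 := bnd _ t BC_exp_cos t0; have b2 := bnd _ t BC_exp_sin t0.
have w0 : 0 <= w := addr_ge0 ler01 (ltW x0).
rewrite (le_trans (ler_normB _ _))//.
have hw : `|w * exp_op R C t| <= w by rewrite normrM (ger0_norm w0) ler_piMr.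
have hy : `|y * exp_op R S t| <= `|y| by rewrite normrM ler_piMr.
have h := le_trans (ler_normB (w * exp_op R C t) (y * exp_op R S t)) (lerD hw hy).
by rewrite (le_trans (lerD h bc))// addrC addrA.
Qed.

Lemma resolvent_symbol_im : w * q + y * p = 0.
Proof.
apply: (exp_small (1 + w + `|y|)) => t t0.
have mI := itv_measurable R `[0%R, t]%R.
have I : Rintegral leb `[0%R, t] (fun s => - w * G2 s - y * G1 s) = G2 t - G2 0.
  apply: (FTC G2) => // s; apply: cvgB; apply: cvgMr; [exact: cG2|exact: cG1].
have i1 := itv_iint G1 t cG1; have i2 := itv_iint G2 t cG2.
have E1 := step _ t BC_exp_cos t0; have E2 := step _ t BC_exp_sin t0.
rewrite -/p in E1; rewrite -/q in E2.
have j2 : iint R leb `[0%R, t] (fun s => - w * G2 s) by exact: iintZ.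
have j1 : iint R leb `[0%R, t] (fun s => y * G1 s) by exact: iintZ.
rewrite (RintegralB mI j2 j1) (RintegralZl _ mI i2) (RintegralZl _ mI i1) in I.
have -> : w * q + y * p =
    expR (- t) * (w * exp_op R S t + y * exp_op R C t - S t).
  rewrite E1 E2; move: I; rewrite /G2 S0 mulr0 subr0 => I.
  move: I; rewrite /G1; set J1 := Rintegral _ _ _; set J2 := Rintegral _ _ _ => I.
  have -> : expR (- t) * (w * exp_op R S t + y * exp_op R C t - S t) =
    w * (expR (- t) * exp_op R S t) + y * (expR (- t) * exp_op R C t) - expR (- t) * S t by ring.
  lra.
rewrite normrM (ger0_norm (expR_ge0 _)) mulrC ler_wpM2r ?expR_ge0//.
have [_ /(_ t (ltW t0)) bc] := BC_exp_sin.
have b1 := bnd _ t BC_exp_cos t0; have b2 := bnd _ t BC_exp_sin t0.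
have w0 : 0 <= w := addr_ge0 ler01 (ltW x0).
rewrite (le_trans (ler_normB _ _))//.
have hw : `|w * exp_op R S t| <= w by rewrite normrM (ger0_norm w0) ler_piMr.
have hy : `|y * exp_op R C t| <= `|y| by rewrite normrM ler_piMr.
have h := le_trans (ler_normD (w * exp_op R S t) (y * exp_op R C t)) (lerD hw hy).
by rewrite (le_trans (lerD h bc))// addrC addrA.
Qed.

Variables (b : R) (nu : {measure set (measurableTypeR R) -> \bar R}).
Hypothesis bd : bernstein_data 0 b nu.

Let lip h : BC R 1 h -> iint R nu Dp (fun s => exp_op R h 0 - exp_op R h (0 + s)).
Proof.
move=> bh; have mD := itv0y_open_measurable R.
apply: (iint_dominated R nu Dp mD _ (fun s => 2 * Num.min 1 s)).
- apply: measurable_funB; first exact: measurable_cst.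
  have := BC_measurable _ _ _ _ mD (subset_itv0y_open R) (bop_BC _ _ _ _ (bop_exp_op R) _ _ bh).
  by apply: eq_measurable_fun => s _; rewrite add0r.
- move=> s; rewrite /= in_itv/= andbT => s0.
  by have := exp_op_lipschitz R s 1 h 0 s0 bh (lexx _); rewrite mulr1.
- by apply: iintZ => //; exact: iint_min bd.
Qed.

Let iU : iint R nu Dp (fun s => p * (1 - C s) + q * S s).
Proof.
have := lip _ BC_exp_cos; congr (iint _ _ _ _); apply/funext => s.
by rewrite add0r -/p EC; ring.
Qed.

Let iV : iint R nu Dp (fun s => q * (1 - C s) - p * S s).
Proof.
have := lip _ BC_exp_sin; congr (iint _ _ _ _); apply/funext => s.
by rewrite add0r -/q ES; ring.
Qed.

Let pq_gt0 : 0 < p ^+ 2 + q ^+ 2.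
Proof.
have pq0 : 0 <= p ^+ 2 + q ^+ 2 by rewrite addr_ge0 ?sqr_ge0.
rewrite lt_neqAle pq0 andbT eq_sym paddr_eq0 ?sqr_ge0// !sqrf_eq0; apply/negP => /andP[/eqP pz /eqP qz].
by have := resolvent_symbol_re; rewrite pz qz !mulr0 subrr => /esym/eqP; rewrite oner_eq0.
Qed.

(* 1 - C and S are linear combinations of the increments of exp_op C and exp_op S, whose
   integrability is already known. *)
Let i1C : iint R nu Dp (fun s => 1 - C s).
Proof.
have mD := itv0y_open_measurable R.
have := iintZ R nu _ mD (p ^+ 2 + q ^+ 2)^-1 _
  (iintD R nu _ mD _ _ (iintZ R nu _ mD p _ iU) (iintZ R nu _ mD q _ iV)).
congr (iint _ _ _ _); apply/funext => s.
by move: (C s) (S s) => c d; field; rewrite gt_eqF.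
Qed.

Let iS : iint R nu Dp S.
Proof.
have mD := itv0y_open_measurable R.
have := iintZ R nu _ mD (p ^+ 2 + q ^+ 2)^-1 _
  (iintB R nu _ mD _ _ (iintZ R nu _ mD q _ iU) (iintZ R nu _ mD p _ iV)).
congr (iint _ _ _ _); apply/funext => s.
by move: (C s) (S s) => c d; field; rewrite gt_eqF.
Qed.

(** Evaluates [reg_op] on e^{-sz} for complex z, where the real symbol calculus does not reach: by
    the eigenfunction relations the increments factor as (p + i q) (1 - e^{-sz}). *)
Lemma reg_op_cexpn : cplx (reg_op R b nu C 0) (reg_op R b nu S 0) =
  cplx p q * bernsteinC 0 b nu (cplx x y).
Proof.
have mD := itv0y_open_measurable R.
set c1 := Rintegral nu Dp (fun s => 1 - C s); set c2 := Rintegral nu Dp S.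
have gre : cRe (bernsteinC 0 b nu (cplx x y)) = b * x + c1.
  have E : cRe (cint nu Dp (fun s => Rc 1 - cexpn s (cplx x y))) = c1.
    by apply: eq_Rintegral => s _; rewrite cReD cReN.
  by rewrite /bernsteinC !cReD cReM E /=; ring.
have gim : cIm (bernsteinC 0 b nu (cplx x y)) = b * y - c2.
  have E : cIm (cint nu Dp (fun s => Rc 1 - cexpn s (cplx x y))) = - c2.
    rewrite -mulN1r -(RintegralZl _ mD iS).
    by apply: eq_Rintegral => s _; rewrite cImD cImN /= add0r mulN1r.
  by rewrite /bernsteinC !cImD cImM E /=; ring.
have pq1 := resolvent_symbol_re; have pq2 := resolvent_symbol_im.
rewrite /w in pq1 pq2.
have j1 (k : R) : iint R nu Dp (fun s => k * (1 - C s)) by exact: iintZ.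
have j2 (k : R) : iint R nu Dp (fun s => k * S s) by exact: iintZ.
have EU : Rintegral nu Dp (fun s => exp_op R C 0 - exp_op R C (0 + s)) = p * c1 + q * c2.
  rewrite -(RintegralZl _ mD i1C) -(RintegralZl _ mD iS) -(RintegralD mD (j1 p) (j2 q)).
  by apply: eq_Rintegral => s _; rewrite add0r -/p EC; ring.
have EV : Rintegral nu Dp (fun s => exp_op R S 0 - exp_op R S (0 + s)) = q * c1 - p * c2.
  rewrite -(RintegralZl _ mD i1C) -(RintegralZl _ mD iS) -(RintegralB mD (j1 q) (j2 p)).
  by apply: eq_Rintegral => s _; rewrite add0r -/q ES; ring.
apply: CC_eqP; rewrite ?cReM ?cImM gre gim /= /reg_op /bernstein_op ?EU ?EV ?C0 ?S0 -/p -/q.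
  (* Real part of 1 - (p + i q) = z (p + i q), which turns the drift into b z (p + i q). *)
  have -> : 1 - p = p * x - q * y by rewrite -[X in X - _]pq1; ring.
  by ring.
have -> : 0 - q = q * x + p * y by rewrite -[X in X - _]pq2; ring.
by ring.
Qed.

End ComplexResolvent.

(** * Existence of a regularizer and the final assembly *)

Lemma regularizer_exists (R : realType) (X : completeNormedModType (CC R)) (T : R -> X -> X)
    (sgT : bounded_C0_semigroup T) (b : R) (nu : {measure set (measurableTypeR R) -> \bar R}) :
  bernstein_data 0 b nu -> exists rho sigma, regularizer T (bernsteinC 0 b nu) rho sigma.
Proof.
move=> bd.
have [mE repE] := exp_op_represented R.
have [m1 [m2 [P1 [P2 [rep1 rep2 regE]]]]] := reg_op_represented R b nu bd.
have z0 (f : R -> R) : Rintegral (mzero : {measure set (measurableTypeR R) -> \bar R}) `[0%R, +oo[ f = 0.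
  by rewrite /Rintegral integral_measure_zero.
exists (real_cmeasure R mE mzero), (real_cmeasure R m1 m2); split.
- by apply: bounded_real_cmeasure; [case: repE|rewrite /mzero /= ltry].
- by apply: bounded_real_cmeasure; [case: rep1|case: rep2].
- move=> [x y] /= x0.
  have bC := BC_exp_cos R x y x0; have bS := BC_exp_sin R x y x0.
  have := reg_op_cexpn R x y x0 b nu bd.
  rewrite (regE _ _ bC) (regE _ _ bS) -(proj2 repE _ _ bC) -(proj2 repE _ _ bS).
  rewrite -(proj2 rep1 _ _ bC) -(proj2 rep1 _ _ bS) -(proj2 rep2 _ _ bC) -(proj2 rep2 _ _ bS).
  by rewrite /cLaplace !cmint_real !z0 !subr0.
- exact: HP_resolvent_injective.
Qed.

Theorem theorem4p4 (R : realType) (X : completeNormedModType (CC R))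
  (mu : {measure set (measurableTypeR R) -> \bar R}) (a b : R) (nu : {measure set (measurableTypeR R) -> \bar R})
  (T : R -> X -> X) (x y : X) :
  radon_Rplus mu ->
  laplace_transformable mu ->
  (* f = L mu is a potential: completely monotone and f = 1/g, g <> 0 Bernstein *)
  completely_monotone (Laplace mu) ->
  bernstein_data a b nu ->
  (exists z : R, 0 < z /\ bernstein a b nu z != 0) ->
  (forall z : R, 0 < z -> Laplace mu z = (bernstein a b nu z)^-1) ->
  (* f(0+) = oo *)
  Laplace mu z @[z --> 0^'+] --> +oo ->
  (* -A generates the bounded C_0-semigroup T *)
  bounded_C0_semigroup T ->
  (* weak-lim_{alpha -> 0+} \int_0^oo e^{-alpha s} T(s) x mu(ds) = y *)
  (forall phi : X -> CC R, dual_fun phi ->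
     phi (vint mu `[0%R, +oo[ (fun s => Rc (expR (- (al * s))) *: T s x))
       @[al --> 0^'+] --> phi y) ->
  (* (a) *)
  (hp_calc_eq T (bernsteinC a b nu) y x /\
   exists M t0 : R, forall t, t0 <= t ->
     `|cesaro_mean T t x| <= Rc (M / Laplace mu t^-1)) /\
  (* (b) *)
  ((fun t => t / Laplace mu t^-1) @ +oo --> +oo ->
   forall eps : R, 0 < eps -> exists t0 : R, forall t, t0 <= t ->
     `|cesaro_mean T t x| <= Rc (eps / Laplace mu t^-1)).
Proof.
move=> _ muL _ bda _ fE finf sgT wl.
have a0 := bernstein_constant0 R a b mu nu bda fE finf; subst a.
have [M TM] := sg_bounded R X T sgT.
have nrmE t (c : R) : 0 < t -> nrm R X (cesaro_mean T t x) <= c * bernstein 0 b nu t^-1 ->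
    `|cesaro_mean T t x| <= Rc (c / Laplace mu t^-1).
  by move=> t0 h; rewrite normE ler_Rc fE ?invr_gt0// invrK.
split; last first.
  move=> tf e e0.
  have tg : t * bernstein 0 b nu t^-1 @[t --> +oo] --> +oo.
    apply: cvg_trans tf; apply: near_eq_cvg.
    have := nbhs_pinfty_gt (num_real (0 : R)); apply: filterS => t t0.
    by rewrite fE ?invr_gt0// invrK.
  have [t0 ht0] := cesaro_mean_littleo R X b mu nu T x y muL bda fE finf sgT wl M TM tg e e0.
  exists (Num.max t0 1) => t; rewrite ge_max => /andP[t0t t1].
  by apply: nrmE; [exact: lt_le_trans t1|exact: ht0].
split; last first.
  eexists; exists 1 => t t1; have t0 : 0 < t := lt_le_trans ltr01 t1.
  apply: nrmE => //.
  exact: (cesaro_mean_bigO R X b mu nu T x y muL bda fE finf sgT wl M TM t t0).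
have key rho sigma : regularizer T (bernsteinC 0 b nu) rho sigma -> HP T rho x = HP T sigma y.
  move=> [br bs sym _].
  exact: (HP_regularized R X T sgT b mu nu x y rho sigma muL bda fE finf wl br bs sym).
split=> //.
have [rho [sigma reg]] := regularizer_exists R X T sgT b nu bda.
by exists rho, sigma; split => //; exact: key.
Qed.
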